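(* Let $\Omega=B_1$, fix $\lambda>0$, let $\{Q_{\rm b}^j\}\subset C^{1,1}(\partial B_1;\mathbb{S}^4)$ be the $\mathbb{S}^1$-equivariant boundary data defined by $Q^j_{\rm b}=Q_{1,\nu_j}$ for a sequence $\nu_j\downarrow0$ (with $Q_{\mu_1,\mu_2}$ as defined in the context), and fix $j$ large enough such that no minimizer of $\mathcal{E}_\lambda$ over $\mathcal{A}_{Q_{\rm b}^j}(\Omega)$ is $\mathbb{S}^1$-equivariant. Then, for each $\mu>0$ large enough, any minimizer $\bar Q^j_\mu$ of $$\mathcal{F}_{\lambda,\mu}(Q)=\int_\Omega\frac12|\nabla Q|^2+\lambda W(Q)+\frac\mu4(1-|Q|^2)^2\,dx$$ over $W^{1,2}_{Q_{\rm b}^j}(\Omega;\mathcal{S}_0)$ is not $\mathbb{S}^1$-equivariant.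
   Context: $B_1$ is the open unit ball of $\mathbb{R}^3$. $\mathcal{S}_0$ is the 5-dimensional space of real symmetric traceless $3\times3$ matrices with norm $|Q|^2=\mathrm{tr}(Q^2)$; $\mathbb{S}^4=\{Q\in\mathcal{S}_0:|Q|=1\}$. $\mathbb{S}^1$ is identified with the group of rotations $R$ about the $x_3$-axis; a map $Q$ with values in $\mathcal{S}_0$ is $\mathbb{S}^1$-equivariant if $Q(Rx)=RQ(x)R^t$ for (a.e.) $x$ and all $R\in\mathbb{S}^1$. The potential is $W(Q)=\frac1{4\sqrt6}|Q|^4-\frac13\mathrm{tr}(Q^3)+\frac1{12\sqrt6}$ for $Q\in\mathcal{S}_0$. $\mathcal{E}_\lambda(Q)=\int_\Omega\frac12|\nabla Q|^2+\lambda W(Q)\,dx$ for $Q\in W^{1,2}(\Omega;\mathbb{S}^4)$. $\mathcal{A}_{Q_{\rm b}}(\Omega)=\{Q\in W^{1,2}(\Omega;\mathbb{S}^4):Q|_{\partial\Omega}=Q_{\rm b}\}$ and $W^{1,2}_{Q_{\rm b}}(\Omega;\mathcal{S}_0)=\{Q\in W^{1,2}(\Omega;\mathcal{S}_0):Q|_{\partial\Omega}=Q_{\rm b}\}$. Identification $\mathcal{S}_0\simeq\mathbb{R}\oplus\mathbb{C}\oplus\mathbb{C}$: $(t,\zeta_1,\zeta_2)$ corresponds to $t\,\mathbf{e}_0+\mathrm{Re}\zeta_1\,\mathbf{e}^{(1)}_1+\mathrm{Im}\zeta_1\,\mathbf{e}^{(1)}_2+\mathrm{Re}\zeta_2\,\mathbf{e}^{(2)}_1+\mathrm{Im}\zeta_2\,\mathbf{e}^{(2)}_2$,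 where $\mathbf{e}_0=\frac1{\sqrt6}\mathrm{diag}(-1,-1,2)$, $\mathbf{e}^{(1)}_1=\frac1{\sqrt2}(E_{13}+E_{31})$, $\mathbf{e}^{(1)}_2=\frac1{\sqrt2}(E_{23}+E_{32})$, $\mathbf{e}^{(2)}_1=\frac1{\sqrt2}(E_{11}-E_{22})$, $\mathbf{e}^{(2)}_2=\frac1{\sqrt2}(E_{12}+E_{21})$, $E_{kl}$ being the matrix units. For $\mu_1,\mu_2\in\mathbb{C}$, $Q_{\mu_1,\mu_2}:\partial B_1=\mathbb{S}^2\to\mathbb{S}^4$ is the real-analytic $\mathbb{S}^1$-equivariant map given, under this identification and with $x\in\mathbb{S}^2$ corresponding to $[z_0,z_1]\in\mathbb{C}P^1$ via $z_1/z_0=\frac{x_1+ix_2}{1+x_3}$ (the south pole $(0,0,-1)$ corresponding to $[0,1]$), by $$\frac1D\Big(|z_0|^6-|\mu_1|^2|z_0|^4|z_1|^2-|\mu_2|^2|z_0|^2|z_1|^4+\tfrac{|\mu_1|^2|\mu_2|^2}{9}|z_1|^6,\ 2\mu_1\overline{z_0}z_1\big(|z_0|^4-\tfrac{|\mu_2|^2}{3}|z_1|^4\big),\ 2\mu_2\overline{z_0}^2z_1^2\big(|z_0|^2+\tfrac{|\mu_1|^2}{3}|z_1|^2\big)\Big),$$ $D=|z_0|^6+|\mu_1|^2|z_0|^4|z_1|^2+|\mu_2|^2|z_0|^2|z_1|^4+\frac{|\mu_1|^2|\mu_2|^2}{9}|z_1|^6$. *)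

(* Defs.v *)
From HB Require Import structures.
From mathcomp Require Import all_boot all_order all_algebra.
From mathcomp Require Import all_classical all_reals all_analysis.
From mathcomp Require Import complex.
Set Implicit Arguments.
Unset Strict Implicit.
Unset Printing Implicit Defensive.
Import Order.TTheory GRing.Theory Num.Theory.
Import numFieldNormedType.Exports.
Local Open Scope classical_set_scope.
Local Open Scope ring_scope.
Local Open Scope complex_scope.

(* Points of R^3 are triples, so that the product sigma-algebra (Borel sets)
   and the product Lebesgue measure apply.  The library norm on this product
   is the sup norm; it is used only for its topology, the Euclidean norm
   being written out. *)
Notation R3 R := (R * R * R)%type (only parsing).
(* The same type, with the Borel structure that carries lebesgue_measure. *)
Notation mR3 R :=
  (measurableTypeR R * measurableTypeR R * measurableTypeR R)%type
  (only parsing).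

Definition leb3 {R : realType} : set (mR3 R) -> \bar R :=
  ((@lebesgue_measure R \x @lebesgue_measure R) \x @lebesgue_measure R)%E.
HB.instance Definition _ (R : realType) := Measure.on (@leb3 R).

Section Space.
Context {R : realType}.
Implicit Types (x : R3 R) (Omega : set (R3 R)).

Definition normsq3 x : R := x.1.1 ^+ 2 + x.1.2 ^+ 2 + x.2 ^+ 2.

Definition B1 : set (R3 R) := [set x | normsq3 x < 1].
Definition B1bar : set (R3 R) := [set x | normsq3 x <= 1].

Definition basis3 (k : 'I_3) : R3 R :=
  ((val k == 0%N)%:R, (val k == 1%N)%:R, (val k == 2%N)%:R).

Definition to_col x : 'cV[R]_3 := \col_(i < 3) [:: x.1.1; x.1.2; x.2]`_i.
Definition of_col (v : 'cV[R]_3) : R3 R :=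
  (v (inord 0) 0, v (inord 1) 0, v (inord 2) 0).

(* The integral over the unit sphere against surface measure, in spherical
   coordinates (colatitude phi, longitude theta). *)
Definition sphere_pt (phi theta : R) : R3 R :=
  (sin phi * cos theta, sin phi * sin theta, cos phi).
Definition sphere_integral (f : R3 R -> R) : \bar R :=
  (\int[lebesgue_measure]_(theta in `[0%R, (2 * pi)%R])
    \int[lebesgue_measure]_(phi in `[0%R, pi])
      (f (sphere_pt phi theta) * sin phi)%:E)%E.

End Space.

Section Sobolev.
Context {R : realType}.
Variable Omega : set (R3 R).
Implicit Types (u v g phi : R3 R -> R) (k : 'I_3).

Fixpoint Cn (n : nat) phi : Prop :=
  continuous phi /\
  if n is m.+1 then
    forall k, (forall x, derivable phi x (basis3 k)) /\
              Cn m (fun x => 'D_(basis3 k) phi x)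
  else True.

Definition test_function phi : Prop :=
  (forall n, Cn n phi) /\
  exists K : set (R3 R), [/\ compact K, K `<=` Omega &
    forall x, ~ K x -> phi x = 0].

Definition L2 u : Prop :=
  measurable_fun (Omega : set (mR3 R)) u /\
  (\int[leb3]_(x in Omega) (u x ^+ 2)%:E < +oo)%E.

(* g is the weak derivative of u in direction k, and lies in L^2. *)
Definition is_weak_partial k u g : Prop :=
  L2 g /\
  forall phi, test_function phi ->
    (\int[leb3]_(x in Omega) (u x * 'D_(basis3 k) phi x)%:E =
     - \int[leb3]_(x in Omega) (g x * phi x)%:E)%E.

Definition W12 u : Prop :=
  L2 u /\ forall k, exists g, is_weak_partial k u g.

(* For u in W^{1,2} this is well defined up to a null set; the default value
   (the zero function) is never used there. *)
Definition wpartial k u : R3 R -> R :=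
  xget (fun=> 0) [set g | is_weak_partial k u g].

(* The square of the W^{1,2} distance. *)
Definition W12_distsq u v : \bar R :=
  (\int[leb3]_(x in Omega)
    ((u x - v x) ^+ 2 +
     \sum_(k < 3) (wpartial k u x - wpartial k v x) ^+ 2)%:E)%E.

End Sobolev.

(* The trace operator W^{1,2}(B_1) -> L^2(S^2) is the continuous extension of
   the restriction map on W^{1,2}(B_1) /\ C(closure of B_1), a dense subspace;
   the following is the relation "the trace of u is g". *)
Definition has_trace {R : realType} (u g : R3 R -> R) : Prop :=
  exists v : nat -> R3 R -> R,
  [/\ forall n, W12 B1 (v n),
      forall n, {within B1bar, continuous (v n)},
      (fun n => W12_distsq B1 (v n) u) @ \oo --> 0%E &
      (fun n => sphere_integral (fun x => (v n x - g x) ^+ 2)) @ \oo --> 0%E].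

Section QTensors.
Context {R : realType}.
Local Notation M3 := 'M[R]_3.
Implicit Types (A : M3) (Q P : R3 R -> M3) (Omega : set (R3 R)).

Definition S0 : set M3 := [set A | A^T = A /\ \tr A = 0].
Definition normsq A : R := \tr (A ^+ 2).
Definition S4 : set M3 := [set A | S0 A /\ normsq A = 1].

Definition Wpot A : R :=
  (4 * Num.sqrt 6)^-1 * normsq A ^+ 2 - 3^-1 * \tr (A ^+ 3)
  + (12 * Num.sqrt 6)^-1.

(* W^{1,2}(Omega; X): the entries are in W^{1,2}, the values a.e. in X. *)
Definition W12_into Omega (X : set M3) : set (R3 R -> M3) :=
  [set Q : R3 R -> M3 | (forall i j, W12 Omega (fun x => Q x i j)) /\
           {ae leb3, forall x, Omega x -> X (Q x)}].

Definition dpartial Omega (k : 'I_3) Q (x : R3 R) : M3 :=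
  \matrix_(i < 3, j < 3) wpartial Omega k (fun y => Q y i j) x.

Definition grad_normsq Omega Q (x : R3 R) : R :=
  \sum_(k < 3) normsq (dpartial Omega k Q x).

(* Q = Qb on the unit sphere, in the sense of traces. *)
Definition trace_eq Q (Qb : R3 R -> M3) : Prop :=
  forall i j, has_trace (fun x => Q x i j) (fun x => Qb x i j).

Definition A_class (Qb : R3 R -> M3) : set (R3 R -> M3) :=
  [set Q : R3 R -> M3 | W12_into B1 S4 Q /\ trace_eq Q Qb].
Definition W12_class (Qb : R3 R -> M3) : set (R3 R -> M3) :=
  [set Q : R3 R -> M3 | W12_into B1 S0 Q /\ trace_eq Q Qb].

Definition energyE (lambda : R) Q : \bar R :=
  (\int[leb3]_(x in B1)
    (2^-1 * grad_normsq B1 Q x + lambda * Wpot (Q x))%:E)%E.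

Definition energyF (lambda mu : R) Q : \bar R :=
  (\int[leb3]_(x in B1)
    (2^-1 * grad_normsq B1 Q x + lambda * Wpot (Q x)
     + mu / 4 * (1 - normsq (Q x)) ^+ 2)%:E)%E.

Definition minimizer (E : (R3 R -> M3) -> \bar R)
    (C : set (R3 R -> M3)) Q : Prop :=
  C Q /\ forall P, C P -> (E Q <= E P)%E.

Definition rotz (alpha : R) : M3 :=
  \matrix_(i < 3, j < 3)
    (nth [::] [:: [:: cos alpha; - sin alpha; 0];
                  [:: sin alpha;   cos alpha; 0];
                  [:: 0        ;   0        ; 1] ] i)`_j.

Definition equivariant Q : Prop :=
  forall alpha, {ae leb3, forall x, B1 x ->
    Q (of_col (rotz alpha *m to_col x)) =
    rotz alpha *m Q x *m (rotz alpha)^T}.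

(* S_0 = R + C + C; Eu k l is the matrix unit E_{k+1,l+1}. *)
Definition Eu (k l : nat) : M3 := delta_mx (inord k) (inord l).
Definition e0 : M3 :=
  (Num.sqrt 6)^-1 *: (2 *: Eu 2 2 - Eu 0 0 - Eu 1 1).
Definition e11 : M3 := (Num.sqrt 2)^-1 *: (Eu 0 2 + Eu 2 0).
Definition e12 : M3 := (Num.sqrt 2)^-1 *: (Eu 1 2 + Eu 2 1).
Definition e21 : M3 := (Num.sqrt 2)^-1 *: (Eu 0 0 - Eu 1 1).
Definition e22 : M3 := (Num.sqrt 2)^-1 *: (Eu 0 1 + Eu 1 0).

Definition of_coords (t : R) (zeta1 zeta2 : R[i]) : M3 :=
  t *: e0 + complex.Re zeta1 *: e11 + complex.Im zeta1 *: e12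
          + complex.Re zeta2 *: e21 + complex.Im zeta2 *: e22.

(* Homogeneous coordinates [z0, z1] with z1 / z0 = (x1 + i x2) / (1 + x3). *)
Definition hom_coords (x : R3 R) : R[i] * R[i] :=
  if x.2 == -1 then (0, 1) else ((1 + x.2)%:C, x.1.1 +i* x.1.2).

(* Depends on [z0, z1] only; meant for x on the unit sphere. *)
Definition Qmu (mu1 mu2 : R[i]) (x : R3 R) : M3 :=
  let: (z0, z1) := hom_coords x in
  let a := ComplexField.Normc.normc z0 in
  let b := ComplexField.Normc.normc z1 in
  let m1 := ComplexField.Normc.normc mu1 in
  let m2 := ComplexField.Normc.normc mu2 in
  let D := a ^+ 6 + m1 ^+ 2 * a ^+ 4 * b ^+ 2 + m2 ^+ 2 * a ^+ 2 * b ^+ 4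
           + m1 ^+ 2 * m2 ^+ 2 / 9 * b ^+ 6 in
  D^-1 *: of_coords
    (a ^+ 6 - m1 ^+ 2 * a ^+ 4 * b ^+ 2 - m2 ^+ 2 * a ^+ 2 * b ^+ 4
     + m1 ^+ 2 * m2 ^+ 2 / 9 * b ^+ 6)
    (2 * mu1 * conjc z0 * z1 * (a ^+ 4 - m2 ^+ 2 / 3 * b ^+ 4)%:C)
    (2 * mu2 * conjc z0 ^+ 2 * z1 ^+ 2 * (a ^+ 2 + m1 ^+ 2 / 3 * b ^+ 2)%:C).

End QTensors.

(* Main.v *)
(* Suppose that for parameters mu_n >= n + 1 there are equivariant minimizers
   Q_n of F_{lambda, mu_n}.  An explicit competitor with values in S^4 bounds
   their W^{1,2} norms and forces the penalty to 0.  By Rellich a subsequence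
   converges a.e. to some Q, which has values in S^4 by Fatou; by Mazur, convex
   combinations of the Q_n converge to Q in W^{1,2}, so Q keeps the trace, and
   the energy is lower semicontinuous.  Since F_{lambda, mu} = E_lambda on
   S^4-valued maps, E_lambda(Q) <= E_lambda(P) for every admissible P.  Q is
   the pointwise limit wherever it exists and 0 elsewhere, so equivariance is
   inherited pointwise: this contradicts the choice of j.

   Every function with a trace is a W^{1,2}-limit of functions continuous on
   the closed ball, for which Poincare's inequality on boxes follows by
   repeated halving; Rellich follows from it and from an ultrafilter along
   which the means over all boxes converge. *)
Require Import Defs.
From HB Require Import structures.
From mathcomp Require Import all_boot all_order all_algebra.
From mathcomp Require Import all_classical all_reals all_analysis.
From mathcomp Require Import measurable_realfun complex ring lra.
Import Order.TTheory GRing.Theory Num.Theory.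
Import numFieldNormedType.Exports.
Local Open Scope classical_set_scope.
Local Open Scope ring_scope.
Local Open Scope complex_scope.
Set Implicit Arguments.
Unset Strict Implicit.
Unset Printing Implicit Defensive.

(** * Square-integrable functions *)

(** The trace is a relation, the existence of approximants continuous up to the sphere, and not an
    operator. In place of a trace inequality the proof uses that this relation survives averages and
    strong limits; this is why weak compactness is replaced by convex combinations. A function and
    all its weak derivatives are averaged with the same weights, so that the limits still fit
    together.

    Compactness only has to deliver convergence almost everywhere: the values in S^4, the potential
    and equivariance are read at points, and Fatou does the rest. Boxes inside the open ball suffice
    for this, with no estimate up to the sphere.

    [wpartial] is a chosen representative. What is said about the gradient of a limit therefore
    rests on the uniqueness of weak derivatives, hence on the fundamental lemma of the calculus of
    variations.

    A competitor with values in S^4 has an energy independent of mu, and this gives all the uniform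
    bounds. It is a polynomial map to R^5 without zeros on the closed ball, divided by its norm.
    Nonnegativity of the potential on S_0 allows the energy to be split and each term to be bounded
    separately. *)

Section L2theory.
Context d (T : measurableType d) (R : realType).
Variables (mu : {measure set T -> \bar R}) (D : set T).
Hypothesis mD : measurable D.
Implicit Types f g h : T -> R.

(** For Lebesgue measure on [B1] this is convertible with [L2 B1], so the first component of a [W12]
    hypothesis serves directly as a proof of it. *)
Definition sqint f : Prop :=
  measurable_fun D f /\ (\int[mu]_(x in D) (f x ^+ 2)%:E < +oo)%E.

Definition intble f : Prop := mu.-integrable D (EFin \o f).

(** Real-valued for the sake of linear arithmetic. [fine] sends an infinite integral to 0, so this
    is the squared norm only in the presence of [sqint]. *)
Definition nsq f : R := \int[mu]_(x in D) (f x ^+ 2).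

Lemma intbleD f g : intble f -> intble g -> intble (fun x => f x + g x).
Proof.
move=> hf hg; have := integrableD mD hf hg.
by apply: eq_integrable.
Qed.

Lemma intbleZ (c : R) f : intble f -> intble (fun x => c * f x).
Proof.
by move=> hf; have := integrableZl mD c hf; apply: eq_integrable.
Qed.

Lemma sqint_intble f : sqint f -> intble (fun x => f x ^+ 2).
Proof.
move=> [mf ff]; apply/integrableP; split.
  by apply/measurable_EFinP; exact: measurable_funX.
apply: le_lt_trans ff; rewrite le_eqVlt; apply/orP; left; apply/eqP.
by apply: eq_integral => x _ /=; rewrite ger0_norm// sqr_ge0.
Qed.

Lemma intble_sqint f : measurable_fun D f -> intble (fun x => f x ^+ 2) ->
  sqint f.
Proof.
move=> mf hf; split=> //; have /integrableP[_] := hf.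
apply: le_lt_trans; rewrite le_eqVlt; apply/orP; left; apply/eqP.
by apply: eq_integral => x _ /=; rewrite ger0_norm// sqr_ge0.
Qed.

Lemma nsqE f : sqint f -> (nsq f)%:E = (\int[mu]_(x in D) (f x ^+ 2)%:E)%E.
Proof.
by move=> /sqint_intble hf; rewrite /nsq /Rintegral fineK// integrable_fin_num.
Qed.

Lemma nsq_ge0 f : 0 <= nsq f.
Proof. by apply: Rintegral_ge0 => x _; exact: sqr_ge0. Qed.

Lemma le_intble f g : measurable_fun D f -> intble g ->
  (forall x, D x -> `|f x| <= g x) -> intble f.
Proof.
move=> mf ig fg; apply: (le_integrable mD _ _ ig).
  exact/measurable_EFinP.
by move=> x Dx /=; rewrite lee_fin (le_trans (fg x Dx))// ler_norm.
Qed.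

Lemma sqintM_intble f g : sqint f -> sqint g -> intble (fun x => f x * g x).
Proof.
move=> hf hg.
have h := intbleD (sqint_intble hf) (sqint_intble hg).
apply: (le_intble _ h).
  by apply: measurable_funM; [case: hf|case: hg].
move=> x _; rewrite ler_norml; nra.
Qed.

Lemma sqintZ c f : sqint f -> sqint (fun x => c * f x).
Proof.
move=> hf; apply: intble_sqint.
  by apply: measurable_funM; [exact: measurable_cst|case: hf].
have -> : (fun x => (c * f x) ^+ 2) = (fun x => c ^+ 2 * f x ^+ 2).
  by apply/funext => x; rewrite exprMn.
exact/intbleZ/sqint_intble.
Qed.

Lemma sqintD f g : sqint f -> sqint g -> sqint (fun x => f x + g x).
Proof.
move=> hf hg; apply: intble_sqint.
  by apply: measurable_funD; [case: hf|case: hg].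
have -> : (fun x => (f x + g x) ^+ 2)
   = (fun x => f x ^+ 2 + (2 * (f x * g x) + g x ^+ 2)).
  by apply/funext => x; ring.
apply: intbleD; first exact: sqint_intble.
by apply: intbleD; [exact/intbleZ/sqintM_intble|exact: sqint_intble].
Qed.

Lemma sqintB f g : sqint f -> sqint g -> sqint (fun x => f x - g x).
Proof.
move=> hf /(sqintZ (-1)) hg; have := sqintD hf hg.
by congr sqint; apply/funext => x; rewrite mulN1r.
Qed.

Lemma intble_cst (c : R) : (mu D < +oo)%E -> intble (fun=> c).
Proof.
move=> Dfin; apply/integrableP; split; first exact/measurable_EFinP.
rewrite integral_cst// lte_mul_pinfty// ?lee_fin//.
Qed.

Lemma sqint_bounded f (M : R) : (mu D < +oo)%E -> measurable_fun D f ->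
  (forall x, D x -> `|f x| <= M) -> sqint f.
Proof.
move=> Dfin mf fM; apply: intble_sqint => //.
apply: (@le_intble _ (fun=> M ^+ 2)); first exact: measurable_funX.
  exact: intble_cst.
move=> x Dx; rewrite normrX lerXn2r ?nnegrE ?fM//.
by rewrite (le_trans _ (fM x Dx)).
Qed.

Lemma sqint_intble1 f : (mu D < +oo)%E -> sqint f -> intble f.
Proof.
move=> Dfin hf.
have h1 : sqint (fun=> 1 : R).
  by apply: (@sqint_bounded _ 1) => // x _; rewrite normr1.
by have := sqintM_intble hf h1; congr intble; apply/funext => x; rewrite mulr1.
Qed.

Lemma nsq_polar (s t : R) f g : sqint f -> sqint g ->
  nsq (fun x => s * f x + t * g x) =
  s ^+ 2 * nsq f + 2 * s * t * (\int[mu]_(x in D) (f x * g x))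
  + t ^+ 2 * nsq g.
Proof.
move=> hf hg; rewrite /nsq.
rewrite -!RintegralZl//; try exact: sqint_intble; try exact: sqintM_intble.
rewrite -!RintegralD//.
- by apply: eq_Rintegral => x _; ring.
- by apply: intbleD; apply: intbleZ; [exact: sqint_intble|exact: sqintM_intble].
- exact/intbleZ/sqint_intble.
- exact/intbleZ/sqint_intble.
- exact/intbleZ/sqintM_intble.
Qed.

Lemma eq_nsq f g : (forall x, D x -> f x = g x) -> nsq f = nsq g.
Proof. by move=> fg; apply: eq_Rintegral => x /set_mem/fg ->. Qed.

Lemma nsqZ c f : sqint f -> nsq (fun x => c * f x) = c ^+ 2 * nsq f.
Proof.
move=> hf; rewrite /nsq -RintegralZl//; last exact: sqint_intble.
by apply: eq_Rintegral => x _; rewrite exprMn.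
Qed.

(** Stated through the midpoint, the operation that generates [hull]: [nsq_mid] and the Cauchy
    estimate in [mazur] are read off from it. *)
Lemma nsq_parallelogram f g : sqint f -> sqint g ->
  nsq (fun x => f x - g x) =
  2 * nsq f + 2 * nsq g - 4 * nsq (fun x => 2^-1 * (f x + g x)).
Proof.
move=> hf hg.
rewrite (@eq_nsq _ (fun x => 1 * f x + (-1) * g x)); last by move=> x _; ring.
rewrite (@eq_nsq (fun x => 2^-1 * (f x + g x))
  (fun x => 2^-1 * f x + 2^-1 * g x)); last by move=> x _; ring.
by rewrite !nsq_polar//; field.
Qed.

Lemma le_nsq_sum f g : sqint f -> sqint g ->
  nsq (fun x => f x + g x) <= 2 * nsq f + 2 * nsq g.
Proof.
move=> hf hg.
have hg' := sqintZ (-1) hg.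
have := nsq_parallelogram hf hg'.
have -> : nsq (fun x => f x - -1 * g x) = nsq (fun x => f x + g x).
  by apply: eq_nsq => x _; ring.
rewrite nsqZ// => ->; have := nsq_ge0 (fun x => 2^-1 * (f x + -1 * g x)); lra.
Qed.

Lemma nsq_mid f g : sqint f -> sqint g ->
  nsq (fun x => 2^-1 * (f x + g x)) <= (nsq f + nsq g) / 2.
Proof.
move=> hf hg; have := nsq_parallelogram hf hg.
have := nsq_ge0 (fun x => f x - g x); lra.
Qed.

Lemma cauchy_schwarz f g : sqint f -> sqint g ->
  (\int[mu]_(x in D) (f x * g x)) ^+ 2 <= nsq f * nsq g.
Proof.
move=> hf hg; set b := \int[mu]_(x in D) _.
have q s t : 0 <= s ^+ 2 * nsq f + 2 * s * t * b + t ^+ 2 * nsq g.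
  by rewrite -nsq_polar// nsq_ge0.
have a0 := nsq_ge0 f; have c0 := nsq_ge0 g.
(* At (b, -a) the form equals a (a c - b^2). The case a = 0 is separate: there (-(c + 1), b) gives
   -(c + 2) b^2, which forces b = 0. *)
have := q b (- nsq f); have := q (- nsq g) b; have := q 1 (- b).
move: a0 c0; set a := nsq f; set c := nsq g => a0 c0 h1 h2 h3.
have [a00|a00] := eqVneq a 0.
  have := q (- (c + 1)) b; rewrite -/a -/c a00; nra.
have {}a0 : 0 < a by rewrite lt_neqAle eq_sym a00.
have : 0 <= a * (a * c - b ^+ 2) by nra.
by rewrite pmulr_rge0// subr_ge0.
Qed.

Lemma le_nsq f g : sqint f -> sqint g ->
  (forall x, D x -> `|f x| <= `|g x|) -> nsq f <= nsq g.
Proof.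
move=> hf hg fg; apply: le_Rintegral => //; try exact: sqint_intble.
by move=> x Dx; rewrite -(real_normK (num_real (f x))) -(real_normK (num_real (g x))) lerXn2r ?nnegrE// fg.
Qed.

(** Off the exceptional set the limit is the lower limit of the integrands, so Fatou's inequality
    applies on [D] minus that set. For finite [C] the integrability of the limit is part of what is
    obtained. *)
Lemma fatou_ae (f_ : nat -> T -> R) f (C : \bar R) :
  (forall n, measurable_fun D (f_ n)) -> measurable_fun D f ->
  (forall n x, D x -> 0 <= f_ n x) -> (forall x, D x -> 0 <= f x) ->
  (forall n, (\int[mu]_(x in D) (f_ n x)%:E <= C)%E) ->
  {ae mu, forall x, D x -> f_ ^~ x @ \oo --> f x} ->
  (\int[mu]_(x in D) (f x)%:E <= C)%E.
Proof.
move=> mf_ mf f_0 f0 fC [N [mN N0 fN]].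
rewrite (ge0_negligible_integral mN)//; last exact/measurable_EFinP.
have mDN : measurable (D `\` N) by exact: measurableD.
have mDNf g : measurable_fun D g -> measurable_fun (D `\` N) (EFin \o g).
  by move=> mg; apply/measurable_EFinP; apply: measurable_funS mg.
rewrite (eq_integral (fun x => limn_einf (fun n => (f_ n x)%:E))); last first.
  move=> x /set_mem[Dx Nx]; apply/esym; apply: (cvg_limn_einf_sup _).1.
  apply: cvg_EFin; first exact: nearW.
  by apply: contrapT => h; apply: Nx; apply: fN => /= /(_ Dx).
apply: le_trans (fatou mu mDN _ _) _ => [n|n x [Dx _]|].
- exact: mDNf.
- by rewrite lee_fin f_0.
rewrite limn_einf_lim; apply: lime_le; first exact: is_cvg_einfs.
apply: nearW => n; apply: le_trans (fC n).
apply: (@le_trans _ _ (\int[mu]_(x in D `\` N) (f_ n x)%:E)%E).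
  by apply: ereal_inf_lbound; exists n => /=.
apply: ge0_subset_integral => //; first exact/measurable_EFinP.
by move=> x Dx; rewrite lee_fin f_0.
Qed.

Lemma fatou_nsq (f_ : nat -> T -> R) f (C : R) :
  (forall n, sqint (f_ n)) -> measurable_fun D f ->
  (forall n, nsq (f_ n) <= C) ->
  {ae mu, forall x, D x -> f_ ^~ x @ \oo --> f x} ->
  sqint f /\ nsq f <= C.
Proof.
move=> hf mf fC fcv.
have H : (\int[mu]_(x in D) (f x ^+ 2)%:E <= C%:E)%E.
  apply: (@fatou_ae (fun n x => f_ n x ^+ 2) (fun x => f x ^+ 2)).
  - by move=> n; apply/measurable_funX; case: (hf n).
  - exact/measurable_funX.
  - by move=> *; exact: sqr_ge0.
  - by move=> *; exact: sqr_ge0.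
  - by move=> n; rewrite -nsqE// lee_fin.
  - by apply: filterS fcv => x /= h /h fx; apply: cvgM.
have hf' : sqint f by split => //; apply: le_lt_trans H _; rewrite ltry.
by split => //; rewrite -lee_fin nsqE.
Qed.

(** The sum of [4 ^+ n * d_n ^+ 2] has an integral bounded by a geometric series of ratio 1/2, so it
    is finite almost everywhere. Where it equals s, each difference is at most (1 + s) 2^-n and the
    telescoping series converges. *)
Lemma ae_cvg_of_summable (f_ : nat -> T -> R) :
  (forall n, sqint (f_ n)) ->
  (forall n, nsq (fun x => f_ n.+1 x - f_ n x) <= (8^-1) ^+ n) ->
  {ae mu, forall x, D x -> cvgn (f_ ^~ x)}.
Proof.
move=> hf hd.
pose d_ n x := f_ n.+1 x - f_ n x.
have hdn n : sqint (d_ n) by exact: sqintB.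
pose S x := (\sum_(n <oo) (4 ^+ n * d_ n x ^+ 2)%:E)%E.
have d0 n x : (0 <= (4 ^+ n * d_ n x ^+ 2)%:E)%E.
  by rewrite lee_fin mulr_ge0// ?sqr_ge0// exprn_ge0.
have md n : measurable_fun D (fun x => (4 ^+ n * d_ n x ^+ 2)%:E).
  apply/measurable_EFinP/measurable_funM; first exact: measurable_cst.
  by apply/measurable_funX; case: (hdn n).
have S0 x : (0 <= S x)%E by apply: nneseries_ge0.
have iS : mu.-integrable D S.
  apply/integrableP; split.
    by apply: ge0_emeasurable_sum.
  under eq_integral do rewrite gee0_abs//.
  rewrite integral_nneseries//.
  apply: (@le_lt_trans _ _ (\sum_(n <oo) (2 / (2 ^ (n + 1))%:R)%:E)%E).
    apply: lee_nneseries => [n _ _|n _].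
      by apply: integral_ge0.
    under eq_integral do rewrite EFinM.
    rewrite ge0_integralZl_EFin ?exprn_ge0//; last 2 first.
      by move=> x _; rewrite lee_fin sqr_ge0.
      by apply/measurable_EFinP/measurable_funX; case: (hdn n).
    rewrite -nsqE// -EFinM lee_fin.
    apply: (@le_trans _ _ (4 ^+ n * 8^-1 ^+ n)).
      by rewrite ler_wpM2l ?exprn_ge0// hd.
    rewrite addn1 expnS natrM natrX invfM mulrA divff ?pnatr_eq0// mul1r.
    rewrite -exprMn -exprVn lerXn2r ?nnegrE//; lra.
  by rewrite (cvg_lim _ (@cvg_geometric_eseries_half R 2 0))// ltry.
have := integrable_ae mD iS; apply: filterS => x /= /[apply] Sfin.
pose s := fine (S x).
have sE : S x = s%:E by rewrite fineK.
have s0 : 0 <= s by rewrite -lee_fin -sE.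
have dle n : `|d_ n x| <= (1 + s) * 2^-1 ^+ n.
  have : ((4 ^+ n * d_ n x ^+ 2)%:E <= s%:E)%E.
    rewrite -sE /S (@nneseriesD1 _ _ n)//.
    by rewrite leeDl// nneseries_ge0.
  rewrite lee_fin => h.
  have : (2 ^+ n * `|d_ n x|) ^+ 2 <= s.
    by rewrite exprMn real_normK ?num_real// -exprM mulnC exprM (_ : 2 ^+ 2 = 4)//; ring.
  set y := (2 ^+ n * _) => hy.
  have y0 : 0 <= y by rewrite mulr_ge0// exprn_ge0.
  have y1 : y <= 1 + s by nra.
  rewrite exprVn ler_pdivlMr ?exprn_gt0// mulrC; exact: y1.
have : cvgn (series (d_ ^~ x)).
  apply: normed_cvg.
  apply: (series_le_cvg _ _ dle).
  - by move=> n.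
  - by move=> n; rewrite mulr_ge0 ?exprn_ge0//; lra.
  - by apply: is_cvg_geometric_series; rewrite ger0_norm; lra.
move=> cs.
have -> : f_ ^~ x = (fun n => f_ 0%N x + series (d_ ^~ x) n).
  apply/funext => n; by rewrite /series/= telescope_sumr// addrC subrK.
by apply: is_cvgD => //; exact: is_cvg_cst.
Qed.

(** Riesz-Fischer: a subsequence with differences below 8^-k converges almost everywhere, and Fatou
    in the second index turns the Cauchy bound into a bound on the distance to the limit. *)
Lemma sqint_complete (f_ : nat -> T -> R) :
  (forall n, sqint (f_ n)) ->
  (forall e : R, 0 < e -> exists N, forall n m, (N <= n)%N -> (N <= m)%N ->
     nsq (fun x => f_ n x - f_ m x) <= e) ->
  exists f, sqint f /\ forall e : R, 0 < e -> exists N, forall n, (N <= n)%N ->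
     nsq (fun x => f_ n x - f x) <= e.
Proof.
move=> hf hc.
have hc8 k : {N | forall n m, (N <= n)%N -> (N <= m)%N ->
     nsq (fun x => f_ n x - f_ m x) <= 8^-1 ^+ k}.
  by apply: cid; apply: hc; rewrite exprn_gt0// invr_gt0.
(* The sum exceeds the k-th threshold and makes [M] monotone; the summand [k] ensures [M k >= k]. *)
pose M k := (k + \sum_(i < k.+1) sval (hc8 i))%N.
have MS k : (M k <= M k.+1)%N by rewrite /M leq_add// [leqRHS]big_ord_recr leq_addr.
have Mhc k : (sval (hc8 k) <= M k)%N by rewrite /M big_ord_recr/= addnA leq_addl.
have Mm : {homo M : a b / (a <= b)%N} by apply: homo_leq => // a b c; exact: leq_trans.
have [k|k|N [mN N0 fN]] := @ae_cvg_of_summable (fun k => f_ (M k)).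
- exact: hf.
- by apply: (svalP (hc8 k)); rewrite ?(leq_trans (Mhc k)).
have mDN : measurable (D `\` N) by exact: measurableD.
(* Cut to 0 off [D] minus the null set, the sequence converges everywhere, so its limit is
   measurable. *)
pose g k := f_ (M k) \_ (D `\` N).
have gcv x : cvgn (g ^~ x).
  have [DNx|DNx] := pselect ((D `\` N) x); last first.
    rewrite (_ : g ^~ x = cst 0); first exact: is_cvg_cst.
    by apply/funext => k; rewrite /g patchE memNset.
  rewrite (_ : g ^~ x = (fun k => f_ (M k) x)).
    by apply: contrapT => h; apply: DNx.2; apply: fN => /= /(_ DNx.1).
  by apply/funext => k; rewrite /g patchE mem_set.
pose f x := limn (g ^~ x).
have mf : measurable_fun setT f.
  apply: (measurable_fun_cvg (h := g)) => [k|x _]; last exact: gcv.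
  apply/(measurable_restrictT _ _).1 => //.
  by apply: measurable_funS (hf (M k)).1.
have fcv : {ae mu, forall x, D x -> (fun k => f_ (M k) x) @ \oo --> f x}.
  exists N; split => // x /= h; apply: contrapT => Nx; apply: h => Dx.
  rewrite (_ : (fun k => _) = g ^~ x); first exact: gcv.
  by apply/funext => k; rewrite /g patchE mem_set.
have key (e : R) : 0 < e -> exists N, forall n, (N <= n)%N ->
     sqint (fun x => f_ n x - f x) /\ nsq (fun x => f_ n x - f x) <= e.
  move=> e0; have [K hK] := hc e e0; exists K => n Kn.
  have hk0 : (K <= M K)%N by rewrite /M leq_addr.
  apply: (@fatou_nsq (fun k x => f_ n x - f_ (M (k + K)%N) x)).
  - by move=> k; apply: sqintB.
  - by apply: measurable_funB; [case: (hf n)|exact: measurable_funS mf].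
  - by move=> k; apply: hK => //; rewrite (leq_trans hk0)// Mm// leq_addl.
  - apply: filterS fcv => x /= /[apply] fx; apply: cvgB; first exact: cvg_cst.
    by move: fx; rewrite -(cvg_shiftn K).
exists f; split; last by move=> e /key[K hK]; exists K => n /hK[].
have [K hK] := key 1 ltr01.
have [h _] := hK K (leqnn _).
have := sqintB (hf K) h; congr sqint; apply/funext => x; ring.
Qed.

End L2theory.

(** * Smooth bumps and tents on the line *)

Section Smooth.
Context {R : realType}.
Implicit Types f g : R -> R.

(** The derivative is an existential witness, so products and affine changes of variable are handled
    by induction without any formula for higher derivatives. *)
Fixpoint smooth_upto (n : nat) f : Prop :=
  if n is m.+1 then
    exists f' : R -> R, (forall x : R, is_derive x (1 : R) f (f' x)) /\ smooth_upto m f'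
  else continuous f.

Definition smooth f := forall n, smooth_upto n f.

Lemma is_derive_continuous f f' :
  (forall x : R, is_derive x (1 : R) f (f' x)) -> continuous f.
Proof.
by move=> h x; apply: differentiable_continuous; apply/derivable1_diffP; case: (h x).
Qed.

Lemma smooth_upto_continuous n f : smooth_upto n f -> continuous f.
Proof. by case: n => [//|n] [f' [h _]]; exact: is_derive_continuous h. Qed.

Lemma smooth_upto_pred n f : smooth_upto n.+1 f -> smooth_upto n f.
Proof.
elim: n f => [f /smooth_upto_continuous//|n ih f [f' [h sf']]].
by exists f'; split => //; exact: ih.
Qed.

Lemma smooth_upto_cst n c : smooth_upto n (fun=> c).
Proof.
elim: n c => [c|n ih c]; first exact: cst_continuous.
by exists (fun=> 0); split => // x; exact: is_derive_cst.
Qed.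

Lemma smooth_upto_id n : smooth_upto n id.
Proof.
case: n => [|n]; first by move=> x; exact: cvg_id.
by exists (fun=> 1); split => [x|]; [exact: is_derive_id|exact: smooth_upto_cst].
Qed.

Lemma smooth_uptoD n f g : smooth_upto n f -> smooth_upto n g ->
  smooth_upto n (fun x => f x + g x).
Proof.
elim: n f g => [f g cf cg x|n ih f g [f' [hf sf]] [g' [hg sg]]].
  by apply: cvgD; [exact: cf|exact: cg].
by exists (fun x => f' x + g' x); split => [x|]; [exact: is_deriveD|exact: ih].
Qed.

Lemma smooth_uptoM n f g : smooth_upto n f -> smooth_upto n g ->
  smooth_upto n (fun x => f x * g x).
Proof.
elim: n f g => [f g cf cg x|n ih f g].
  by apply: cvgM; [exact: cf|exact: cg].
move=> sf1 sg1; have sf := smooth_upto_pred sf1; have sg := smooth_upto_pred sg1.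
case: sf1 sg1 => [f' [hf sf']] [g' [hg sg']].
exists (fun x => f x * g' x + g x * f' x); split => [x|].
  exact: is_deriveM.
by apply: smooth_uptoD; apply: ih.
Qed.

Lemma is_derive_affine f (a b x df : R) : is_derive (a * x + b) (1 : R) f df ->
  is_derive x (1 : R) (fun x => f (a * x + b)) (a * df).
Proof.
move=> hf.
have hl : is_derive x (1 : R) (fun x : R => a * x + b) a.
  have := is_deriveD (is_deriveZ a (is_derive_id x (1 : R))) (is_derive_cst b x (1 : R)).
  by rewrite addr0 /GRing.scale/= mulr1.
have := @is_derive1_comp R f (fun x : R => a * x + b) x _ _ hf hl.
by rewrite mulrC; exact.
Qed.

Lemma smooth_upto_affine n f (a b : R) : smooth_upto n f ->
  smooth_upto n (fun x => f (a * x + b)).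
Proof.
elim: n f => [f cf x|n ih f [f' [hf sf]]].
  apply: (@continuous_comp _ _ _ (fun x => a * x + b) f); last exact: cf.
  by apply: cvgD; [apply: cvgM; [exact: cvg_cst|exact: cvg_id]|exact: cvg_cst].
exists (fun x => a * f' (a * x + b)); split; last first.
  by apply: smooth_uptoM; [exact: smooth_upto_cst|exact: ih].
by move=> x; exact: is_derive_affine.
Qed.

(** [flat 0] is the classical exp(-1/t). The powers of 1/t make the family closed under
    differentiation, the derivative of [flat n] being [flat n.+2] minus n times [flat n.+1], so all
    members are proved smooth together. *)
Definition flat (n : nat) (t : R) : R :=
  if 0 < t then t^-1 ^+ n * expR (- t^-1) else 0.

Lemma flat_ge0 n t : 0 <= flat n t.
Proof.
rewrite /flat; case: ifPn => // t0.
by rewrite mulr_ge0 ?expR_ge0// exprn_ge0// invr_ge0 ltW.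
Qed.

(** With s = 1/t this says s^n <= n! exp(s), by one term of the exponential series. It is the source
    of the bounds that are uniform in the scale [m]. *)
Lemma flat_le n t : flat n t <= n`!%:R.
Proof.
rewrite /flat; case: ifPn => [t0|_]; last exact: ler0n.
have s0 : 0 <= t^-1 by rewrite invr_ge0 ltW.
rewrite expRN ler_pdivrMr ?expR_gt0// mulrC -ler_pdivrMr ?ltr0n ?fact_gt0//.
case: n => [|n].
  by rewrite expr0 fact0 divr1 (le_trans _ (expR_ge1Dx _))// lerDl.
by apply: le_trans (expR_ge1Dxn n s0); rewrite lerDr.
Qed.

Lemma flat_le0 n t : t <= 0 -> flat n t = 0.
Proof. by rewrite /flat; case: ltP. Qed.

Lemma flatS n t : flat n.+1 t * t = flat n t.
Proof.
rewrite /flat; case: ltP => [t0|]; last by rewrite mul0r.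
by rewrite exprSr mulrAC -(mulrA _ _ t) mulVf ?gt_eqF// mulr1.
Qed.

Lemma flat_continuous0 n : {for (0 : R), continuous (flat n)}.
Proof.
apply/cvgrPdist_le => /= e e0.
rewrite (flat_le0 n (lexx 0)).
have c0 : 0 < (n.+1)`!%:R :> R by rewrite ltr0n fact_gt0.
near=> z.
rewrite sub0r normrN -flatS normrM ger0_norm ?flat_ge0//.
rewrite (le_trans (ler_wpM2r _ (flat_le _ _)))//.
rewrite mulrC -ler_pdivlMr//.
near: z; exact: (@nbhs0_le _ R _ (divr_gt0 e0 c0)).
Unshelve. all: by end_near. Qed.

Lemma is_derive_flat n (t : R) : is_derive t (1 : R) (flat n)
  (flat n.+2 t - n%:R * flat n.+1 t).
Proof.
have [t0|t0|->] := ltgtP t 0.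
- rewrite !flat_le0 ?ltW// mulr0 subr0.
  apply: (@near_eq_is_derive _ _ _ (fun=> 0) _ t).
    by near=> z; rewrite flat_le0// ltW//; near: z; exact: lt_nbhsl.
- have tV : is_derive t (1 : R) (fun x : R => x^-1) (- t ^- 2).
    have := @is_deriveV R id t 1 1; rewrite /GRing.scale/= mulr1; apply.
    by rewrite gt_eqF.
  apply: (@near_eq_is_derive R R R (fun x : R => x^-1 ^+ n * expR (- x^-1)) (flat n) t 1).
    by near=> z; rewrite /flat ifT//; near: z; exact: lt_nbhsr.
  have tX := is_deriveX n tV.
  have tE := @is_derive1_comp R expR (fun x : R => - x^-1) t _ _ (is_derive_expR _) (is_deriveN tV).
  have := is_deriveM tX tE.
  have -> : (GRing.inv : R -> R) ^+ n * (expR \o (fun x : R => - x^-1))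
     = (fun x : R => x^-1 ^+ n * expR (- x^-1)).
    by rewrite exprfctE.
  move=> h; apply: is_derive_eq h _.
  rewrite /flat t0 /GRing.scale/= exprfctE opprK.
  have t0' : t != 0 by rewrite gt_eqF.
  case: n {tX} => [|n]; first by field.
  by rewrite /= !exprS; field.
(* At 0 the difference quotient of [flat n] is [flat n.+1], by [flatS]; its continuity at 0 gives
   the derivative. *)
- apply/is_derive1_caratheodory; exists (flat n.+1); split.
  + by move=> z; rewrite (flat_le0 _ (lexx 0)) !subr0 flatS.
  + exact: flat_continuous0.
  + by rewrite !flat_le0// mulr0 subr0.
Unshelve. all: by end_near. Qed.

Lemma smooth_upto_flat m n : smooth_upto m (flat n).
Proof.
elim: m n => [n|m ih n]; first exact: is_derive_continuous (is_derive_flat n).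
exists (fun t => flat n.+2 t - n%:R * flat n.+1 t); split; first exact: is_derive_flat.
apply: smooth_uptoD => //.
have -> : (fun t => - (n%:R * flat n.+1 t)) = (fun t => - n%:R * flat n.+1 t).
  by apply/funext => t; rewrite mulNr.
by apply: smooth_uptoM => //; exact: smooth_upto_cst.
Qed.

Lemma flat0_le1 t : flat 0 t <= 1.
Proof. exact: flat_le. Qed.

Lemma flat_scale_cvgS k (y : R) : flat k.+1 (n.+1%:R * y) @[n --> \oo] --> (0 : R).
Proof.
have [y0|y0] := ltP 0 y; last first.
  rewrite (_ : (fun n => _) = cst 0); first exact: cvg_cst.
  by apply/funext => n; rewrite flat_le0// mulr_ge0_le0.
apply: (@squeeze_cvgr _ _ _ _ (fun=> 0) (fun n => k`!%:R / y * n.+1%:R^-1)).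
- near=> n; rewrite flat_ge0/= -mulrA -invfM mulrC [y * _]mulrC.
  rewrite mulrC ler_pdivlMr ?mulr_gt0//.
  by rewrite flatS flat_le.
- exact: cvg_cst.
- rewrite -[X in _ --> X](mulr0 (k`!%:R / y)).
  by apply: cvgM; [exact: cvg_cst|exact: cvg_harmonic].
Unshelve. all: by end_near. Qed.

Lemma flat0_lower (y : R) : 0 < y -> 1 - y^-1 <= flat 0 y.
Proof. by move=> y0; rewrite /flat y0 expr0 mul1r expR_ge1Dx. Qed.

Lemma flat_scale_cvg0 (y : R) :
  flat 0 (n.+1%:R * y) @[n --> \oo] --> ((0 < y)%R%:R : R).
Proof.
have [y0|y0] := ltP 0 y; last first.
  rewrite (_ : (fun n => _) = cst 0); first exact: cvg_cst.
  by apply/funext => n; rewrite flat_le0// mulr_ge0_le0.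
apply: (@squeeze_cvgr _ _ _ _ (fun n => 1 - y^-1 * n.+1%:R^-1) (fun=> 1)).
- near=> n; rewrite flat0_le1 andbT -invfM mulrC flat0_lower//.
  by rewrite mulr_gt0.
- rewrite -[X in _ --> X]subr0 -[X in _ - X](mulr0 (y^-1)).
  apply: cvgB; first exact: cvg_cst.
  by apply: cvgM; [exact: cvg_cst|exact: cvg_harmonic].
- exact: cvg_cst.
Unshelve. all: by end_near. Qed.

(** As [m] grows, [flat 0 (m * y)] tends to 1 for y > 0 and stays 0 for y <= 0: a smooth
    approximation of the indicator of ]a, b[ which vanishes outside that interval. *)
Definition bump (m a b x : R) := flat 0 (m * (x - a)) * flat 0 (m * (b - x)).

Lemma bump_ge0 m a b x : 0 <= bump m a b x.
Proof. by rewrite mulr_ge0 ?flat_ge0. Qed.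

Lemma bump_le1 m a b x : bump m a b x <= 1.
Proof. by rewrite mulr_ile1 ?flat_ge0 ?flat0_le1. Qed.

Lemma bump_out m a b x : 0 <= m -> ~~ (a < x < b) -> bump m a b x = 0.
Proof.
move=> m0; rewrite negb_and -!leNgt => /orP[h|h]; rewrite /bump.
  by rewrite flat_le0 ?mul0r// mulr_ge0_le0// subr_le0.
by rewrite [X in _ * X]flat_le0 ?mulr0// mulr_ge0_le0// subr_le0.
Qed.

Lemma bump_cvg a b x : bump n.+1%:R a b x @[n --> \oo] --> ((a < x < b)%R%:R : R).
Proof.
have -> : ((a < x < b)%R%:R : R) = (0 < x - a)%R%:R * (0 < b - x)%R%:R.
  by rewrite !subr_gt0; case: (a < x); case: (x < b); rewrite ?mulr1 ?mulr0.
by apply: cvgM; exact: flat_scale_cvg0.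
Qed.

Lemma flat_affineE k m a : (fun x => flat k (m * (x - a))) =
  (fun x => flat k (m * x + (- (m * a)))).
Proof. by apply/funext => x; rewrite mulrBr. Qed.

Lemma flat_affineNE k m b : (fun x => flat k (m * (b - x))) =
  (fun x => flat k ((- m) * x + m * b)).
Proof. by apply/funext => x; rewrite mulrBr mulNr addrC. Qed.

Lemma smooth_bump m a b : smooth (bump m a b).
Proof.
move=> n; rewrite /bump; apply: smooth_uptoM.
  by rewrite flat_affineE; apply: smooth_upto_affine; exact: smooth_upto_flat.
by rewrite flat_affineNE; apply: smooth_upto_affine; exact: smooth_upto_flat.
Qed.

(** With c the midpoint, (x - a) - 2 (x - c)^+ has slope 1 before c and -1 after it; here the
    positive part is smoothed to y times [flat 0 (m * y)], with y = x - c. *)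
Definition tent_profile (m a b x : R) : R :=
  (x - a) - 2 * ((x - (a + b) / 2) * flat 0 (m * (x - (a + b) / 2))).

(* As [m] goes to infinity, a smooth approximation of [tent] whose derivative
   stays bounded and converges to [haar]. *)
Definition smooth_tent (m a b x : R) := bump m a b x * tent_profile m a b x.

(** The product rule, with y m [flat 2 (m * y)] rewritten as [flat 1 (m * y)]: the only factors [m]
    left outside a [flat] are multiplied by the profile, which is small near the ends of the
    interval. *)
Definition smooth_tent' (m a b x : R) :=
  (m * flat 2 (m * (x - a)) * flat 0 (m * (b - x))
   - m * flat 0 (m * (x - a)) * flat 2 (m * (b - x))) * tent_profile m a b x
  + bump m a b x * (1 - 2 * (flat 0 (m * (x - (a + b) / 2))
                             + flat 1 (m * (x - (a + b) / 2)))).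

Lemma smooth_smooth_tent m a b : smooth (smooth_tent m a b).
Proof.
move=> n; rewrite /smooth_tent; apply: smooth_uptoM; first exact: smooth_bump.
have sB (c : R) : smooth_upto n (fun x => x - c).
  by apply: smooth_uptoD; [exact: smooth_upto_id|exact: smooth_upto_cst].
rewrite /tent_profile; apply: smooth_uptoD => //.
rewrite (_ : (fun x => _) = (fun x => - 2 * ((x - (a + b) / 2) * flat 0 (m * (x - (a + b) / 2))))); last first.
  by apply/funext => x; rewrite mulNr.
apply: smooth_uptoM; first exact: smooth_upto_cst.
apply: smooth_uptoM => //.
by rewrite flat_affineE; apply: smooth_upto_affine; exact: smooth_upto_flat.
Qed.

Lemma is_derive_flat0_scale m a x :
  is_derive x (1 : R) (fun x => flat 0 (m * (x - a))) (m * flat 2 (m * (x - a))).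
Proof.
rewrite flat_affineE mulrBr; apply: is_derive_affine.
by have := is_derive_flat 0 (m * x - m * a); rewrite mul0r subr0.
Qed.

Lemma is_derive_flat0_scaleN m b x :
  is_derive x (1 : R) (fun x => flat 0 (m * (b - x))) (- (m * flat 2 (m * (b - x)))).
Proof.
rewrite flat_affineNE mulrBr (addrC (m * b)) -!mulNr; apply: is_derive_affine.
by have := is_derive_flat 0 (- m * x + m * b); rewrite mul0r subr0.
Qed.

Lemma is_derive_smooth_tent m a b x :
  is_derive x (1 : R) (smooth_tent m a b) (smooth_tent' m a b x).
Proof.
have d1 := is_deriveM (is_derive_flat0_scale m a x) (is_derive_flat0_scaleN m b x).
have d2 (c : R) : is_derive x (1 : R) (fun x : R => x - c) 1.
  by have := is_deriveB (is_derive_id x (1 : R)) (is_derive_cst c x (1 : R)); rewrite subr0.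
have d3 := is_deriveM (d2 ((a + b) / 2)) (is_derive_flat0_scale m ((a + b) / 2) x).
have d4 := is_deriveB (d2 a) (is_deriveZ 2 d3).
have h : is_derive x (1 : R) (smooth_tent m a b) _ := is_deriveM d1 d4.
apply: is_derive_eq h _.
rewrite /smooth_tent' /bump /tent_profile ?fctE /GRing.scale/=.
set y := x - (a + b) / 2.
rewrite -[2 *: _]/(2 * _).
have f1 : flat 1 (m * y) = y * (m * flat 2 (m * y)) by rewrite -flatS; ring.
rewrite f1; ring.
Qed.

Definition haar (a b x : R) : R :=
  if a < x < b then (if x <= (a + b) / 2 then 1 else -1) else 0.

Definition tent (a b x : R) : R :=
  if a < x < b then (x - a) - 2 * ((x - (a + b) / 2) * (0 < x - (a + b) / 2)%R%:R) else 0.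

Lemma tent_bound a b x : a <= b -> `|tent a b x| <= (b - a) / 2.
Proof.
move=> ab; rewrite /tent; case: ifPn => [/andP[ax xb]|_]; last first.
  by rewrite normr0; lra.
by rewrite ler_norml subr_gt0; case: ltP => h; rewrite ?mulr1 ?mulr0; lra.
Qed.

Lemma tent_profile_bound m a b x : 0 <= m -> a < x < b ->
  `|tent_profile m a b x| <= 3 * (x - a).
Proof.
move=> m0 /andP[ax xb]; rewrite /tent_profile.
have := flat_ge0 0 (m * (x - (a + b) / 2)).
have := flat0_le1 (m * (x - (a + b) / 2)).
have [h|h] := leP x ((a + b) / 2).
  rewrite flat_le0; last by rewrite mulr_ge0_le0// subr_le0.
  by rewrite mulr0 mulr0 subr0 ler_norml; lra.
set f := flat _ _ => f1 f0; rewrite ler_norml; nra.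
Qed.

(** Since [flat 0 (m * y)] is at least 1 - 1/(m y), smoothing changes the positive part by at most
    1/m, so the profile is close to b - x on the right half; on the left half x - a <= b - x. The
    error 2/m is harmless because the factor it meets in [smooth_tent'] is of order [m]. *)
Lemma tent_profile_right m a b x : 0 < m -> a < x < b ->
  `|tent_profile m a b x| <= (b - x) + 2 * m^-1.
Proof.
move=> m0 /andP[ax xb]; rewrite /tent_profile.
have mV : 0 < m^-1 by rewrite invr_gt0.
have [h|h] := leP x ((a + b) / 2).
  rewrite flat_le0; last by apply: mulr_ge0_le0; rewrite ?subr_le0// ltW.
  by rewrite mulr0 mulr0 subr0 ler_norml; lra.
set y := x - (a + b) / 2.
have y0 : 0 < y by rewrite subr_gt0.
have := @flat0_lower (m * y) (mulr_gt0 m0 y0).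
rewrite invfM => h1.
have : y * (1 - m^-1 * y^-1) <= y * flat 0 (m * y) by rewrite ler_pM2l.
rewrite mulrBr mulr1 mulrCA mulfV ?gt_eqF// mulr1.
have : y * flat 0 (m * y) <= y * 1 by rewrite ler_pM2l// flat0_le1.
set z := y * flat _ _; move=> h2 h3; rewrite ler_norml.
by rewrite /y in h2 h3 *; lra.
Qed.

Lemma smooth_tent_bound m a b x : 0 <= m -> a <= b -> `|smooth_tent m a b x| <= 3 * (b - a).
Proof.
move=> m0 ab; rewrite /smooth_tent.
have [h|h] := boolP (a < x < b); last by rewrite bump_out// mul0r normr0; lra.
rewrite normrM ger0_norm ?bump_ge0//.
have h1 := tent_profile_bound m0 h; case/andP: h => ax xb.
apply: (@le_trans _ _ (1 * (3 * (x - a)))); last by lra.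
by apply: ler_pM => //; rewrite ?bump_ge0 ?bump_le1.
Qed.

Lemma smooth_tent'_out m a b x : 0 <= m -> ~~ (a < x < b) -> smooth_tent' m a b x = 0.
Proof.
move=> m0 h; rewrite /smooth_tent' bump_out// mul0r addr0.
move: h; rewrite negb_and -!leNgt => /orP[h|h].
  have hh : m * (x - a) <= 0 by rewrite mulr_ge0_le0// subr_le0.
  by rewrite !(flat_le0 _ hh) !mulr0 !mul0r subr0 mul0r.
have hh : m * (b - x) <= 0 by rewrite mulr_ge0_le0// subr_le0.
by rewrite !(flat_le0 _ hh) !mulr0 subr0 mul0r.
Qed.

(** Uniform in [m], as dominated convergence requires. The three terms are bounded by 3, 5 and 5:
    the factor [m] in the derivative of each cutoff is absorbed by the distance to the corresponding
    end, through [flatS]. *)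
Lemma smooth_tent'_bound m a b x : 0 < m -> `|smooth_tent' m a b x| <= 13.
Proof.
move=> m0.
have [h|h] := boolP (a < x < b); last by rewrite smooth_tent'_out ?normr0 ?ltW.
have h1 := tent_profile_bound (ltW m0) h; have h2 := tent_profile_right m0 h.
case/andP: h => ax xb; rewrite /smooth_tent'.
set P := tent_profile _ _ _ _ in h1 h2 *.
have A : `|m * flat 2 (m * (x - a)) * P| <= 3.
  rewrite normrM ger0_norm ?mulr_ge0 ?flat_ge0 ?(ltW m0)//.
  rewrite (le_trans (ler_wpM2l _ h1)) ?mulr_ge0 ?flat_ge0 ?(ltW m0)//.
  have -> : m * flat 2 (m * (x - a)) * (3 * (x - a)) = 3 * (flat 2 (m * (x - a)) * (m * (x - a))).
    by ring.
  rewrite flatS ger_pMr//; exact: flat_le.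
have B : `|m * flat 2 (m * (b - x)) * P| <= 5.
  rewrite normrM ger0_norm ?mulr_ge0 ?flat_ge0 ?(ltW m0)//.
  rewrite (le_trans (ler_wpM2l _ h2)) ?mulr_ge0 ?flat_ge0 ?(ltW m0)//.
  have -> : m * flat 2 (m * (b - x)) * (b - x + 2 * m^-1) =
     flat 2 (m * (b - x)) * (m * (b - x)) + 2 * flat 2 (m * (b - x)) * (m / m).
    by ring.
  rewrite flatS divff ?gt_eqF// mulr1.
  have := flat_le 1 (m * (b - x)); have := flat_le 2 (m * (b - x)).
  rewrite (_ : 1`! = 1)%N// (_ : 2`! = 2)%N//; lra.
move: (flat0_le1 (m * (b - x))) (flat0_le1 (m * (x - a))) (flat_ge0 0 (m * (b - x))) (flat_ge0 0 (m * (x - a))).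
set u := flat 0 (m * (b - x)); set v := flat 0 (m * (x - a)) => u1 v1 u0 v0.
have A' : `|m * flat 2 (m * (x - a)) * P * u| <= 3.
  by rewrite normrM (ger0_norm u0) (le_trans (ler_piMr _ u1)).
have B' : `|m * flat 2 (m * (b - x)) * P * v| <= 5.
  by rewrite normrM (ger0_norm v0) (le_trans (ler_piMr _ v1)).
set z := m * (x - (a + b) / 2).
have C : `|bump m a b x * (1 - 2 * (flat 0 z + flat 1 z))| <= 5.
  rewrite normrM ger0_norm ?bump_ge0// (le_trans (ler_wpM2r _ (bump_le1 _ _ _ _)))// mul1r.
  have := flat_le 1 z; have := flat0_le1 z; have := flat_ge0 0 z; have := flat_ge0 1 z.
  by rewrite (_ : 1`! = 1)%N// ler_norml; lra.
rewrite (_ : _ + _ = m * flat 2 (m * (x - a)) * P * u - m * flat 2 (m * (b - x)) * P * v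
  + bump m a b x * (1 - 2 * (flat 0 z + flat 1 z))); last by ring.
move: A' B' C; rewrite !ler_norml; lra.
Qed.

Lemma tent_profile_cvg a b x : tent_profile n.+1%:R a b x @[n --> \oo] -->
  (x - a) - 2 * ((x - (a + b) / 2) * (0 < x - (a + b) / 2)%R%:R).
Proof.
apply: cvgB; first exact: cvg_cst.
apply: cvgM; first exact: cvg_cst.
by apply: cvgM; [exact: cvg_cst|exact: flat_scale_cvg0].
Qed.

Lemma smooth_tent_cvg a b x : smooth_tent n.+1%:R a b x @[n --> \oo] --> tent a b x.
Proof.
have -> : tent a b x = (a < x < b)%R%:R * ((x - a) - 2 * ((x - (a + b) / 2) * (0 < x - (a + b) / 2)%R%:R)).
  by rewrite /tent; case: ifP; rewrite ?mul1r ?mul0r.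
by apply: cvgM; [exact: bump_cvg|exact: tent_profile_cvg].
Qed.

Lemma scale_flat2_cvg (y : R) : n.+1%:R * flat 2 (n.+1%:R * y) @[n --> \oo] --> (0 : R).
Proof.
have [y0|y0] := ltP 0 y; last first.
  rewrite (_ : (fun n => _) = cst 0); first exact: cvg_cst.
  by apply/funext => n; rewrite flat_le0 ?mulr0// mulr_ge0_le0.
rewrite (_ : (fun n => _) = (fun n => y^-1 * flat 1 (n.+1%:R * y))); last first.
  apply/funext => n; rewrite -(flatS 1).
  have : y != 0 by rewrite gt_eqF.
  by move=> ?; field.
by rewrite -(mulr0 y^-1); apply: cvgM; [exact: cvg_cst|exact: flat_scale_cvgS].
Qed.

Lemma smooth_tent'_cvg a b x : smooth_tent' n.+1%:R a b x @[n --> \oo] --> haar a b x.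
Proof.
have -> : haar a b x = (0 * (0 < b - x)%R%:R - (0 < x - a)%R%:R * 0)
    * ((x - a) - 2 * ((x - (a + b) / 2) * (0 < x - (a + b) / 2)%R%:R))
  + (a < x < b)%R%:R * (1 - 2 * ((0 < x - (a + b) / 2)%R%:R + 0)).
  rewrite mul0r mulr0 subr0 mul0r add0r addr0 /haar; case: ifP => _; last by rewrite mul0r.
  by rewrite mul1r subr_gt0; case: leP; rewrite ?mulr0 ?mulr1 ?subr0//; lra.
apply: cvgD; last first.
  apply: cvgM; first exact: bump_cvg.
  apply: cvgB; first exact: cvg_cst.
  apply: cvgM; first exact: cvg_cst.
  by apply: cvgD; [exact: flat_scale_cvg0|exact: flat_scale_cvgS].
apply: cvgM; last exact: tent_profile_cvg.
apply: cvgB.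
  by apply: cvgM; [exact: scale_flat2_cvg|exact: flat_scale_cvg0].
rewrite (_ : (fun n => _) = (fun n => flat 0 (n.+1%:R * (x - a)) * (n.+1%:R * flat 2 (n.+1%:R * (b - x))))); last first.
  by apply/funext => n; ring.
by apply: cvgM; [exact: flat_scale_cvg0|exact: scale_flat2_cvg].
Qed.

End Smooth.

(** * Boxes and test functions in three dimensions *)

#[global] Instance leb3_ae_filter (R : realType) :
  Filter (almost_everywhere (@leb3 R)).
Proof. exact: ae_filter_ringOfSetsType. Qed.

Section Geometry.
Context {R : realType}.
Implicit Types (x : R3 R) (i k : 'I_3) (l r : 'I_3 -> R).

Definition coord i x : R := [:: x.1.1; x.1.2; x.2]`_i.

Lemma I3P (P : 'I_3 -> Prop) : P 0 -> P 1 -> P 2 -> forall i, P i.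
Proof.
move=> h0 h1 h2 [[|[|[|//]]] hi].
- by rewrite (_ : Ordinal hi = 0)//; exact: val_inj.
- by rewrite (_ : Ordinal hi = 1)//; exact: val_inj.
- by rewrite (_ : Ordinal hi = 2)//; exact: val_inj.
Qed.

Lemma measurable_coord i : measurable_fun setT (coord i : mR3 R -> R).
Proof.
have m1 := @measurable_fst _ _ (measurableTypeR R * measurableTypeR R)%type (measurableTypeR R).
have m2 := @measurable_snd _ _ (measurableTypeR R * measurableTypeR R)%type (measurableTypeR R).
elim/I3P: i.
- by apply: (measurableT_comp (@measurable_fst _ _ (measurableTypeR R) (measurableTypeR R)) m1).
- by apply: (measurableT_comp (@measurable_snd _ _ (measurableTypeR R) (measurableTypeR R)) m1).
- exact: m2.
Qed.

Lemma continuous_coord i : continuous (coord i : R3 R -> R).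
Proof.
elim/I3P: i => x.
- by apply: (@cvg_comp _ _ _ (fun x : R3 R => x.1) fst); [exact: cvg_fst|exact: cvg_fst].
- by apply: (@cvg_comp _ _ _ (fun x : R3 R => x.1) snd); [exact: cvg_fst|exact: cvg_snd].
- exact: cvg_snd.
Qed.

Lemma coord_line i k x (h : R) : coord i (h *: basis3 k + x) = h * (i == k)%:R + coord i x.
Proof. by elim/I3P: i; elim/I3P: k. Qed.

(** Reduces directional derivatives to functions of one variable, where the one-dimensional chain
    rule applies. *)
Lemma is_derive_lineP (V W : normedModType R) (f : V -> W) (x v : V) df :
  is_derive x v f df <-> is_derive (0 : R) (1 : R) (fun h : R => f (h *: v + x)) df.
Proof.
have E : (fun h : R => h^-1 *: (f (h *: v + x) - f x)) =
  (fun h : R => h^-1 *: (((fun h : R => f (h *: v + x)) \o shift 0) (h *: 1) - f (0 *: v + x))).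
  by apply/funext => h /=; rewrite scale0r add0r addr0 /GRing.scale/= mulr1.
split=> -[h1 h2].
  split; first by rewrite /derivable -E.
  by rewrite -h2 /derive -E.
split; first by move: h1; rewrite /derivable -E.
by rewrite -h2 /derive -E.
Qed.

Lemma is_derive_coord i k x (f : R -> R) df :
  is_derive (coord i x) (1 : R) f df ->
  is_derive x (basis3 k) (f \o coord i) ((i == k)%:R * df).
Proof.
move=> h; apply/is_derive_lineP.
have -> : (fun h0 : R => (f \o coord i) (h0 *: basis3 k + x)) =
   (fun h0 : R => f ((i == k)%:R * h0 + coord i x)).
  by apply/funext => t /=; rewrite coord_line mulrC.
by apply: is_derive_affine; rewrite mulr0 add0r.
Qed.

Definition tensor (f : 'I_3 -> R -> R) x : R := \prod_(i < 3) f i (coord i x).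

(** Half-open, so that cutting by a coordinate plane gives an exact partition; [cbox] is the version
    used for compactness and for inclusion in the ball. *)
Definition box l r : set (mR3 R) := [set x | forall i, l i < coord i x <= r i].
Definition cbox l r : set (R3 R) := [set x | forall i, l i <= coord i x <= r i].

Lemma boxE l r : box l r =
  (`]l 0, r 0] `*` `]l 1, r 1]) `*` `]l 2, r 2].
Proof.
apply/seteqP; split=> [x h|x [[/= h0 h1] h2]].
  by split; [split|]; rewrite /= in_itv/=; [exact: (h 0)|exact: (h 1)|exact: (h 2)].
by move: h0 h1 h2; rewrite !in_itv/= => h0 h1 h2; elim/I3P.
Qed.

Lemma measurable_box l r : measurable (box l r).
Proof. by rewrite boxE; do 2 apply: measurableX => //. Qed.

Lemma compact_cbox l r : compact (cbox l r).
Proof.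
have -> : cbox l r = (`[l 0, r 0] `*` `[l 1, r 1]) `*` `[l 2, r 2].
  apply/seteqP; split=> [x h|x [[/= h0 h1] h2]].
    by split; [split|]; rewrite /= in_itv/=; [exact: (h 0)|exact: (h 1)|exact: (h 2)].
  by move: h0 h1 h2; rewrite !in_itv/= => h0 h1 h2; elim/I3P.
have h := compact_setX (compact_setX (@segment_compact R (l 0) (r 0)) (@segment_compact R (l 1) (r 1))) (@segment_compact R (l 2) (r 2)).
exact: h.
Qed.

Definition vol l r : R := \prod_(i < 3) (r i - l i).

Lemma leb3X (A B C : set (measurableTypeR R)) :
  measurable A -> measurable B -> measurable C ->
  (leb3 ((A `*` B) `*` C) =
   lebesgue_measure A * lebesgue_measure B * lebesgue_measure C)%E.
Proof.
move=> mA mB mC; rewrite /leb3 product_measure1E//; last exact: measurableX.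
by congr (_ * _)%E; exact: product_measure1E.
Qed.

Lemma leb3_box l r : (forall i, l i <= r i) -> leb3 (box l r) = (vol l r)%:E.
Proof.
move=> lr; rewrite boxE leb3X//.
have itv i : lebesgue_measure `]l i, r i] = (r i - l i)%:E.
  rewrite lebesgue_measure_itv/= lte_fin; case: ltP => [_|h]; first by rewrite EFinB.
  by apply/esym; congr EFin; apply/eqP; rewrite subr_eq0 eq_le h lr.
rewrite !itv -!EFinM /vol !big_ord_recl big_ord0 mulr1 mulrA.
by congr (_ * _ * _)%:E; congr (r _ - l _); exact: val_inj.
Qed.

Lemma leb3_plane i c : leb3 [set x : mR3 R | coord i x = c] = 0%E.
Proof.
elim/I3P: i.
- have -> : [set x : mR3 R | coord 0 x = c] = ([set c] `*` setT) `*` setT.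
    by apply/seteqP; split=> [x /= <-//|x [[]]].
  by rewrite leb3X// lebesgue_measure_set1 mul0e mul0e.
- have -> : [set x : mR3 R | coord 1 x = c] = (setT `*` [set c]) `*` setT.
    by apply/seteqP; split=> [x /= <-//|x [[]]].
  by rewrite leb3X// lebesgue_measure_set1 mule0 mul0e.
- have -> : [set x : mR3 R | coord 2 x = c] = (setT `*` setT) `*` [set c].
    by apply/seteqP; split=> [x /= <-//|x []].
  by rewrite leb3X// lebesgue_measure_set1 mule0.
Qed.

Lemma normsq3E x : normsq3 x = \sum_(i < 3) coord i x ^+ 2.
Proof. by rewrite !big_ord_recl big_ord0 addr0 addrA. Qed.

Lemma B1_coord x i : B1 x -> -1 < coord i x < 1.
Proof.
rewrite /B1/= normsq3E (bigD1 i)//= => h.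
have : 0 <= \sum_(j < 3 | j != i) coord j x ^+ 2 by apply: sumr_ge0 => j _; exact: sqr_ge0.
by set s := \sum_(_ < _ | _) _ in h * => s0; apply/andP; split; nra.
Qed.

Lemma measurable_normsq3 : measurable_fun setT (normsq3 : mR3 R -> R).
Proof.
have -> : (normsq3 : mR3 R -> R) = (fun x => \sum_(i < 3) coord i x ^+ 2).
  by apply/funext => x; exact: normsq3E.
by apply: measurable_sum => i; apply: measurable_funX; exact: measurable_coord.
Qed.

Lemma measurable_B1 : measurable (B1 : set (mR3 R)).
Proof.
have -> : (B1 : set (mR3 R)) = setT `&` normsq3 @^-1` `]-oo, 1[.
  by rewrite setTI; apply/seteqP; split=> x; rewrite /B1/= in_itv.
exact: measurable_normsq3.
Qed.

Lemma leb3_B1_fin : (leb3 (B1 : set (mR3 R)) < +oo)%E.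
Proof.
apply: (@le_lt_trans _ _ (leb3 (box (fun=> -1) (fun=> 1)))).
  apply: le_measure; rewrite ?inE; [exact: measurable_B1|exact: measurable_box|].
  by move=> x Bx i; have /andP[-> /ltW ->] := B1_coord i Bx.
by rewrite leb3_box ?ltry// => i; lra.
Qed.

Lemma tensor_out f x i : f i (coord i x) = 0 -> tensor f x = 0.
Proof. by move=> h; rewrite /tensor (bigD1 i)//= h mul0r. Qed.

Lemma tensorE f x :
  tensor f x = f 0 (coord 0 x) * f 1 (coord 1 x) * f 2 (coord 2 x).
Proof.
rewrite /tensor !big_ord_recl big_ord0 mulr1 mulrA.
by congr (f _ (coord _ x) * f _ (coord _ x) * f _ (coord _ x)); exact: val_inj.
Qed.

Lemma continuous_tensor f : (forall i, continuous (f i)) -> continuous (tensor f).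
Proof.
move=> cf x.
have h i : continuous (f i \o coord i).
  move=> y; apply: continuous_comp; [exact: continuous_coord|exact: cf].
rewrite (_ : tensor f = (fun x => f 0 (coord 0 x) * f 1 (coord 1 x) * f 2 (coord 2 x))).
  by apply: cvgM; [apply: cvgM|]; exact: h.
by apply/funext => y; exact: tensorE.
Qed.

Lemma measurable_tensor f : (forall i, measurable_fun setT (f i)) ->
  measurable_fun setT (tensor f : mR3 R -> R).
Proof.
move=> mf; apply: measurable_prod => i _.
by apply: (measurableT_comp (mf i)); exact: measurable_coord.
Qed.

Definition subst1 (f : 'I_3 -> R -> R) k g i := if i == k then g else f i.

Lemma is_derive_tensor f f' k x :
  is_derive (coord k x) (1 : R) (f k) (f' (coord k x)) ->
  is_derive x (basis3 k) (tensor f) (tensor (subst1 f k f') x).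
Proof.
move=> h; apply/is_derive_lineP.
pose c := \prod_(i < 3 | i != k) f i (coord i x).
have -> : (fun h : R => tensor f (h *: basis3 k + x)) =
    (fun h : R => c * f k (1 * h + coord k x)).
  apply/funext => t; rewrite /tensor (bigD1 k)//= coord_line eqxx mulr1 mul1r mulrC.
  congr (_ * _); apply: eq_bigr => i /negbTE ik.
  by rewrite coord_line ik mulr0 add0r.
have -> : tensor (subst1 f k f') x = c * (1 * f' (coord k x)).
  rewrite /tensor (bigD1 k)//= /subst1 eqxx mul1r mulrC; congr (_ * _).
  by apply: eq_bigr => i /negbTE ->.
apply: is_deriveZ; apply: is_derive_affine; by rewrite mulr0 add0r.
Qed.

(** A partial derivative of a product of functions of one coordinate is again such a product, with
    one factor differentiated; hence the induction over all families [f]. *)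
Lemma Cn_tensor n f : (forall i, smooth_upto n (f i)) -> Cn n (tensor f).
Proof.
elim: n f => [|n ih] f sf.
  by split => //; apply: continuous_tensor => i; exact: sf.
split; first by apply: continuous_tensor => i; exact: smooth_upto_continuous (sf i).
move=> k; have [f' [hf' sf']] := sf k.
have hd x := @is_derive_tensor f f' k x (hf' _).
split; first by move=> x; case: (hd x).
rewrite (_ : (fun x => _) = tensor (subst1 f k f')).
  apply: ih => i; rewrite /subst1; case: eqP => // _.
  exact: smooth_upto_pred.
by apply/funext => x; case: (hd x).
Qed.

Lemma test_tensor (Omega : set (R3 R)) f l r :
  (forall i, smooth (f i)) -> cbox l r `<=` Omega ->
  (forall i t, ~~ (l i <= t <= r i) -> f i t = 0) ->
  test_function Omega (tensor f).
Proof.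
move=> sf lrO f0; split; first by move=> n; apply: Cn_tensor => i; exact: sf.
exists (cbox l r); split => //; first exact: compact_cbox.
move=> x /existsNP[i /negP hi]; apply: (@tensor_out _ _ i); exact: f0.
Qed.

End Geometry.

(** * Joint measurability of continuous functions *)

Section Measurability.
Context {R : realType}.

Lemma continuous_fixr (U V W : topologicalType) (f : U * V -> W) y :
  continuous f -> continuous (fun x => f (x, y)).
Proof.
move=> cf x; apply: (@cvg_comp _ _ _ (fun x => (x, y)) f); last exact: cf.
apply: cvg_pair; [exact: cvg_id|exact: cvg_cst].
Qed.

Lemma continuous_fixl (U V W : topologicalType) (f : U * V -> W) x :
  continuous f -> continuous (fun y => f (x, y)).
Proof.
move=> cf y; apply: (@cvg_comp _ _ _ (fun y => (x, y)) f); last exact: cf.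
apply: cvg_pair; [exact: cvg_cst|exact: cvg_id].
Qed.

(** The second variable is rounded down to a multiple of 1/(n+1). The rounded function is measurable
    because only countably many values of [y] occur, and continuity in [y] recovers [f] in the
    limit. Used twice, this makes continuous functions of three variables measurable for the product
    sigma-algebra. *)
Lemma measurable_caratheodory d (T : measurableType d) (f : T -> R -> R) :
  (forall y, measurable_fun setT (f ^~ y)) -> (forall x, continuous (f x)) ->
  measurable_fun setT (fun z : T * measurableTypeR R => f z.1 z.2).
Proof.
move=> mf cf.
pose a n (y : R) : R := (Num.floor (n.+1%:R * y))%:~R / n.+1%:R.
apply: (measurable_fun_cvg (h := fun n z => f z.1 (a n z.2))) => [n|z _].
- move=> _ Y mY; rewrite setTI.
  have -> : (fun z : T * measurableTypeR R => f z.1 (a n z.2)) @^-1` Y =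
     \bigcup_(k : int) ((f ^~ (k%:~R / n.+1%:R)) @^-1` Y `*`
        `[k%:~R / n.+1%:R, (k + 1)%:~R / n.+1%:R[).
    apply/seteqP; split=> [z /= hz|z [k _ [/= h1]]].
      exists (Num.floor (n.+1%:R * z.2)) => //; split => //=.
      rewrite in_itv/= ler_pdivrMr// ltr_pdivlMr// mulrC.
      exact: floor_itv.
    rewrite in_itv/= ler_pdivrMr// ltr_pdivlMr// => h2.
    by rewrite /a [_.+1%:R * _]mulrC (floor_def h2).
  apply: countable_bigcupT_measurable => // k; apply: measurableX => //.
  by rewrite -[X in measurable X]setTI; exact: mf.
- apply: (cvg_comp (a ^~ z.2) (f z.1)); last exact: cf.
  apply: (@squeeze_cvgr _ _ _ _ (fun n => z.2 - n.+1%:R^-1) (fun=> z.2)).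
  + near=> n; rewrite /a.
    have /andP[h1 h2] := floor_itv (n.+1%:R * z.2).
    rewrite ler_pdivrMr// [z.2 * _]mulrC h1 andbT ler_pdivlMr// mulrBl mulVf//.
    by rewrite lerBlDr mulrC ltW// (lt_le_trans h2)// intrD.
  + rewrite -[X in _ --> X]subr0; apply: cvgB; first exact: cvg_cst.
    exact: cvg_harmonic.
  + exact: cvg_cst.
Unshelve. all: by end_near. Qed.

Lemma continuous_measurable2 (f : R * R -> R) : continuous f ->
  measurable_fun setT (f : measurableTypeR R * measurableTypeR R -> R).
Proof.
move=> cf.
have := @measurable_caratheodory _ (measurableTypeR R) (fun x y => f (x, y)).
have -> : (fun z : measurableTypeR R * measurableTypeR R => f (z.1, z.2)) = f.
  by apply/funext => -[].
apply => [y|x]; first by apply: continuous_measurable_fun; exact: continuous_fixr.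
exact: continuous_fixl.
Qed.

Lemma continuous_measurable3 (f : R3 R -> R) : continuous f ->
  measurable_fun setT (f : mR3 R -> R).
Proof.
move=> cf.
have := @measurable_caratheodory _ (measurableTypeR R * measurableTypeR R)%type (fun x y => f (x, y)).
have -> : (fun z : mR3 R => f (z.1, z.2)) = f by apply/funext => -[].
apply => [y|x].
  by apply: (@continuous_measurable2 (fun x => f (x, y))); exact: continuous_fixr.
exact: continuous_fixl.
Qed.

End Measurability.

Section TestFunctions.
Context {R : realType}.
Variable Omega : set (R3 R).
Implicit Types (u v g phi : R3 R -> R) (k : 'I_3).

Lemma test_continuous phi : test_function Omega phi -> continuous phi.
Proof. by move=> [/(_ 0%N) [? _]]. Qed.

Lemma test_derive k phi : test_function Omega phi ->
  test_function Omega (fun x => 'D_(basis3 k) phi x).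
Proof.
move=> [hC [K [cK KO hK]]]; split.
  by move=> n; have [_ /(_ k)[]] := hC n.+1.
exists K; split => // x Kx.
have clK : closed K by apply: compact_closed => //; exact: Rhausdorff.
have oK : open (~` K) by exact: closed_openC.
have h : \near x, phi x = 0.
  by apply: filterS (open_nbhs_nbhs (conj oK Kx)) => y /hK.
rewrite (@near_eq_derive _ _ _ phi (fun=> 0)) //.
by rewrite derive_cst.
Qed.

Lemma test_bounded phi : test_function Omega phi ->
  exists M, forall x, `|phi x| <= M.
Proof.
move=> h; have cphi := test_continuous h; case: h => [_ [K [cK KO hK]]].
have : compact (phi @` K).
  by apply: continuous_compact => //; exact: continuous_subspaceT.
move=> /compact_bounded[M [Mr hM]].
exists (`|M| + 1) => x.
have [Kx|/hK ->] := pselect (K x); last by rewrite normr0; have := normr_ge0 M; lra.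
apply: (hM (`|M| + 1)); last by exists x.
by rewrite (le_lt_trans (ler_norm M))// ltrDl.
Qed.

End TestFunctions.

Section RealConvergence.
Context d (T : measurableType d) (R : realType).
Variables (mu : {measure set T -> \bar R}) (D : set T).
Hypothesis mD : measurable D.
Implicit Types f g : T -> R.

Lemma dominated_Rintegral (f_ : nat -> T -> R) f g :
  (forall n, measurable_fun D (f_ n)) -> measurable_fun D f -> intble mu D g ->
  (forall n x, D x -> `|f_ n x| <= g x) ->
  {ae mu, forall x, D x -> f_ ^~ x @ \oo --> f x} ->
  (\int[mu]_(x in D) f_ n x) @[n --> \oo] --> \int[mu]_(x in D) f x.
Proof.
move=> mf_ mf ig fg cv.
have [|||||h1 _ h2] := @dominated_convergence _ _ _ mu D mD (fun n => EFin \o f_ n) (EFin \o f) (EFin \o g).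
- by move=> n; exact/measurable_EFinP.
- exact/measurable_EFinP.
- by apply: filterS cv => x /= /[apply] h; apply: cvg_EFin => //; exact: nearW.
- exact: ig.
- by apply: aeW => x n Dx /=; rewrite lee_fin fg.
apply: fine_cvg => /=.
rewrite /Rintegral fineK; first exact: h2.
exact: integrable_fin_num.
Qed.

Lemma cvg_inner (f_ : nat -> T -> R) f g :
  (forall n, sqint mu D (f_ n)) -> sqint mu D f -> sqint mu D g ->
  nsq mu D (fun x => f_ n x - f x) @[n --> \oo] --> 0 ->
  (\int[mu]_(x in D) (f_ n x * g x)) @[n --> \oo] --> \int[mu]_(x in D) (f x * g x).
Proof.
move=> hf_ hf hg cv; apply/subr_cvg0; apply/cvgr0Pnorm_le => /= e e0.
(* The added 1 covers a function [g] of norm 0. *)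
have g1 : 0 < nsq mu D g + 1 by rewrite ltr_wpDl// nsq_ge0.
have : \forall n \near \oo, nsq mu D (fun x => f_ n x - f x) <= e ^+ 2 / (nsq mu D g + 1).
  have e2 : 0 < e ^+ 2 / (nsq mu D g + 1) by rewrite divr_gt0// exprn_gt0.
  move/cvgr0Pnorm_le : cv => /(_ _ e2); apply: filterS => n.
  by rewrite ger0_norm// nsq_ge0.
apply: filterS => n hn.
rewrite -RintegralB//; try exact: sqintM_intble.
rewrite (@eq_Rintegral _ _ _ mu D (fun x => (f_ n x - f x) * g x)); last by move=> x _; ring.
rewrite -(@ler_pXn2r _ 2)// ?nnegrE ?(ltW e0)//.
rewrite real_normK ?num_real//.
apply: le_trans (cauchy_schwarz mD _ hg) _; first exact: sqintB.
apply: (@le_trans _ _ (e ^+ 2 / (nsq mu D g + 1) * (nsq mu D g + 1))).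
  by apply: ler_pM => //; rewrite ?nsq_ge0// lerDl.
by rewrite divfK// gt_eqF.
Qed.

End RealConvergence.

(** * The fundamental lemma of the calculus of variations *)

Section ZeroIntegral.
Context d (T : measurableType d) (R : realType).
Variables (mu : {measure set T -> \bar R}).

(** The sets [A] over whose preimage the integral vanishes form a Dynkin system; closure under
    complements holds because the integral over all of [S] is 0. The map [f] allows a product
    sigma-algebra to be treated one coordinate at a time. *)
Lemma zero_integral_generated d' (T' : measurableType d') (S : set T)
    (g : T -> R) (f : T -> T') (G : set (set T')) :
  measurable S -> intble mu S g -> measurable_fun setT f ->
  setI_closed G -> @measurable _ T' = <<s G >> ->
  \int[mu]_(x in S) g x = 0 ->
  (forall A, G A -> \int[mu]_(x in S `&` f @^-1` A) g x = 0) ->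
  forall A, measurable A -> \int[mu]_(x in S `&` f @^-1` A) g x = 0.
Proof.
move=> mS ig mf GI mG S0 G0 A; rewrite mG.
pose H := [set A | measurable A /\ \int[mu]_(x in S `&` f @^-1` A) g x = 0].
have mpre B : measurable B -> measurable (S `&` f @^-1` B).
  by move=> mB; apply: measurableI => //; rewrite -[X in measurable X]setTI; exact: mf.
have igS B : measurable B -> B `<=` S -> mu.-integrable B (EFin \o g).
  by move=> mB BS; apply: integrableS ig.
have intC B : measurable B -> \int[mu]_(x in S `&` f @^-1` (~` B)) g x =
    - \int[mu]_(x in S `&` f @^-1` B) g x.
  move=> mB; apply/eqP; rewrite -addr_eq0 addrC -Rintegral_setU.
  - by rewrite -setIUr preimage_setC setUv setIT S0.
  - exact: mpre.
  - exact/mpre/measurableC.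
  - apply: igS; last by move=> x [[]|[]].
    by apply: measurableU; apply: mpre => //; exact: measurableC.
  - by apply/disj_setPRL => x [_ h] /= [_]; exact: h.
suff: <<s G >> `<=` H by move=> /[apply] -[].
rewrite -setI_closed_g_dynkin_g_sigma_algebra//.
apply: smallest_sub; last first.
  by move=> B GB; split; [rewrite mG; exact: sub_gen_smallest|exact: G0].
split.
- by split => //; rewrite preimage_setT setIT.
- by move=> B [mB B0]; split; [exact: measurableC|rewrite intC// B0 oppr0].
- move=> F tF HF; have mF n : measurable (F n) by case: (HF n).
  split; first exact: bigcupT_measurable.
  rewrite preimage_bigcup setI_bigcupr /Rintegral integral_bigcup//.
  + rewrite eseries0// => n _ _.
    have [_ h] := HF n.
    rewrite -[LHS]fineK ?integrable_fin_num//; [|exact: mpre|by apply: igS; [exact: mpre|exact: subIsetl]].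
    by congr EFin.
  + apply/trivIsetP => i j _ _ ij.
    rewrite setIACA setIid -preimage_setI.
    by move/trivIsetP : tF => ->//; rewrite preimage_set0 setI0.
  + by move=> n; exact: mpre.
  + apply: igS; first by apply: bigcupT_measurable => n; exact: mpre.
    by move=> x [n _ []].
Qed.

End ZeroIntegral.

Section Fundamental.
Context {R : realType}.
Implicit Types (u v g phi : R3 R -> R) (k : 'I_3) (l r : 'I_3 -> R).
Local Notation mB1 := measurable_B1.
Local Notation B := (@B1 R : set (mR3 R)).

Lemma test_sqint phi : test_function B1 phi -> sqint leb3 B phi.
Proof.
move=> h; have [M hM] := test_bounded h.
apply: (@sqint_bounded _ _ _ _ _ mB1 _ M) => //; first exact: leb3_B1_fin.
by apply: measurable_funTS; apply: continuous_measurable3; exact: test_continuous h.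
Qed.

(** Bumps converge to indicators of open boxes, whereas [box] contains its right faces; the
    difference lies in three coordinate planes. *)
Lemma ae_off_planes (c : 'I_3 -> R) :
  {ae (@leb3 R), forall x, forall i, coord i x != c i}.
Proof.
have h i : {ae (@leb3 R), forall x, coord i x != c i}.
  exists [set x | coord i x = c i]; split; last by move=> x /= /negP; rewrite negbK => /eqP.
    have -> : [set x : mR3 R | coord i x = c i] = setT `&` coord i @^-1` [set c i].
      by rewrite setTI.
    exact: measurable_coord.
  exact: leb3_plane.
have := ae_foralln (fun n => h (inord n)); apply: filterS => x hx i.
by have := hx i; rewrite inord_val.
Qed.

Lemma box_sub_cbox l r : box l r `<=` cbox l r.
Proof. by move=> x h i; have /andP[/ltW -> ->] := h i. Qed.

Lemma restrict_indicE (A : set (mR3 R)) g : g \_ A = (fun x => g x * \1_A x).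
Proof.
by apply/funext => x; rewrite patchE indicE; case: ifP => _; rewrite ?mulr1 ?mulr0.
Qed.

Lemma Rintegral_box l r g : cbox l r `<=` B1 ->
  \int[leb3]_(x in box l r) g x = \int[leb3]_(x in B) (g x * \1_(box l r) x).
Proof.
move=> lr; rewrite -restrict_indicE -Rintegral_mkcondr; congr (Rintegral _ _ _).
by rewrite setIidr//; apply: subset_trans lr; exact: box_sub_cbox.
Qed.

Definition bumps (n : nat) l r : 'I_3 -> R -> R := fun i => bump n.+1%:R (l i) (r i).

Lemma bumps_out n l r i t : ~~ (l i <= t <= r i) -> bumps n l r i t = 0.
Proof.
move=> h; rewrite /bumps bump_out//; apply: contra h.
by move=> /andP[/ltW -> /ltW ->].
Qed.

Lemma test_bumps n l r : cbox l r `<=` B1 -> test_function B1 (tensor (bumps n l r)).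
Proof.
move=> lr; apply: (test_tensor _ lr) => [i|i t]; first exact: smooth_bump.
exact: bumps_out.
Qed.

Lemma bumps_bound n l r x : `|tensor (bumps n l r) x| <= 1.
Proof.
rewrite /tensor normr_prod; apply: prodr_ile1 => i; rewrite normr_ge0/=.
by rewrite ger0_norm ?bump_ge0 ?bump_le1.
Qed.

Lemma prod_indicE l r x : (forall i, coord i x != r i) ->
  \prod_(i < 3) (l i < coord i x < r i)%R%:R = \1_(box l r) x :> R.
Proof.
move=> hx; rewrite indicE.
have [h|h] := boolP (x \in box l r).
  rewrite big1// => i _; have /andP[-> h2] := set_mem h i.
  by rewrite lt_neqAle hx h2.
have : ~ (box l r x) by move=> hb; move: h; rewrite mem_set.
move=> /existsNP[i hi]; rewrite (bigD1 i)//=.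
suff -> : (l i < coord i x < r i) = false by rewrite mul0r.
by apply/negP => /andP[h1 /ltW h2]; apply: hi; rewrite h1.
Qed.

Lemma tensor_cvg (f : nat -> 'I_3 -> R -> R) (f' : 'I_3 -> R -> R) x :
  (forall i, (fun n => f n i (coord i x)) @ \oo --> f' i (coord i x)) ->
  tensor (f n) x @[n --> \oo] --> tensor f' x.
Proof.
move=> h; rewrite tensorE; under eq_fun do rewrite tensorE.
by apply: cvgM; [apply: cvgM|]; exact: h.
Qed.

Lemma bumps_cvg l r : {ae (@leb3 R), forall x, tensor (bumps n l r) x @[n --> \oo] --> (\1_(box l r) x : R)}.
Proof.
apply: filterS (ae_off_planes r) => x hx.
rewrite -prod_indicE//.
apply: (@tensor_cvg (fun n => bumps n l r) (fun i t => (l i < t < r i)%R%:R)) => i.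
exact: bump_cvg.
Qed.

Lemma integral_bumps_cvg g l r : sqint leb3 B g -> cbox l r `<=` B1 ->
  (\int[leb3]_(x in B) (g x * tensor (bumps n l r) x)) @[n --> \oo] -->
  \int[leb3]_(x in box l r) g x.
Proof.
move=> hg lr; rewrite Rintegral_box//.
apply: (@dominated_Rintegral _ _ _ _ _ mB1 _ _ (fun x => `|g x|)).
- move=> n; apply: measurable_funM; first by case: hg.
  by case: (test_sqint (test_bumps n lr)).
- apply: measurable_funM; first by case: hg.
  by apply: measurable_indic; exact: measurable_box.
- apply: integrable_norm; apply: sqint_intble1 => //; first exact: mB1.
  exact: leb3_B1_fin.
- move=> n x _; rewrite normrM ler_piMr// bumps_bound//.
- apply: filterS (bumps_cvg l r) => x hx _.
  by apply: cvgM; first exact: cvg_cst.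
Qed.

Lemma box_integral_zero g : sqint leb3 B g ->
  (forall phi, test_function B1 phi -> \int[leb3]_(x in B) (g x * phi x) = 0) ->
  forall l r, cbox l r `<=` B1 -> \int[leb3]_(x in box l r) g x = 0.
Proof.
move=> hg h l r lr; have := integral_bumps_cvg hg lr.
rewrite (_ : (fun n => _) = cst 0); last by apply/funext => n; rewrite h//; exact: test_bumps.
by move=> /(cvg_lim (@Rhausdorff R)); rewrite lim_cst//; exact: Rhausdorff.
Qed.

(** Coordinates in the ball are below 1 in absolute value, so the squared norm grows by at most 6 e
    + 3 e^2. As e <= 1/10, this is less than the available 1 - |x|^2. *)
Lemma cbox_near x (e : R) (y : R3 R) : B1 x -> e <= (1 - normsq3 x) / 10 ->
  (forall i, `|coord i y - coord i x| <= e) -> B1 y.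
Proof.
move=> Bx he h; have Bx' : normsq3 x < 1 by [].
have x0 : 0 <= normsq3 x by rewrite normsq3E sumr_ge0// => i _; exact: sqr_ge0.
have e0 : 0 <= e by exact: le_trans (h 0).
have E i : coord i y ^+ 2 <= coord i x ^+ 2 + 2 * e + e ^+ 2.
  have := B1_coord i Bx; have := h i; rewrite ler_norml => /andP[h1 h2] /andP[h3 h4].
  set a := coord i x in h1 h2 h3 h4 *; set b := coord i y in h1 h2 *.
  have -> : b = a + (b - a) by ring.
  set d := b - a in h1 h2 *; nra.
rewrite /B1/= normsq3E (le_lt_trans (ler_sum _ (fun i _ => E i)))//.
rewrite 2!big_split/= -normsq3E !sumr_const card_ord.
have e1 : e ^+ 2 <= e / 10 by rewrite expr2 ler_wpM2l//; lra.
lra.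
Qed.

(** Cubes with rational centre and half-side 1/(m+1), enumerated through [pickle]. Countability is
    the point: a property that holds almost everywhere on each box then holds almost everywhere on
    the ball. *)
Lemma B1_box_cover : exists lb rb : nat -> 'I_3 -> R,
  [/\ forall n, cbox (lb n) (rb n) `<=` B1, forall n i, lb n i <= rb n i &
   forall x, B1 x -> exists n, box (lb n) (rb n) x].
Proof.
pose T : countType := ({ffun 'I_3 -> rat} * nat)%type.
pose lc (t : T) i : R := ratr (t.1 i) - t.2.+1%:R^-1.
pose rc (t : T) i : R := ratr (t.1 i) + t.2.+1%:R^-1.
pose good n := if unpickle n is Some t then `[< cbox (lc t) (rc t) `<=` B1 >] else false.
pose pt n : T := odflt ([ffun=> 0], 0%N) (unpickle n).
(* Codes that are not good get the degenerate box at the origin: its closed form is one point of the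
   ball, its half-open form is empty. *)
exists (fun n => if good n then lc (pt n) else fun=> 0).
exists (fun n => if good n then rc (pt n) else fun=> 0).
split.
- move=> n; case: ifPn => [|_].
    by rewrite /good /pt; case: unpickle => //= t /asboolP.
  move=> x hx; rewrite /B1/= normsq3E big1// => i _.
  have := hx i; rewrite -eq_le => /eqP <-; exact: expr0n.
- by move=> n i; case: ifP => // _; rewrite /lc /rc lerD2l ge0_cp.
- move=> x Bx.
  pose e := (1 - normsq3 x) / 10.
  have e0 : 0 < e by rewrite divr_gt0// subr_gt0.
  have [m hm] : exists m : nat, (m.+1%:R^-1 : R) < e / 2.
    have e2 : 0 < e / 2 by rewrite divr_gt0.
    by have [m _ hm] := near_infty_natSinv_lt (PosNum e2); exists m; apply: hm => /=.
  have hc i : {q : rat | coord i x - m.+1%:R^-1 < ratr q < coord i x + m.+1%:R^-1}.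
    apply: cid.
    have : coord i x - m.+1%:R^-1 < coord i x + m.+1%:R^-1.
      have : 0 < m.+1%:R^-1 :> R by rewrite invr_gt0.
      by set z := _^-1; lra.
    by move/rat_in_itvoo => [q hq]; exists q; rewrite in_itv in hq.
  pose t : T := ([ffun i => sval (hc i)], m).
  have tE i : (t.1 i) = sval (hc i) by rewrite ffunE.
  exists (pickle t).
  have -> : good (pickle t).
    rewrite /good pickleK; apply/asboolP => y hy.
    apply: (cbox_near Bx (lexx e)) => i.
    have := hy i; rewrite /lc /rc tE; have := svalP (hc i); rewrite -/e.
    move: hm; rewrite /=; set z := _^-1 => hm /andP[h1 h2] /andP[h3 h4].
    by rewrite ler_norml; apply/andP; split; lra.
  move=> i; rewrite /pt pickleK /= /lc /rc tE; have := svalP (hc i).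
  by rewrite /=; set z := _^-1 => /andP[h1 h2]; apply/andP; split; lra.
Qed.

Lemma box_setI l r l' r' : box l r `&` box l' r' =
  box (fun i => Num.max (l i) (l' i)) (fun i => Num.min (r i) (r' i)).
Proof.
apply/seteqP; split=> [x [h h'] i|x h].
  have /andP[h1 h2] := h i; have /andP[h3 h4] := h' i.
  by rewrite gt_max le_min h1 h2 h3 h4.
have h' i : Num.max (l i) (l' i) < coord i x <= Num.min (r i) (r' i) := h i.
by split => i; move: (h' i); rewrite gt_max le_min => /andP[/andP[? ?] /andP[? ?]]; apply/andP.
Qed.

Lemma cbox_sub l r l' r' : (forall i, l' i <= l i) -> (forall i, r i <= r' i) ->
  cbox l r `<=` cbox l' r'.
Proof.
move=> hl hr x h i; have /andP[h1 h2] := h i.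
by rewrite (le_trans (hl i) h1) (le_trans h2 (hr i)).
Qed.

(** Integrals over boxes determine all others: the intervals in coordinates 2, 1 and 0 are replaced
    in turn by measurable sets, then the rectangle in the first two coordinates by any measurable
    set of the plane, and finally the product by any measurable set of space. *)
Lemma sub_integral_zero g l r : sqint leb3 B g ->
  (forall l r, cbox l r `<=` B1 -> \int[leb3]_(x in box l r) g x = 0) ->
  cbox l r `<=` B1 ->
  forall E, measurable E -> \int[leb3]_(x in box l r `&` E) g x = 0.
Proof.
move=> hg h lr.
have ig : intble leb3 B g by apply: sqint_intble1 => //; [exact: mB1|exact: leb3_B1_fin].
have h' l' r' : \int[leb3]_(x in box l r `&` box l' r') g x = 0.
  rewrite box_setI; apply: h; apply: subset_trans lr; apply: cbox_sub => i.
    by rewrite le_max lexx.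
  by rewrite ge_min lexx.
pose cy i (A : set (measurableTypeR R)) : set (mR3 R) := coord i @^-1` A.
have mcy i A : measurable A -> measurable (cy i A).
  by move=> mA; rewrite -[X in measurable X]setTI; exact: measurable_coord.
have mbox := measurable_box l r.
have igS S : measurable S -> intble leb3 (box l r `&` S) g.
  move=> mS; apply: integrableS ig; [exact: mB1|exact: measurableI|].
  by move=> x [/box_sub_cbox/lr].
have mcy' i a b : measurable (cy i `]a, b]%classic) by apply: mcy.
have gen i (S : set (mR3 R)) : measurable S ->
  (forall a b : R, \int[leb3]_(x in box l r `&` S `&` cy i `]a, b]%classic) g x = 0) ->
  forall A, measurable A -> \int[leb3]_(x in box l r `&` S `&` cy i A) g x = 0.
  move=> mS hab A mA.
  apply: (@zero_integral_generated _ _ _ leb3 _ (measurableTypeR R) _ g (coord i) (@ocitv R)) => //.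
  - exact: measurableI.
  - exact: igS.
  - exact: measurable_coord.
  - exact: ocitvI.
  - rewrite -(hab (l i) (r i)); congr (Rintegral _ _ _).
    apply/seteqP; split=> [x [hx Sx]|x [[]]//].
    by split => //; rewrite /cy/= in_itv/=; exact: hx.
  - by move=> _ [[a b] _ <-]; exact: hab.
have S2 a0 b0 a1 b1 A2 : measurable A2 ->
    \int[leb3]_(x in box l r `&` (cy 0 `]a0, b0]%classic `&` cy 1 `]a1, b1]%classic) `&` cy 2 A2) g x = 0.
  apply: gen => [|a2 b2]; first exact: measurableI.
  rewrite -(h' (fun i => [:: a0; a1; a2]`_i) (fun i => [:: b0; b1; b2]`_i)) -setIA.
  congr (Rintegral _ (_ `&` _) _).
  apply/seteqP; split=> [x [[/= h0 h1] h2]|x hx].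
    by move: h0 h1 h2; rewrite /cy/= !in_itv/= => h0 h1 h2; elim/I3P.
  by split; [split|]; rewrite /cy/= in_itv/=; [exact: (hx 0)|exact: (hx 1)|exact: (hx 2)].
have S1 a0 b0 A1 A2 : measurable A1 -> measurable A2 ->
    \int[leb3]_(x in box l r `&` (cy 0 `]a0, b0]%classic `&` cy 2 A2) `&` cy 1 A1) g x = 0.
  move=> mA1 mA2; apply: gen => // [|a1 b1]; first by apply: measurableI => //; exact: mcy.
  rewrite -(S2 a0 b0 a1 b1 A2)//; congr (Rintegral _ _ _).
  by rewrite -!setIA; congr (_ `&` (_ `&` _)); exact: setIC.
have S0 A0 A1 A2 : measurable A0 -> measurable A1 -> measurable A2 ->
    \int[leb3]_(x in box l r `&` (cy 1 A1 `&` cy 2 A2) `&` cy 0 A0) g x = 0.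
  move=> mA0 mA1 mA2; apply: gen => // [|a0 b0]; first by apply: measurableI; exact: mcy.
  rewrite -(S1 a0 b0 A1 A2)//; congr (Rintegral _ _ _).
  by rewrite -!setIA; congr (_ `&` _); rewrite setIA setIC; congr (_ `&` _); exact: setIC.
have F2 A2 : measurable A2 -> forall E, measurable E ->
    \int[leb3]_(x in box l r `&` cy 2 A2 `&` fst @^-1` E) g x = 0.
  move=> mA2.
  apply: (@zero_integral_generated _ _ _ leb3 _ (measurableTypeR R * measurableTypeR R)%type
     _ g fst [set A `*` A' | A in measurable & A' in measurable]) => //.
  - by apply: measurableI => //; exact: mcy.
  - by apply: igS; exact: mcy.
  - move=> _ _ [A mA [A' mA' <-]] [C mC [C' mC' <-]].
    exists (A `&` C); first exact: measurableI.
    by exists (A' `&` C'); [exact: measurableI|rewrite setXI].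
  - exact: measurable_prod_measurableType.
  - have := S0 setT setT A2 measurableT measurableT mA2.
    by rewrite /cy !preimage_setT setTI setIT.
  - move=> _ [A mA [A' mA' <-]]; rewrite -(S0 A A' A2)//; congr (Rintegral _ _ _).
    rewrite -!setIA; congr (_ `&` _).
    by apply/seteqP; split=> [x [? []]//|x [? []]].
apply: (@zero_integral_generated _ _ _ leb3 _ (mR3 R) _ g id
   [set A `*` A' | A in measurable & A' in measurable]) => //.
- by rewrite -[box l r]setIT; exact: igS.
- move=> _ _ [A mA [A' mA' <-]] [C mC [C' mC' <-]].
  exists (A `&` C); first exact: measurableI.
  by exists (A' `&` C'); [exact: measurableI|rewrite setXI].
- exact: measurable_prod_measurableType.
- exact: h.
- move=> _ [A mA [A' mA' <-]]; rewrite -(F2 A' mA' A mA); congr (Rintegral _ _ _).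
  by rewrite -setIA; congr (_ `&` _); apply/seteqP; split=> [x []//|x []].
Qed.

(** Its role is to make weak derivatives unique almost everywhere. Bumps give vanishing integrals
    over boxes, hence over their measurable subsets, hence [g = 0] almost everywhere on each box of
    a countable cover. *)
Lemma fundamental_lemma g : sqint leb3 B g ->
  (forall phi, test_function B1 phi -> \int[leb3]_(x in B) (g x * phi x) = 0) ->
  {ae (@leb3 R), forall x, B1 x -> g x = 0}.
Proof.
move=> hg h; have [lb [rb [lrB _ cov]]] := B1_box_cover.
have bz := box_integral_zero hg h.
have ig : intble leb3 B g by apply: sqint_intble1 => //; [exact: mB1|exact: leb3_B1_fin].
have key n : {ae (@leb3 R), forall x, box (lb n) (rb n) x -> g x = 0}.
  have igb : intble leb3 (box (lb n) (rb n)) g.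
    apply: integrableS ig; [exact: mB1|exact: measurable_box|].
    by move=> x /box_sub_cbox/lrB.
  have : ae_eq leb3 (box (lb n) (rb n)) (EFin \o g) (cst 0%E).
    have H := @integral_ae_eq _ _ _ leb3 _ (measurable_box (lb n) (rb n)) (cst 0%E) _ igb (measurable_cst _).
    apply: H => E Esub mE; rewrite integral0.
    have := sub_integral_zero hg bz (lrB n) mE.
    rewrite setIidr// => E0.
    rewrite -[LHS]fineK; first by congr EFin.
    by apply: integrable_fin_num => //; apply: integrableS igb; first exact: measurable_box.
  by apply: filterS => x /= /[apply] -[].
apply: filterS (ae_foralln key) => x hx /cov[n]; exact: hx.
Qed.

End Fundamental.

(** * Weak derivatives *)

Section WeakPartials.
Context {R : realType}.
Implicit Types (u v g h phi : R3 R -> R) (k : 'I_3) (l r : 'I_3 -> R).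
Local Notation mB1 := measurable_B1.
Local Notation B := (@B1 R : set (mR3 R)).
Local Notation sq := (sqint leb3 B).
Local Notation nB := (nsq leb3 B).

(** The defining identity lives in [\bar R]. For square-integrable functions both sides are finite,
    so it can be read in [R], where integrals are linear. *)
Lemma weak_partialP k u g : sq u ->
  is_weak_partial B1 k u g <-> sq g /\
  forall phi, test_function B1 phi ->
    \int[leb3]_(x in B) (u x * 'D_(basis3 k) phi x) =
    - \int[leb3]_(x in B) (g x * phi x).
Proof.
move=> hu; split=> -[hg h]; split => // phi hphi.
- by rewrite /Rintegral (h phi hphi) fineN.
- have i1 := sqintM_intble mB1 hu (test_sqint (test_derive k hphi)).
  have i2 := sqintM_intble mB1 hg (test_sqint hphi).
  have f1 := integrable_fin_num mB1 i1.
  have f2 := integrable_fin_num mB1 i2.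
  by rewrite -[LHS]fineK// -[in RHS](fineK f2) -EFinN -(h phi hphi).
Qed.

Lemma weak_partial_lin k (a b : R) u v g h : sq u -> sq v ->
  is_weak_partial B1 k u g -> is_weak_partial B1 k v h ->
  is_weak_partial B1 k (fun x => a * u x + b * v x) (fun x => a * g x + b * h x).
Proof.
move=> hu hv /(weak_partialP _ _ hu)[hg ug] /(weak_partialP _ _ hv)[hh vh].
have hau := sqintZ mB1 a hu; have hbv := sqintZ mB1 b hv.
apply: (iffRL (weak_partialP k _ (sqintD mB1 hau hbv))).
have hag := sqintZ mB1 a hg; have hbh := sqintZ mB1 b hh.
have hagh := sqintD mB1 hag hbh.
split; first exact hagh.
move=> phi hphi; have tp := test_sqint hphi; have td := test_sqint (test_derive k hphi).
have L (f1 f2 p : R3 R -> R) : sq f1 -> sq f2 -> sq p ->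
    \int[leb3]_(x in B) ((a * f1 x + b * f2 x) * p x) =
    a * \int[leb3]_(x in B) (f1 x * p x) + b * \int[leb3]_(x in B) (f2 x * p x).
  move=> h1 h2 hp; have i1 := sqintM_intble mB1 h1 hp; have i2 := sqintM_intble mB1 h2 hp.
  rewrite -!RintegralZl//; try exact: mB1.
  rewrite -(RintegralD mB1 (intbleZ mB1 a i1) (intbleZ mB1 b i2)).
  by apply: eq_Rintegral => x _; ring.
by rewrite !L// ug// vh//; ring.
Qed.

Lemma weak_partial_unique k u g h : sq u ->
  is_weak_partial B1 k u g -> is_weak_partial B1 k u h ->
  {ae (@leb3 R), forall x, B1 x -> g x = h x}.
Proof.
move=> hu /(weak_partialP _ _ hu)[hg ug] /(weak_partialP _ _ hu)[hh uh].
have hgh := sqintB mB1 hg hh.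
have : {ae (@leb3 R), forall x, B1 x -> g x - h x = 0}.
  apply: (fundamental_lemma hgh) => phi hphi; have tp := test_sqint hphi.
  rewrite (@eq_Rintegral _ _ _ leb3 B (fun x => g x * phi x - h x * phi x)); last first.
    by move=> x _; ring.
  rewrite (RintegralB mB1 (sqintM_intble mB1 hg tp) (sqintM_intble mB1 hh tp)).
  by rewrite -[X in X - _]opprK -ug// -[X in _ - X]opprK -uh// subrr.
by apply: filterS => x /= /[apply] /eqP; rewrite subr_eq0 => /eqP.
Qed.

(** Both sides of the defining identity are inner products with a fixed square-integrable function,
    hence continuous under L^2 convergence. *)
Lemma weak_partial_limit k (u_ g_ : nat -> R3 R -> R) u g :
  (forall n, sq (u_ n)) -> sq u -> sq g ->
  (forall n, is_weak_partial B1 k (u_ n) (g_ n)) ->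
  nB (fun x => u_ n x - u x) @[n --> \oo] --> 0 ->
  nB (fun x => g_ n x - g x) @[n --> \oo] --> 0 ->
  is_weak_partial B1 k u g.
Proof.
move=> hu_ hu hg hw cu cg; apply: (iffRL (weak_partialP k _ hu)); split => // phi hphi.
have tp := test_sqint hphi; have td := test_sqint (test_derive k hphi).
have hw' n := iffLR (weak_partialP k _ (hu_ n)) (hw n).
have h1 := cvg_inner mB1 hu_ hu td cu.
have h2 := cvg_inner mB1 (fun n => (hw' n).1) hg tp cg.
have h3 : (\int[leb3]_(x in B) (u_ n x * 'D_(basis3 k) phi x)) @[n --> \oo] -->
   - \int[leb3]_(x in B) (g x * phi x).
  rewrite (_ : (fun n => _) = (fun n => - \int[leb3]_(x in B) (g_ n x * phi x))).
    exact: cvgN.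
  by apply/funext => n; exact: (hw' n).2.
exact: cvg_unique h1 h3.
Qed.

Lemma wpartialP k u : W12 B1 u -> is_weak_partial B1 k u (wpartial B1 k u).
Proof. by move=> [_ /(_ k) [g hg]]; apply: (@xgetPex _ (fun=> 0) [set g | is_weak_partial B1 k u g]); exists g. Qed.

Lemma sq_wpartial k u : W12 B1 u -> sq (wpartial B1 k u).
Proof. by move=> /(wpartialP k)[]. Qed.

Lemma wpartial_ae k u g : W12 B1 u -> is_weak_partial B1 k u g ->
  {ae (@leb3 R), forall x, B1 x -> wpartial B1 k u x = g x}.
Proof. by move=> hu; apply: weak_partial_unique; [exact: hu.1|exact: wpartialP]. Qed.

Lemma ae_eq_nsq (D : set (mR3 R)) (f g : R3 R -> R) : measurable D -> D `<=` B ->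
  sqint leb3 D f -> sqint leb3 D g -> {ae (@leb3 R), forall x, B1 x -> f x = g x} ->
  nsq leb3 D f = nsq leb3 D g.
Proof.
move=> mD DB hf hg fg; rewrite /nsq /Rintegral; congr fine.
apply: ge0_ae_eq_integral => //.
- by apply/measurable_EFinP/measurable_funX; case: hf.
- by apply/measurable_EFinP/measurable_funX; case: hg.
- by move=> x _; rewrite lee_fin sqr_ge0.
- by move=> x _; rewrite lee_fin sqr_ge0.
- by apply: filterS fg => x /= h Dx; rewrite h//; exact: DB.
Qed.

Lemma sqintS (D E : set (mR3 R)) (f : R3 R -> R) : measurable D -> measurable E ->
  D `<=` E -> sqint leb3 E f -> sqint leb3 D f.
Proof.
move=> mD mE DE hf; apply: intble_sqint => //.
  by apply: measurable_funS hf.1.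
by apply: integrableS (sqint_intble hf).
Qed.

Definition upd (f : 'I_3 -> R) k c i := if i == k then c else f i.

Lemma box_indicE l r x :
  \1_(box l r) x = tensor (fun i t => (l i < t <= r i)%R%:R) x :> R.
Proof.
rewrite indicE; have [h|h] := boolP (x \in box l r).
  by rewrite /tensor big1// => i _; rewrite (set_mem h i).
have : ~ (box l r x) by move=> hb; move: h; rewrite mem_set.
move=> /existsNP[i /negP/negbTE hi]; apply/esym; apply: (@tensor_out _ _ _ i).
by rewrite hi.
Qed.

Lemma tensor_split (f : 'I_3 -> R -> R) k x :
  tensor f x = f k (coord k x) * \prod_(i < 3 | i != k) f i (coord i x).
Proof. by rewrite /tensor (bigD1 k). Qed.

Definition tents n k l r := subst1 (bumps n l r) k (smooth_tent n.+1%:R (l k) (r k)).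

Lemma test_tents n k l r : cbox l r `<=` B1 -> test_function B1 (tensor (tents n k l r)).
Proof.
move=> lr; apply: (test_tensor _ lr) => [i|i t].
  by rewrite /tents /subst1; case: eqP => _; [exact: smooth_smooth_tent|exact: smooth_bump].
move=> h; rewrite /tents /subst1; case: eqP => [ik|_]; last exact: bumps_out.
rewrite /smooth_tent bump_out ?mul0r//; rewrite ik in h.
by apply: contra h => /andP[/ltW -> /ltW ->].
Qed.

Lemma derive_tents n k l r x : 'D_(basis3 k) (tensor (tents n k l r)) x =
  tensor (subst1 (bumps n l r) k (smooth_tent' n.+1%:R (l k) (r k))) x.
Proof.
have := @is_derive_tensor R (tents n k l r) (smooth_tent' n.+1%:R (l k) (r k)) k x.
rewrite {1}/tents {1}/subst1 eqxx => /(_ (is_derive_smooth_tent _ _ _ _)) [_ ->].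
by congr (tensor _ x); apply/funext => i; rewrite /tents /subst1; case: eqP.
Qed.

Lemma haar_indicE k l r x : l k <= r k -> (forall i, coord i x != r i) ->
  tensor (subst1 (fun i t => (l i < t < r i)%R%:R) k (haar (l k) (r k))) x =
  \1_(box l (upd r k ((l k + r k) / 2))) x - \1_(box (upd l k ((l k + r k) / 2)) r) x :> R.
Proof.
move=> lr hx; rewrite !box_indicE !(tensor_split _ k) /subst1 /upd eqxx.
have E (l' r' : 'I_3 -> R) : (forall i, i != k -> l' i = l i /\ r' i = r i) ->
  \prod_(i < 3 | i != k) (l' i < coord i x <= r' i)%R%:R =
  \prod_(i < 3 | i != k) (if i == k then haar (l k) (r k) else
     fun t => (l i < t < r i)%R%:R) (coord i x) :> R.
  move=> h; apply: eq_bigr => i ik; have [-> ->] := h i ik.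
  by rewrite (negbTE ik) /= [X in _ && X]le_eqVlt (negbTE (hx i)).
rewrite (E l (fun i => if i == k then (l k + r k) / 2 else r i)); last first.
  by move=> i /negbTE ->.
rewrite (E (fun i => if i == k then (l k + r k) / 2 else l i) r); last first.
  by move=> i /negbTE ->.
rewrite -mulrBl; congr (_ * _).
have hk := hx k; set t := coord k x in hk *; rewrite /haar.
case: (ltP (l k) t) => h1 /=; last first.
  by rewrite (_ : ((l k + r k) / 2 < t) = false) ?subrr//; apply/negbTE; rewrite -leNgt; lra.
case: (ltP t (r k)) => h2 /=; last first.
  have h3 : r k < t by rewrite lt_neqAle eq_sym hk.
  rewrite (_ : (t <= (l k + r k) / 2) = false); last by apply/negbTE; rewrite -ltNge; lra.
  rewrite (_ : (t <= r k) = false); last by apply/negbTE; rewrite -ltNge.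
  by rewrite andbF subrr.
by case: leP => h4; rewrite ?(ltW h2)/= ?subr0 ?sub0r.
Qed.

Lemma integral_indic_sqint (g : R3 R -> R) l r : sq g -> sq (fun x => g x * \1_(box l r) x).
Proof.
move=> hg; split.
  apply: measurable_funM; first by case: hg.
  by apply: measurable_indic; exact: measurable_box.
case: hg => mg; apply: le_lt_trans; apply: ge0_le_integral => //.
- exact: mB1.
- by move=> x _; rewrite lee_fin sqr_ge0.
- apply/measurable_EFinP/measurable_funX/measurable_funM => //.
  by apply: measurable_indic; exact: measurable_box.
- exact/measurable_EFinP/measurable_funX.
- move=> x _; rewrite lee_fin exprMn indicE.
  by case: (_ \in _); rewrite ?expr1n ?mulr1// expr0n/= mulr0 sqr_ge0.
Qed.

Lemma nsq_box (g : R3 R -> R) l r : cbox l r `<=` B1 ->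
  nsq leb3 (box l r) g = nB (fun x => g x * \1_(box l r) x).
Proof.
move=> lr; rewrite /nsq Rintegral_box//; apply: eq_Rintegral => x _.
by rewrite exprMn indicE; case: (_ \in _); rewrite ?expr1n// expr0n.
Qed.

Lemma vol_ge0 l r : (forall i, l i <= r i) -> 0 <= vol l r.
Proof. by move=> lr; apply: prodr_ge0 => i _; rewrite subr_ge0. Qed.

Lemma Rintegral_box_cst l r c : (forall i, l i <= r i) ->
  \int[leb3]_(x in box l r) c = c * vol l r.
Proof.
move=> lr; rewrite (Rintegral_cst _ (measurable_box l r)); congr (c * _).
by have /(congr1 fine) := leb3_box lr.
Qed.

(* Integrating [u] against the Haar function of the box in direction [k], the
   derivative of a tent of height [(r k - l k) / 2], and Cauchy-Schwarz. *)
Lemma haar_estimate k u g l r : sq u -> is_weak_partial B1 k u g ->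
  cbox l r `<=` B1 -> (forall i, l i <= r i) ->
  (\int[leb3]_(x in box l (upd r k ((l k + r k) / 2))) u x
   - \int[leb3]_(x in box (upd l k ((l k + r k) / 2)) r) u x) ^+ 2
  <= ((r k - l k) / 2) ^+ 2 * vol l r * nsq leb3 (box l r) g.
Proof.
move=> hu hw lr l_r; have [hg hw'] := iffLR (weak_partialP k _ hu) hw.
set c := (l k + r k) / 2.
have ck : l k <= c <= r k by have := l_r k; rewrite /c => h; apply/andP; split; lra.
have lc : cbox l (upd r k c) `<=` B1.
  apply: subset_trans lr; apply: cbox_sub => // i; rewrite /upd; case: eqP => // ->.
  by case/andP: ck.
have cr : cbox (upd l k c) r `<=` B1.
  apply: subset_trans lr; apply: cbox_sub => // i; rewrite /upd; case: eqP => // ->.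
  by case/andP: ck.
have [mu1 _] := hu; have [mg _] := hg.
have iu : intble leb3 B u by apply: sqint_intble1 => //; [exact: mB1|exact: leb3_B1_fin].
have ig : intble leb3 B g by apply: sqint_intble1 => //; [exact: mB1|exact: leb3_B1_fin].
(* The limit of [tents]: the exact tent in direction [k], times the indicator of the open interval
   in the two others. Integration by parts is exact for the smooth tents and is passed to this
   limit. *)
pose tau := tensor (subst1 (fun i t => (l i < t < r i)%R%:R) k (tent (l k) (r k))).
have mI i : measurable_fun setT (fun t : R => (l i < t < r i)%R%:R : R).
  have -> : (fun t : R => (l i < t < r i)%R%:R : R) = \1_(`]l i, r i[%classic).
    apply/funext => t; rewrite indicE mem_setE/=; congr (_%:R).
  exact: measurable_indic.
have mtau : measurable_fun setT (tau : mR3 R -> R).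
  apply: measurable_tensor => i; rewrite /subst1; case: eqP => // _.
  apply: (measurable_fun_cvg (h := fun n => smooth_tent n.+1%:R (l k) (r k))) => [n|t _].
    apply: continuous_measurable_fun; apply: (@smooth_upto_continuous _ 0).
    exact: smooth_smooth_tent.
  exact: smooth_tent_cvg.
have C1 : (\int[leb3]_(x in B) (u x * 'D_(basis3 k) (tensor (tents n k l r)) x)) @[n --> \oo] -->
   \int[leb3]_(x in B) (u x * (\1_(box l (upd r k c)) x - \1_(box (upd l k c) r) x)).
  apply: (@dominated_Rintegral _ _ _ _ _ mB1 _ _ (fun x => 13 * `|u x|)).
  - move=> n; apply: measurable_funM => //.
    by case: (test_sqint (test_derive k (test_tents n k lr))).
  - apply: measurable_funM => //; apply: measurable_funB.
      by apply: measurable_indic; exact: measurable_box.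
    by apply: measurable_indic; exact: measurable_box.
  - by apply: intbleZ; [exact: mB1|exact: integrable_norm].
  - move=> n x _; rewrite normrM mulrC ler_wpM2r// derive_tents (tensor_split _ k) normrM.
    rewrite /subst1 eqxx -[leRHS]mulr1 ler_pM//; first exact: smooth_tent'_bound.
    rewrite normr_prod; apply: prodr_ile1 => i /negbTE ->.
    by rewrite normr_ge0 ger0_norm ?bump_ge0 ?bump_le1.
  - apply: filterS (ae_off_planes r) => x hx _; apply: cvgM; first exact: cvg_cst.
    rewrite -haar_indicE//; under eq_fun do rewrite derive_tents.
    apply: (@tensor_cvg _ (fun n => subst1 (bumps n l r) k (smooth_tent' n.+1%:R (l k) (r k)))) => i.
    rewrite /subst1; case: eqP => // _; [exact: smooth_tent'_cvg|exact: bump_cvg].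
have C2 : (\int[leb3]_(x in B) (g x * tensor (tents n k l r) x)) @[n --> \oo] -->
   \int[leb3]_(x in B) (g x * tau x).
  apply: (@dominated_Rintegral _ _ _ _ _ mB1 _ _ (fun x => 3 * (r k - l k) * `|g x|)).
  - move=> n; apply: measurable_funM => //.
    by case: (test_sqint (test_tents n k lr)).
  - by apply: measurable_funM => //; exact: measurable_funTS.
  - by apply: intbleZ; [exact: mB1|exact: integrable_norm].
  - move=> n x _; rewrite normrM mulrC ler_wpM2r// (tensor_split _ k) normrM.
    rewrite /tents /subst1 eqxx -[leRHS]mulr1 ler_pM//; first exact: smooth_tent_bound.
    rewrite normr_prod; apply: prodr_ile1 => i /negbTE ->.
    by rewrite normr_ge0 ger0_norm ?bump_ge0 ?bump_le1.
  - apply: aeW => x _; apply: cvgM; first exact: cvg_cst.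
    apply: (@tensor_cvg _ (fun n => tents n k l r)) => i.
    rewrite /tents /subst1; case: eqP => // _; [exact: smooth_tent_cvg|exact: bump_cvg].
have E1 : \int[leb3]_(x in B) (u x * (\1_(box l (upd r k c)) x - \1_(box (upd l k c) r) x)) =
    - \int[leb3]_(x in B) (g x * tau x).
  apply: (cvg_unique _ C1) => //.
  rewrite (_ : (fun n => _) = (fun n => - \int[leb3]_(x in B) (g x * tensor (tents n k l r) x))).
    exact: cvgN C2.
  by apply/funext => n; rewrite hw'//; exact: test_tents.
have E2 : \int[leb3]_(x in box l (upd r k c)) u x - \int[leb3]_(x in box (upd l k c) r) u x =
    - \int[leb3]_(x in B) (g x * tau x).
  rewrite -E1 !Rintegral_box//.
  have i1 : intble leb3 B (fun x => u x * \1_(box l (upd r k c)) x).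
    by apply: sqint_intble1 => //; [exact: mB1|exact: leb3_B1_fin|exact: integral_indic_sqint].
  have i2 : intble leb3 B (fun x => u x * \1_(box (upd l k c) r) x).
    by apply: sqint_intble1 => //; [exact: mB1|exact: leb3_B1_fin|exact: integral_indic_sqint].
  rewrite -(RintegralB mB1 i1 i2); apply: eq_Rintegral => x _; ring.
rewrite E2 sqrrN.
have taub x : `|tau x| <= (r k - l k) / 2 * \1_(box l r) x.
  rewrite box_indicE /tau !(tensor_split _ k) /subst1 eqxx normrM.
  have p1 : `|\prod_(i < 3 | i != k) (if i == k then tent (l k) (r k) else
     (fun t : R => (l i < t < r i)%R%:R)) (coord i x)| <=
     \prod_(i < 3 | i != k) (l i < coord i x <= r i)%R%:R.
    rewrite normr_prod; apply: ler_prod => i /negbTE ->; rewrite normr_ge0/= ger0_norm//.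
    by rewrite ler_nat; case: (boolP (l i < coord i x < r i)) => // /andP[-> /ltW ->].
  rewrite mulrA; apply: ler_pM => //.
  have := @tent_bound R (l k) (r k) (coord k x) (l_r k).
  rewrite /tent; case: (boolP (l k < coord k x < r k)) => [/andP[-> /ltW ->]|_]; first by rewrite mulr1.
  by rewrite !normr0 => h; rewrite mulr_ge0.
have stau : sq tau.
  apply: (@sqint_bounded _ _ _ _ _ mB1 _ ((r k - l k) / 2)) => //.
  - exact: leb3_B1_fin.
  - exact: measurable_funTS.
  - move=> x _; apply: le_trans (taub x) _; have := l_r k => h.
    by apply: ler_piMr; [lra|rewrite indicE lern1 leq_b1].
have s1 := integral_indic_sqint (fun=> 1).
(* [tau] vanishes off the box, so only the norm of [g] on the box enters Cauchy-Schwarz. *)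
rewrite (@eq_Rintegral _ _ _ leb3 B (fun x => (g x * \1_(box l r) x) * tau x)); last first.
  move=> x _; have := taub x; rewrite indicE; case: (_ \in _); rewrite ?mulr1// mulr0 normr_le0.
  by move=> /eqP ->; rewrite !mulr0.
apply: le_trans (cauchy_schwarz mB1 (integral_indic_sqint _ _ hg) stau) _.
rewrite -nsq_box// mulrC ler_wpM2r ?nsq_ge0//.
have s1b : sq (fun x => (r k - l k) / 2 * (1 * \1_(box l r) x)).
  have h1 : sq (fun=> 1) by apply: (@sqint_bounded _ _ _ _ _ mB1 _ 1) => //; [exact: leb3_B1_fin|move=> *; rewrite normr1].
  exact (sqintZ mB1 _ (integral_indic_sqint l r h1)).
apply: (@le_trans _ _ (nB (fun x => (r k - l k) / 2 * (1 * \1_(box l r) x)))).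
  apply: (le_nsq mB1) => // x _; rewrite mul1r (le_trans (taub x))// ler_norm//.
rewrite /nsq (@eq_Rintegral _ _ _ leb3 B (fun x => ((r k - l k) / 2) ^+ 2 * \1_(box l r) x)); last first.
  by move=> x _; rewrite mul1r exprMn indicE; case: (_ \in _); rewrite ?expr1n// expr0n.
by rewrite -Rintegral_box// Rintegral_box_cst.
Qed.

End WeakPartials.

(** * Poincare's inequality and Rellich's theorem *)

Section Poincare.
Context {R : realType}.
Implicit Types (u v g h phi : R3 R -> R) (k : 'I_3) (l r : 'I_3 -> R).
Local Notation mB1 := measurable_B1.
Local Notation B := (@B1 R : set (mR3 R)).
Local Notation sq := (sqint leb3 B).
Local Notation nB := (nsq leb3 B).

Lemma nbhs_coord (x : R3 R) (A : set (R3 R)) : nbhs x A <->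
  exists2 e, 0 < e & forall y, (forall i, `|coord i x - coord i y| < e) -> A y.
Proof.
split.
  move=> /nbhs_ballP[e e0 hA]; exists e => // y hy; apply: hA.
  by split; [split|]; [exact: (hy 0)|exact: (hy 1)|exact: (hy 2)].
move=> [e e0 hA]; apply/nbhs_ballP; exists e => // y [[h0 h1] h2]; apply: hA.
by elim/I3P.
Qed.

Lemma open_B1 : open (B1 : set (R3 R)).
Proof.
rewrite openE => x Bx; apply/nbhs_coord.
exists ((1 - normsq3 x) / 10).
  by rewrite divr_gt0// subr_gt0.
by move=> y hy; apply: (cbox_near Bx (lexx _)) => i; rewrite distrC ltW.
Qed.

Lemma uniform_continuity_box u l r (e : R) : {within B1bar, continuous u} ->
  cbox l r `<=` B1 -> 0 < e -> exists2 d : R, 0 < d &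
  forall x y, cbox l r x -> cbox l r y -> (forall i, `|coord i x - coord i y| <= d) ->
  `|u x - u y| <= e.
Proof.
move=> cu lr e0.
have cuB : {in B1, continuous u}.
  rewrite -continuous_open_subspace; last exact: open_B1.
  by apply: continuous_subspaceW cu => x; rewrite /B1/B1bar/= => /ltW.
have /compact_near_coveringP cK := @compact_cbox R l r.
pose P (d : R) (x : R3 R) := forall y, cbox l r y -> (forall i, `|coord i x - coord i y| <= d) ->
  `|u x - u y| <= e.
have : \forall d \near 0^'+, cbox l r `<=` P d.
  apply: cK => x Kx.
  have /nbhs_coord[d d0 hd] : nbhs x [set y | `|u x - u y| < e / 2].
    have : {for x, continuous u} by apply: cuB; rewrite inE; exact: lr.
    by move/cvgrPdist_lt => /(_ (e / 2)); apply; rewrite divr_gt0.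
  exists ([set x' | forall i, `|coord i x - coord i x'| < d / 2], [set t | t < d / 2]) => /=.
    split; last by apply: nbhs_right_lt; rewrite divr_gt0.
    by apply/nbhs_coord; exists (d / 2); rewrite ?divr_gt0.
  move=> [x' t] /= [hx' ht] y Ky hy.
  have h1 : `|u x - u x'| < e / 2.
    by apply: hd => i; rewrite (lt_trans (hx' i))//; lra.
  have h2 : `|u x - u y| < e / 2.
    apply: hd => i; rewrite (le_lt_trans (ler_distD (coord i x') _ _))//.
    by have := hx' i; have := hy i; lra.
  rewrite (le_trans (ler_distD (u x) _ _))// distrC; lra.
move=> h; have [d [d0 hd]] : exists d : R, 0 < d /\ cbox l r `<=` P d.
  near (0 : R)^'+ => d; exists d; split; [by []|near: d; exact: h].
by exists d => // x y /hd; apply.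
Unshelve. all: by end_near. Qed.

Lemma box_split l r k c : l k <= c <= r k ->
  box l r = box l (upd r k c) `|` box (upd l k c) r.
Proof.
move=> /andP[lc cr]; apply/seteqP; split=> [x h|x [h|h] i].
- have [xc|cx] := leP (coord k x) c; [left|right] => i; have := h i; rewrite /upd;
    case: eqP => // ->; first by rewrite xc andbT => /andP[].
  by rewrite cx => /andP[].
- have := h i; rewrite /upd; case: eqP => // -> /andP[-> h2]; exact: le_trans cr.
- have := h i; rewrite /upd; case: eqP => // -> /andP[h2 ->]; rewrite andbT; exact: le_lt_trans h2.
Qed.

Lemma box_split_disj l r k c : [disjoint box l (upd r k c) & box (upd l k c) r].
Proof.
apply/disj_setPRL => x h /= h'; have := h k; have := h' k.
by rewrite /upd eqxx => /andP[_ h1] /andP[h2 _]; have := lt_le_trans h2 h1; rewrite ltxx.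
Qed.

Lemma Rintegral_box_split l r k c f : l k <= c <= r k -> intble leb3 (box l r) f ->
  \int[leb3]_(x in box l r) f x =
  \int[leb3]_(x in box l (upd r k c)) f x + \int[leb3]_(x in box (upd l k c) r) f x.
Proof.
move=> h; rewrite {1 2}(box_split h) => hf; apply: Rintegral_setU => //.
- exact: measurable_box.
- exact: measurable_box.
- exact: box_split_disj.
Qed.

Lemma vol_half l r k : let c := (l k + r k) / 2 in
  vol l (upd r k c) = vol l r / 2 /\ vol (upd l k c) r = vol l r / 2.
Proof.
move=> c; rewrite /vol (bigD1 k)//= [in X in _ /\ X](bigD1 k)//= [\prod_(i < 3) (r i - l i)](bigD1 k)//=.
have h1 : \prod_(i < 3 | i != k) (upd r k c i - l i) = \prod_(i < 3 | i != k) (r i - l i).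
  by apply: eq_bigr => i /negbTE ik; rewrite /upd ik.
have h2 : \prod_(i < 3 | i != k) (r i - upd l k c i) = \prod_(i < 3 | i != k) (r i - l i).
  by apply: eq_bigr => i /negbTE ik; rewrite /upd ik.
by rewrite h1 h2 /upd eqxx /c; split; field.
Qed.

(** The variance: the integral over the box of the squared difference between [u] and its mean, in
    expanded form. *)
Definition boxvar l r u :=
  nsq leb3 (box l r) u - (\int[leb3]_(x in box l r) u x) ^+ 2 / vol l r.

Lemma sq_box l r u : cbox l r `<=` B1 -> sq u -> sqint leb3 (box l r) u.
Proof.
move=> lr; apply: sqintS; [exact: measurable_box|exact: mB1|].
by move=> x /box_sub_cbox/lr.
Qed.

Lemma leb3_box_fin l r : (leb3 (box l r) < +oo)%E.
Proof.
pose m i := Num.max (r i) (l i).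
apply: (@le_lt_trans _ _ (leb3 (box l m))).
  apply: le_measure; rewrite ?inE; [exact: measurable_box|exact: measurable_box|].
  by move=> x h i; have /andP[h1 h2] := h i; rewrite h1/= le_max h2.
by rewrite leb3_box ?ltry// => i; rewrite /m le_max lexx orbT.
Qed.

Lemma intble_box l r u : cbox l r `<=` B1 -> sq u -> intble leb3 (box l r) u.
Proof.
move=> lr hu; apply: sqint_intble1 (sq_box lr hu); first exact: measurable_box.
exact: leb3_box_fin.
Qed.

Lemma cbox_halves l r k : cbox l r `<=` B1 -> (forall i, l i <= r i) ->
  let c := (l k + r k) / 2 in
  [/\ l k <= c <= r k, cbox l (upd r k c) `<=` B1 & cbox (upd l k c) r `<=` B1].
Proof.
move=> lr l_r c.
have hc : l k <= c <= r k by have := l_r k; rewrite /c => h; apply/andP; split; lra.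
by split => //; apply: subset_trans lr; apply: cbox_sub => // i; rewrite /upd; case: eqP => // ->;
  case/andP: hc.
Qed.

Lemma nsq_box_split l r k u : cbox l r `<=` B1 -> (forall i, l i <= r i) -> sq u ->
  let c := (l k + r k) / 2 in
  nsq leb3 (box l r) u = nsq leb3 (box l (upd r k c)) u + nsq leb3 (box (upd l k c) r) u.
Proof.
move=> lr l_r hu c; have [hc _ _] := cbox_halves k lr l_r.
by apply: Rintegral_box_split => //; apply: sqint_intble; exact: sq_box.
Qed.

(** With A and C the integrals over the two halves and V the volume, (A + C)^2 / V = 2 A^2 / V + 2
    C^2 / V - (A - C)^2 / V. Halving thus loses exactly (A - C)^2 / V, which [haar_estimate]
    bounds. *)
Lemma boxvar_split k u g l r : sq u -> is_weak_partial B1 k u g ->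
  cbox l r `<=` B1 -> (forall i, l i < r i) ->
  boxvar l r u <= boxvar l (upd r k ((l k + r k) / 2)) u +
    boxvar (upd l k ((l k + r k) / 2)) r u +
    (r k - l k) ^+ 2 / 4 * nsq leb3 (box l r) g.
Proof.
move=> hu hw lr l_r; set c := (l k + r k) / 2.
have l_r' i : l i <= r i by exact: ltW.
have [hc hL hR] := cbox_halves k lr l_r'; rewrite -/c in hc hL hR.
have := haar_estimate hu hw lr l_r'; rewrite -/c.
rewrite /boxvar (nsq_box_split k lr l_r' hu) -/c.
rewrite (Rintegral_box_split hc (intble_box lr hu)).
have [-> ->] := vol_half l r k.
have v0 : 0 < vol l r by apply: prodr_gt0 => i _; rewrite subr_gt0.
set A := \int[_]_(_ in box l _) _; set C := \int[_]_(_ in box _ r) _.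
set n1 := nsq _ (box l _) u; set n2 := nsq _ (box _ r) u; set G := nsq _ (box l r) _.
set V := vol l r in v0 *; move=> h.
have : (A - C) ^+ 2 / V <= ((r k - l k) / 2) ^+ 2 * G.
  by rewrite ler_pdivrMr// mulrAC.
have V0 : V != 0 by rewrite gt_eqF.
have -> : (A + C) ^+ 2 / V = A ^+ 2 / (V / 2) + C ^+ 2 / (V / 2) - (A - C) ^+ 2 / V by field.
have -> : ((r k - l k) / 2) ^+ 2 = (r k - l k) ^+ 2 / 4 by field.
lra.
Qed.

(** The mean is the constant nearest to [u] in L^2, so it may be replaced by the value of [u] at the
    corner [r], a point of the half-open box. *)
Lemma boxvar_osc u l r (e : R) : sq u -> cbox l r `<=` B1 -> (forall i, l i < r i) ->
  (forall x y, box l r x -> box l r y -> `|u x - u y| <= e) ->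
  boxvar l r u <= e ^+ 2 * vol l r.
Proof.
move=> hu lr l_r he.
have l_r' i : l i <= r i by exact: ltW.
have v0 : 0 < vol l r by apply: prodr_gt0 => i _; rewrite subr_gt0.
pose y0 : R3 R := (r 0, r 1, r 2).
have By0 : box l r y0 by elim/I3P; rewrite /coord/= l_r lexx.
pose c := u y0.
have mb := measurable_box l r.
have sb := sq_box lr hu.
have sc (a : R) : sqint leb3 (box l r) (fun=> a).
  apply: (@sqint_bounded _ _ _ _ _ mb _ `|a|) => //; first exact: leb3_box_fin.
have suc := sqintB mb sb (sc c).
have h1 : nsq leb3 (box l r) (fun x => u x - c) <= e ^+ 2 * vol l r.
  rewrite -Rintegral_box_cst//; apply: le_Rintegral => //.
  - exact: sqint_intble.
  - by apply: sqint_intble1 => //; exact: leb3_box_fin.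
  - move=> x hx; rewrite -(real_normK (num_real (u x - c))) lerXn2r ?nnegrE//; last exact: he.
    by rewrite (le_trans _ (he x y0 hx By0)).
apply: le_trans h1; rewrite /boxvar.
have -> : nsq leb3 (box l r) (fun x => u x - c) =
   nsq leb3 (box l r) u - 2 * c * \int[leb3]_(x in box l r) u x + c ^+ 2 * vol l r.
  rewrite (@eq_nsq _ _ _ leb3 (box l r) _ (fun x => 1 * u x + (- c) * 1)); last by move=> x _; ring.
  have := nsq_polar mb 1 (- c) sb (sc 1) => ->.
  rewrite (@eq_Rintegral _ _ _ leb3 (box l r) u (fun x => u x * 1)); last by move=> x _; rewrite mulr1.
  have -> : nsq leb3 (box l r) (fun=> 1) = vol l r.
    by rewrite /nsq expr1n Rintegral_box_cst// mul1r.
  by ring.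
set I := \int[_]_(_ in _) _; set V := vol l r in v0 *.
have : 0 <= (I - c * V) ^+ 2 / V by rewrite divr_ge0 ?sqr_ge0 ?ltW.
have V0 : V != 0 by rewrite gt_eqF.
have -> : (I - c * V) ^+ 2 / V = I ^+ 2 / V - 2 * c * I + c ^+ 2 * V by field.
lra.
Qed.

(* Halving a side costs one [haar_estimate]; the recursion stops when
   the oscillation of the continuous [u] on the boxes is below [e]. *)
Lemma poincare_continuous u (g : 'I_3 -> R3 R -> R) l r :
  sq u -> (forall k, is_weak_partial B1 k u (g k)) ->
  {within B1bar, continuous u} -> cbox l r `<=` B1 -> (forall i, l i < r i) ->
  boxvar l r u <= 3^-1 * \sum_(k < 3) (r k - l k) ^+ 2 * nsq leb3 (box l r) (g k).
Proof.
move=> hu hw cu lr0 l_r0.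
(* An error [e ^+ 2 * vol l r] may be allowed: taking for [e] the square root of an arbitrary
   positive number over the volume makes it negligible. *)
suff H (e : R) : 0 < e -> boxvar l r u <= e ^+ 2 * vol l r +
    3^-1 * \sum_(k < 3) (r k - l k) ^+ 2 * nsq leb3 (box l r) (g k).
  set K := 3^-1 * _ in H *.
  have v0 : 0 < vol l r by apply: prodr_gt0 => i _; rewrite subr_gt0.
  apply/ler_addgt0Pl => e e0.
  have := H (Num.sqrt (e / vol l r)); rewrite sqrtr_gt0 divr_gt0// => /(_ isT).
  rewrite sqr_sqrtr; last by rewrite divr_ge0// ltW.
  by rewrite divfK// gt_eqF.
move=> e0.
have [d d0 hd] := uniform_continuity_box cu lr0 e0.
(* Boxes in the ball have sides below 2, and 2 / d < M <= 2^M for the integer chosen, so [M]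
   halvings in each direction bring all sides down to at most [d]. *)
have [M hM] : exists M : nat, forall i, r i - l i <= d * 2 ^+ M.
  exists (Num.bound (2 / d)) => i0.
  have lc i : -1 < l i.
    have : B1 (l 0, l 1, l 2) by apply: lr0; elim/I3P; rewrite /coord/= lexx ltW.
    by move/B1_coord => h; move: i; elim/I3P; [have := h 0|have := h 1|have := h 2]; case/andP.
  have rc i : r i < 1.
    have : B1 (r 0, r 1, r 2) by apply: lr0; elim/I3P; rewrite /coord/= lexx andbT ltW.
    by move/B1_coord => h; move: i; elim/I3P; [have := h 0|have := h 1|have := h 2]; case/andP.
  apply: (@le_trans _ _ 2); first by have := lc i0; have := rc i0; lra.
  rewrite mulrC -ler_pdivrMr//; apply: ltW.
  have h : 2 / d < (Num.bound (2 / d))%:R by apply: archi_boundP; rewrite divr_ge0// ltW.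
  by apply: lt_le_trans h _; rewrite -natrX ler_nat ltnW// ltn_expl.
pose n0 := (M + M + M)%N.
(* [m i] counts the halvings left in direction [i], and the induction is on their total. The
   constant 1/3 solves K/4 + 1/4 = K: halving divides the squared side by 4 and costs a quarter of
   it. *)
suff H n (m : 'I_3 -> nat) l' r' : (\sum_(i < 3) m i = n)%N ->
    cbox l' r' `<=` cbox l r -> (forall i, l' i < r' i) ->
    (forall i, r' i - l' i <= d * 2 ^+ (m i)) ->
    boxvar l' r' u <= e ^+ 2 * vol l' r' +
    3^-1 * \sum_(k < 3) (r' k - l' k) ^+ 2 * nsq leb3 (box l' r') (g k).
  by apply: (H _ (fun=> M) l r).
elim: n m l' r' => [|n ih] m l' r' hm lr l_r hs.
  have m0 i : m i = 0%N by move/eqP: hm; rewrite sum_nat_eq0 => /forallP/(_ i)/implyP/(_ isT)/eqP.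
  have lrB : cbox l' r' `<=` B1 by apply: subset_trans lr0.
  apply: le_trans (boxvar_osc hu lrB l_r _) _.
    move=> x y hx hy; apply: hd; [by apply/lr/box_sub_cbox|by apply/lr/box_sub_cbox|] => i.
    have := hs i; rewrite m0 expr0 mulr1 => hi; apply: le_trans hi.
    have /andP[x1 x2] := hx i; have /andP[y1 y2] := hy i.
    by rewrite ler_norml; apply/andP; split; lra.
  by rewrite lerDl mulr_ge0// sumr_ge0// => i _; rewrite mulr_ge0 ?nsq_ge0 ?sqr_ge0.
have [k mk] : exists k, (0 < m k)%N.
  apply/existsP; rewrite -[X in is_true X]negbK negb_exists; apply/negP => /forallP h.
  by move: hm; rewrite big1// => i _; have := h i; rewrite -eqn0Ngt => /eqP.
have lrB : cbox l' r' `<=` B1 by apply: subset_trans lr0.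
have l_r' i : l' i <= r' i by exact: ltW.
pose c := (l' k + r' k) / 2.
have [hc hL hR] := cbox_halves k lrB l_r'; rewrite -/c in hc hL hR.
have := boxvar_split hu (hw k) lrB l_r; rewrite -/c => /le_trans; apply.
pose m' i := if i == k then (m k).-1 else m i.
have hm' : (\sum_(i < 3) m' i = n)%N.
  move: hm; rewrite (bigD1 k)//= [in X in _ -> X](bigD1 k)//= /m' eqxx.
  have -> : (\sum_(i < 3 | i != k) (if i == k then (m k).-1 else m i) = \sum_(i < 3 | i != k) m i)%N.
    by apply: eq_bigr => i /negbTE ->.
  by case: (m k) mk => // p _ /=; rewrite addSn => -[].
have hsk : c - l' k = (r' k - l' k) / 2 /\ r' k - c = (r' k - l' k) / 2.
  by rewrite /c; split; field.
have hs2 : (r' k - l' k) / 2 <= d * 2 ^+ (m k).-1.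
  by have := hs k; case: (m k) mk => // p _ /=; rewrite exprS; lra.
have iL := ih m' l' (upd r' k c) hm' _ _ _.
have iR := ih m' (upd l' k c) r' hm' _ _ _.
have {}iL : boxvar l' (upd r' k c) u <= e ^+ 2 * (vol l' r' / 2) +
  3^-1 * ((r' k - l' k) ^+ 2 / 4 * nsq leb3 (box l' (upd r' k c)) (g k) +
   \sum_(i < 3 | i != k) (r' i - l' i) ^+ 2 * nsq leb3 (box l' (upd r' k c)) (g i)).
  rewrite -(vol_half l' r' k).1 -/c.
  apply: le_trans (iL _ _ _) _.
  - by apply: subset_trans lr; apply: cbox_sub => // i; rewrite /upd; case: eqP => // ->; case/andP: hc.
  - by move=> i; rewrite /upd; case: eqP => // ->; have := l_r k; rewrite /c; lra.
  - by move=> i; rewrite /upd /m'; case: eqP => // ->; rewrite hsk.1.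
  - rewrite lerD2l ler_wpM2l// (bigD1 k)//= {1 2}/upd eqxx hsk.1 lerD//.
      by rewrite exprMn exprVn (_ : 2 ^+ 2 = 4)//; ring.
    by apply: ler_sum => i /negbTE ik; rewrite /upd ik.
have {}iR : boxvar (upd l' k c) r' u <= e ^+ 2 * (vol l' r' / 2) +
  3^-1 * ((r' k - l' k) ^+ 2 / 4 * nsq leb3 (box (upd l' k c) r') (g k) +
   \sum_(i < 3 | i != k) (r' i - l' i) ^+ 2 * nsq leb3 (box (upd l' k c) r') (g i)).
  rewrite -(vol_half l' r' k).2 -/c.
  apply: le_trans (iR _ _ _) _.
  - by apply: subset_trans lr; apply: cbox_sub => // i; rewrite /upd; case: eqP => // ->; case/andP: hc.
  - by move=> i; rewrite /upd; case: eqP => // ->; have := l_r k; rewrite /c; lra.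
  - by move=> i; rewrite /upd /m'; case: eqP => // ->; rewrite hsk.2.
  - rewrite lerD2l ler_wpM2l// (bigD1 k)//= {1 2}/upd eqxx hsk.2 lerD//.
      by rewrite exprMn exprVn (_ : 2 ^+ 2 = 4)//; ring.
    by apply: ler_sum => i /negbTE ik; rewrite /upd ik.
have sg i : sq (g i) by case: (hw i).
rewrite [X in _ <= _ + 3^-1 * X](bigD1 k)//=.
have nE i := nsq_box_split k lrB l_r' (sg i); rewrite /= -/c in nE.
rewrite (eq_bigr (fun i => (r' i - l' i) ^+ 2 * nsq leb3 (box l' (upd r' k c)) (g i) +
   (r' i - l' i) ^+ 2 * nsq leb3 (box (upd l' k c) r') (g i))); last first.
  by move=> i _; rewrite nE mulrDr.
rewrite big_split/= !nE.
move: iL iR.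
set S1 := \sum_(_ < _ | _) _; set S2 := \sum_(_ < _ | _) _.
set a := (r' k - l' k) ^+ 2; set G1 := nsq _ (box l' _) _; set G2 := nsq _ (box _ r') _.
set V := vol l' r'; lra.
Qed.

End Poincare.

Section NsqLimits.
Context d (T : measurableType d) (R : realType).
Variables (mu : {measure set T -> \bar R}) (D : set T).
Hypothesis mD : measurable D.

Lemma cvg_nsq (f_ : nat -> T -> R) f :
  (forall n, sqint mu D (f_ n)) -> sqint mu D f ->
  nsq mu D (fun x => f_ n x - f x) @[n --> \oo] --> 0 ->
  nsq mu D (f_ n) @[n --> \oo] --> nsq mu D f.
Proof.
move=> hf_ hf cv.
have E n : nsq mu D (f_ n) = nsq mu D (fun x => f_ n x - f x) +
    2 * (\int[mu]_(x in D) (f_ n x * f x)) - nsq mu D f.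
  rewrite (@eq_nsq _ _ _ mu D (fun x => f_ n x - f x) (fun x => 1 * f_ n x + (-1) * f x)); last first.
    by move=> x _; ring.
  by rewrite nsq_polar//; ring.
rewrite (_ : (fun n => _) = (fun n => nsq mu D (fun x => f_ n x - f x) +
    2 * (\int[mu]_(x in D) (f_ n x * f x)) - nsq mu D f)); last exact/funext.
have -> : nsq mu D f = 0 + 2 * (\int[mu]_(x in D) (f x * f x)) - nsq mu D f :> R.
  have -> : \int[mu]_(x in D) (f x * f x) = nsq mu D f.
    by apply: eq_Rintegral => x _; rewrite expr2.
  by ring.
rewrite {2}(_ : nsq mu D f = 0 + 2 * (\int[mu]_(x in D) (f x * f x)) - nsq mu D f); last first.
  have -> : \int[mu]_(x in D) (f x * f x) = nsq mu D f.
    by apply: eq_Rintegral => x _; rewrite expr2.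
  by ring.
apply: cvgB; last by apply: cvg_cst.
apply: cvgD => //; apply: cvgM; first exact: cvg_cst.
exact: cvg_inner.
Qed.

Lemma cvg_finsum (I : finType) (f : nat -> I -> R) (l : I -> R) :
  (forall i, f n i @[n --> \oo] --> l i) -> (\sum_i f n i) @[n --> \oo] --> \sum_i l i.
Proof.
move=> h; elim: (index_enum I) => [|i r ih].
  by rewrite big_nil; under eq_fun do rewrite big_nil; exact: cvg_cst.
by rewrite big_cons; under eq_fun do rewrite big_cons; exact: cvgD.
Qed.

Lemma squeeze0 (a b : nat -> R) : (forall n, 0 <= a n <= b n) ->
  b @ \oo --> 0 -> a @ \oo --> 0.
Proof.
move=> h hb; apply: (@squeeze_cvgr _ _ _ _ (fun=> 0) b) => //; last exact: cvg_cst.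
exact: nearW.
Qed.

End NsqLimits.

Section Traces.
Context {R : realType}.
Implicit Types (u v g h phi : R3 R -> R) (k : 'I_3) (l r : 'I_3 -> R).
Local Notation mB1 := measurable_B1.
Local Notation B := (@B1 R : set (mR3 R)).
Local Notation sq := (sqint leb3 B).
Local Notation nB := (nsq leb3 B).
Local Notation wp := (wpartial B1).

Definition wdist u v : R := nB (fun x => u x - v x) +
  \sum_(k < 3) nB (fun x => wp k u x - wp k v x).

Lemma sqB_wp k u v : W12 B1 u -> W12 B1 v -> sq (fun x => wp k u x - wp k v x).
Proof.
move=> /(sq_wpartial k) h1 /(sq_wpartial k) h2; exact (sqintB mB1 h1 h2).
Qed.

Lemma sqB_W12 u v : W12 B1 u -> W12 B1 v -> sq (fun x => u x - v x).
Proof. move=> [h1 _] [h2 _]; exact (sqintB mB1 h1 h2). Qed.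

Lemma W12_distsqE u v : W12 B1 u -> W12 B1 v -> W12_distsq B1 u v = (wdist u v)%:E.
Proof.
move=> hu hv; rewrite /W12_distsq /wdist.
have su := sqB_W12 hu hv; have sk k := sqB_wp k hu hv.
transitivity ((nB (fun x => u x - v x))%:E +
    \sum_(k < 3) (nB (fun x => wp k u x - wp k v x))%:E)%E; last by rewrite sumEFin -EFinD.
rewrite (nsqE mB1 su).
rewrite [LHS](_ : _ = \int[leb3]_(x in B) (((u x - v x) ^+ 2)%:E +
    \sum_(k < 3) ((wp k u x - wp k v x) ^+ 2)%:E))%E; last first.
  by apply: eq_integral => x _; rewrite EFinD -sumEFin.
rewrite ge0_integralD//.
- congr (_ + _)%E; rewrite ge0_integral_sum//.
  + by under eq_bigr do rewrite -(nsqE mB1 (sk _)).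
  + exact: mB1.
  + by move=> k; apply/measurable_EFinP/measurable_funX; case: (sk k).
  + by move=> k x _; rewrite lee_fin sqr_ge0.
- exact: mB1.
- by move=> x _; rewrite lee_fin sqr_ge0.
- by apply/measurable_EFinP/measurable_funX; case: su.
- by move=> x _; apply: sume_ge0 => k _; rewrite lee_fin sqr_ge0.
- apply: emeasurable_sum => k.
  by apply/measurable_EFinP/measurable_funX; case: (sk k).
Qed.

Lemma wdist_ge0 u v : 0 <= wdist u v.
Proof. by rewrite addr_ge0 ?nsq_ge0// sumr_ge0// => k _; exact: nsq_ge0. Qed.

Lemma wdist_nsq u v : nB (fun x => u x - v x) <= wdist u v.
Proof. by rewrite lerDl sumr_ge0// => k _; exact: nsq_ge0. Qed.

Lemma wdist_nsqk k u v : nB (fun x => wp k u x - wp k v x) <= wdist u v.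
Proof.
rewrite /wdist (bigD1 k)//= addrCA lerDl addr_ge0 ?nsq_ge0// sumr_ge0// => i _; exact: nsq_ge0.
Qed.

Lemma has_traceP u g : W12 B1 u -> has_trace u g <->
  exists v : nat -> R3 R -> R,
  [/\ forall n, W12 B1 (v n),
      forall n, {within B1bar, continuous (v n)},
      wdist (v n) u @[n --> \oo] --> 0 &
      (fun n => sphere_integral (fun x => (v n x - g x) ^+ 2)) @ \oo --> 0%E].
Proof.
move=> hu; split=> -[v [h1 h2 h3 h4]]; exists v; split => //.
  move: h3; rewrite (_ : (fun n => _) = (fun n => (wdist (v n) u)%:E)).
    by move/fine_cvg.
  by apply/funext => n; exact: W12_distsqE.
rewrite (_ : (fun n => _) = (fun n => (wdist (v n) u)%:E)).
  by apply: cvg_EFin => //; exact: nearW.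
by apply/funext => n; exact: W12_distsqE.
Qed.

Lemma le_nsq_box l r u : cbox l r `<=` B1 -> sq u -> nsq leb3 (box l r) u <= nB u.
Proof.
move=> lr hu; have sb := sq_box lr hu; rewrite -lee_fin (nsqE (measurable_box l r) sb) (nsqE mB1 hu).
 apply: ge0_subset_integral => //.
- exact: measurable_box.
- exact: mB1.
- by apply/measurable_EFinP/measurable_funX; case: hu.
- by move=> x _; rewrite lee_fin sqr_ge0.
- by move=> x /box_sub_cbox/lr.
Qed.

(* [G] plays the role of the gradient of [u]. *)
Definition cont_approx u (G : 'I_3 -> R3 R -> R) : Prop :=
  sq u /\ (forall k, sq (G k)) /\
  exists (v : nat -> R3 R -> R) (gv : nat -> 'I_3 -> R3 R -> R),
  [/\ forall n, sq (v n), forall n k, is_weak_partial B1 k (v n) (gv n k),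
      forall n, {within B1bar, continuous (v n)},
      nB (fun x => v n x - u x) @[n --> \oo] --> 0 &
      forall k, nB (fun x => gv n k x - G k x) @[n --> \oo] --> 0].

(** This is how the boundary condition enters compactness: the definition of the trace supplies
    approximants continuous on the closed ball, which take the place of a density theorem in
    W^{1,2}. *)
Lemma has_trace_approx u g : W12 B1 u -> has_trace u g -> cont_approx u (fun k => wp k u).
Proof.
move=> hu /(has_traceP _ hu)[v [hv cv dv _]]; split; first exact: hu.1.
split; first by move=> k; exact: sq_wpartial.
exists v, (fun n k => wp k (v n)); split => //.
- by move=> n; exact: (hv n).1.
- by move=> n k; exact: wpartialP.
- by apply: squeeze0 dv => n; rewrite nsq_ge0; exact: wdist_nsq.
- by move=> k; apply: squeeze0 dv => n; rewrite nsq_ge0; exact: wdist_nsqk.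
Qed.

Lemma cvg_nsqB (a b : nat -> R3 R -> R) (f g : R3 R -> R) :
  (forall n, sq (a n)) -> (forall n, sq (b n)) -> sq f -> sq g ->
  nB (fun x => a n x - f x) @[n --> \oo] --> 0 ->
  nB (fun x => b n x - g x) @[n --> \oo] --> 0 ->
  nB (fun x => (a n x - b n x) - (f x - g x)) @[n --> \oo] --> 0.
Proof.
move=> ha hb hf hg ca cb.
apply: (@squeeze0 _ _ (fun n => 2 * nB (fun x => a n x - f x) + 2 * nB (fun x => b n x - g x))).
  move=> n; rewrite nsq_ge0/=.
  have h1 := sqintB mB1 (ha n) hf; have h2 := sqintZ mB1 (-1) (sqintB mB1 (hb n) hg).
  have := le_nsq_sum mB1 h1 h2; rewrite (nsqZ mB1 _ (sqintB mB1 (hb n) hg)) sqrrN expr1n mul1r.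
  apply: le_trans; rewrite le_eqVlt; apply/orP; left; apply/eqP.
  by apply: eq_nsq => x _; ring.
rewrite -[X in _ --> X](addr0 0) -[in X in _ --> X + _](mulr0 2) -[in X in _ --> _ + X](mulr0 2).
by apply: cvgD; apply: cvgM => //; exact: cvg_cst.
Qed.

Lemma cont_approxB u G u' G' : cont_approx u G -> cont_approx u' G' ->
  cont_approx (fun x => u x - u' x) (fun k x => G k x - G' k x).
Proof.
move=> [su [sG [v [gv [sv wv cv dv dg]]]]] [su' [sG' [v' [gv' [sv' wv' cv' dv' dg']]]]].
have sgv n k : sq (gv n k) by case: (wv n k).
have sgv' n k : sq (gv' n k) by case: (wv' n k).
split; first exact (sqintB mB1 su su').
split; first by move=> k; exact (sqintB mB1 (sG k) (sG' k)).
exists (fun n x => v n x - v' n x), (fun n k x => gv n k x - gv' n k x); split.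
- by move=> n; exact (sqintB mB1 (sv n) (sv' n)).
- move=> n k; have := weak_partial_lin 1 (-1) (sv n) (sv' n) (wv n k) (wv' n k).
  by congr (is_weak_partial _ _ _ _); apply/funext => x; ring.
- by move=> n x; apply: cvgB; [exact: cv|exact: cv'].
- exact: cvg_nsqB.
- by move=> k; apply: (@cvg_nsqB (fun n => gv n k) (fun n => gv' n k)).
Qed.

(** Both sides are continuous under L^2 convergence of the function and of its gradient on the box,
    so the inequality passes from the continuous approximants to [u]. *)
Lemma poincare_approx u G l r : cont_approx u G ->
  cbox l r `<=` B1 -> (forall i, l i < r i) ->
  boxvar l r u <= 3^-1 * \sum_(k < 3) (r k - l k) ^+ 2 * nsq leb3 (box l r) (G k).
Proof.
move=> [su0 [sG0 [v [gv [sv0 wv cv c0 ck]]]]] lr l_r.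
have sgv n k : sq (gv n k) by case: (wv n k).
have mb := measurable_box l r.
have b0 : nsq leb3 (box l r) (fun x => v n x - u x) @[n --> \oo] --> 0.
  apply: squeeze0 c0 => n; rewrite nsq_ge0 le_nsq_box//; exact (sqintB mB1 (sv0 n) su0).
have bk k : nsq leb3 (box l r) (fun x => gv n k x - G k x) @[n --> \oo] --> 0.
  apply: squeeze0 (ck k) => n; rewrite nsq_ge0 le_nsq_box//; exact (sqintB mB1 (sgv n k) (sG0 k)).
have sv n := sq_box lr (sv0 n); have su := sq_box lr su0.
have svk k n := sq_box lr (sgv n k); have suk k := sq_box lr (sG0 k).
have s1 : sqint leb3 (box l r) (fun=> 1).
  by apply: (@sqint_bounded _ _ _ _ _ mb _ 1) => //; [exact: leb3_box_fin|move=> *; rewrite normr1].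
have C1 : nsq leb3 (box l r) (v n) @[n --> \oo] --> nsq leb3 (box l r) u by exact: cvg_nsq.
have C2 : (\int[leb3]_(x in box l r) (v n x * 1)) @[n --> \oo] --> \int[leb3]_(x in box l r) (u x * 1).
  by apply: cvg_inner => //.
have E1 (f : R3 R -> R) : \int[leb3]_(x in box l r) (f x * 1) = \int[leb3]_(x in box l r) f x.
  by apply: eq_Rintegral => x _; rewrite mulr1.
have {}C2 : (\int[leb3]_(x in box l r) v n x) @[n --> \oo] --> \int[leb3]_(x in box l r) u x.
  by rewrite -E1; move: C2; under eq_fun do rewrite E1.
have C3 : boxvar l r (v n) @[n --> \oo] --> boxvar l r u.
  rewrite /boxvar; apply: cvgB => //; apply: cvgM; last exact: cvg_cst.
  by apply: (@cvgM _ _ _ _ (fun n => _) (fun n => _)).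
have C4 : 3^-1 * (\sum_(k < 3) (r k - l k) ^+ 2 * nsq leb3 (box l r) (gv n k)) @[n --> \oo] -->
   3^-1 * \sum_(k < 3) (r k - l k) ^+ 2 * nsq leb3 (box l r) (G k).
  apply: cvgM; first exact: cvg_cst.
  apply: cvg_finsum => k; apply: cvgM; first exact: cvg_cst.
  by apply: (cvg_nsq mb (fun n => svk k n) (suk k)).
apply: ler_cvg_to C3 C4 _.
by apply: nearW => n; exact: poincare_continuous.
Qed.

End Traces.

(** * Limits along an ultrafilter and compactness on boxes *)

Section Ultrafilter.
Context {R : realType}.
Variable U : set_system nat.
Hypothesis UU : UltraFilter U.
Implicit Types (a : nat -> R).

(** By compactness of the segment, the ultrafilter gives every bounded sequence a limit without
    passing to subsequences; an actual subsequence is extracted only once, in [rellich]. *)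
Lemma ultra_bounded_cvg a (C : R) : (forall n, `|a n| <= C) ->
  exists l : R, forall e : R, 0 < e -> U [set n | `|a n - l| <= e].
Proof.
move=> aC.
have cK := @segment_compact R (- C) C.
have UP : ProperFilter U by exact: ultra_proper.
have FK : (a @ U) `[- C, C]%classic.
  have h : a @^-1` `[- C, C]%classic = setT.
    by apply/seteqP; split=> // n _ /=; rewrite in_itv/= -ler_norml.
  change (U (a @^-1` `[- C, C]%classic)); rewrite h; exact: filterT.
have [l [_ hl]] := cK (a @ U) _ FK.
exists l => e e0.
have [//|h] := in_ultra_setVsetC [set n | `|a n - l| <= e] UU.
have : (a @ U) (~` [set t | `|t - l| <= e]) by [].
have lN : nbhs l [set t | `|t - l| < e].
  by apply/nbhs_ballP; exists e => // y; rewrite /ball/= distrC.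
move=> /hl/(_ lN)[t [/= h1 h2]]; exfalso; apply: h1; exact: ltW.
Qed.

End Ultrafilter.

Section Rellich.
Context {R : realType}.
Implicit Types (u v g h phi : R3 R -> R) (k : 'I_3) (l r : 'I_3 -> R).
Local Notation mB1 := measurable_B1.
Local Notation B := (@B1 R : set (mR3 R)).
Local Notation sq := (sqint leb3 B).
Local Notation nB := (nsq leb3 B).
Variable U : set_system nat.
Hypothesis UU : UltraFilter U.
Variables (u : nat -> R3 R -> R) (G : nat -> 'I_3 -> R3 R -> R) (C : R).
Hypothesis hu : forall n, cont_approx (u n) (G n).
Hypothesis uC : forall n, nB (u n) <= C.
Hypothesis GC : forall n k, nB (G n k) <= C.

Let UP : ProperFilter U. Proof. exact: ultra_proper. Qed.

Let su n : sq (u n). Proof. by case: (hu n). Qed.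
Let sG n k : sq (G n k). Proof. by case: (hu n) => _ []. Qed.

Let dB n m := fun x => u n x - u m x.
Let dG n m k := fun x => G n k x - G m k x.

(** Cauchy-Schwarz bounds the square of the integral by [vol l r * C]; the 1 is there because |t| <=
    1 + t^2, which avoids a square root. *)
Lemma box_mean_bound n l r : cbox l r `<=` B1 -> (forall i, l i < r i) ->
  `|\int[leb3]_(x in box l r) u n x| <= 1 + vol l r * C.
Proof.
move=> lr l_r; have mb := measurable_box l r.
have l_r' i : l i <= r i by exact: ltW.
have s1 : sqint leb3 (box l r) (fun=> 1).
  by apply: (@sqint_bounded _ _ _ _ _ mb _ 1) => //; [exact: leb3_box_fin|move=> *; rewrite normr1].
have sb := sq_box lr (su n).
have := cauchy_schwarz mb s1 sb.
have -> : nsq leb3 (box l r) (fun=> 1) = vol l r.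
  by rewrite /nsq expr1n Rintegral_box_cst// mul1r.
rewrite (@eq_Rintegral _ _ _ leb3 (box l r) (u n)); last by move=> x _; rewrite mul1r.
set I := \int[_]_(_ in _) _ => h.
have : I ^+ 2 <= vol l r * C.
  apply: le_trans h _; rewrite ler_wpM2l ?vol_ge0//.
  exact: le_trans (le_nsq_box lr (su n)) (uC n).
set V := vol l r * C => h2; have V0 : 0 <= V by exact: le_trans (sqr_ge0 _) h2.
by rewrite ler_norml; apply/andP; split; nra.
Qed.

(* The estimate is additive under halving of boxes; on the smallest ones it is
   Poincare's inequality, the means being close along the ultrafilter. *)
Lemma ultra_cauchy_coarse (d : R) : 0 < d ->
  forall N (m : 'I_3 -> nat) l r, (\sum_(i < 3) m i = N)%N ->
  cbox l r `<=` B1 -> (forall i, l i < r i) ->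
  (forall i, r i - l i <= d * 2 ^+ (m i)) ->
  forall e : R, 0 < e -> exists2 A, U A & forall n p, A n -> A p ->
   nsq leb3 (box l r) (dB n p) <= e + d ^+ 2 *
     \sum_(k < 3) nsq leb3 (box l r) (dG n p k).
Proof.
move=> d0; elim=> [|N ih] m l r hm lr l_r hs e e0.
- have m0 i : m i = 0%N by move/eqP: hm; rewrite sum_nat_eq0 => /forallP/(_ i)/implyP/(_ isT)/eqP.
  have v0 : 0 < vol l r by apply: prodr_gt0 => i _; rewrite subr_gt0.
  have [I hI] := ultra_bounded_cvg UU (fun n => box_mean_bound n lr l_r).
  (* Two integrals within [eta] of [I] differ by at most 2 eta, and (2 eta)^2 <= 4 eta <= e vol
     because eta <= 1. *)
  pose eta := Num.min 1 (e * vol l r / 4).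
  have eta0 : 0 < eta by rewrite lt_min ltr01/= divr_gt0// mulr_gt0.
  exists [set n | `|\int[leb3]_(x in box l r) u n x - I| <= eta]; first exact: hI.
  move=> n p /= hn hp.
  have hd : cont_approx (dB n p) (dG n p) by exact: cont_approxB.
  have := poincare_approx hd lr l_r; rewrite /boxvar.
  rewrite (RintegralB (measurable_box l r) (intble_box lr (su n)) (intble_box lr (su p))).
  set a := \int[_]_(_ in _) _ in hn *; set b := \int[_]_(_ in _) _ in hp *.
  have hab : (a - b) ^+ 2 / vol l r <= e.
    rewrite ler_pdivrMr//.
    have : `|a - b| <= 2 * eta.
      have -> : a - b = (a - I) - (b - I) by ring.
      by rewrite (le_trans (ler_normB _ _))//; lra.
    have e1 : eta <= 1 by rewrite /eta ge_min lexx.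
    have e2 : eta <= e * vol l r / 4 by rewrite /eta ge_min lexx orbT.
    by rewrite ler_norml => /andP[h1 h2]; nra.
  set S := \sum_(_ < _) _; move=> h.
  have S0 : 0 <= S by rewrite /S sumr_ge0// => i _; rewrite mulr_ge0 ?nsq_ge0 ?sqr_ge0.
  have hS : 3^-1 * S <= d ^+ 2 * \sum_(k < 3) nsq leb3 (box l r) (dG n p k).
    apply: (@le_trans _ _ S); first lra.
    rewrite /S mulr_sumr; apply: ler_sum => i _; rewrite ler_wpM2r ?nsq_ge0//.
    have := hs i; rewrite m0 expr0 mulr1 => hi.
    by rewrite lerXn2r ?nnegrE ?subr_ge0 ?(ltW (l_r i)) ?(ltW d0).
  by move: hab h hS; set q := _ / _; set N1 := nsq _ _ _; set S2 := _ * \sum_(_ < _) _; lra.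
- have [k mk] : exists k, (0 < m k)%N.
    apply/existsP; rewrite -[X in is_true X]negbK negb_exists; apply/negP => /forallP h.
    by move: hm; rewrite big1// => i _; have := h i; rewrite -eqn0Ngt => /eqP.
  have l_r' i : l i <= r i by exact: ltW.
  have [hc hL hR] := cbox_halves k lr l_r'; set c := (l k + r k) / 2 in hc hL hR.
  pose m' i := if i == k then (m k).-1 else m i.
  have hm' : (\sum_(i < 3) m' i = N)%N.
    move: hm; rewrite (bigD1 k)//= [in X in _ -> X](bigD1 k)//= /m' eqxx.
    have -> : (\sum_(i < 3 | i != k) (if i == k then (m k).-1 else m i) = \sum_(i < 3 | i != k) m i)%N.
      by apply: eq_bigr => i /negbTE ->.
    by case: (m k) mk => // p _ /=; rewrite addSn => -[].
  have hsk : c - l k = (r k - l k) / 2 /\ r k - c = (r k - l k) / 2.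
    by rewrite /c; split; field.
  have hs2 : (r k - l k) / 2 <= d * 2 ^+ (m k).-1.
    by have := hs k; case: (m k) mk => // p _ /=; rewrite exprS; lra.
  have e2 : 0 < e / 2 by rewrite divr_gt0.
  have [A UA hA] : exists2 A, U A & forall n p, A n -> A p ->
     nsq leb3 (box l (upd r k c)) (dB n p) <= e / 2 + d ^+ 2 *
     \sum_(k0 < 3) nsq leb3 (box l (upd r k c)) (dG n p k0).
    apply: (ih m') => //.
      by move=> i; rewrite /upd; case: eqP => // ->; have := l_r k; rewrite /c; lra.
    by move=> i; rewrite /upd /m'; case: eqP => // ->; rewrite hsk.1.
  have [A' UA' hA'] : exists2 A, U A & forall n p, A n -> A p ->
     nsq leb3 (box (upd l k c) r) (dB n p) <= e / 2 + d ^+ 2 *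
     \sum_(k0 < 3) nsq leb3 (box (upd l k c) r) (dG n p k0).
    apply: (ih m') => //.
      by move=> i; rewrite /upd; case: eqP => // ->; have := l_r k; rewrite /c; lra.
    by move=> i; rewrite /upd /m'; case: eqP => // ->; rewrite hsk.2.
  exists (A `&` A'); first exact: filterI.
  move=> n p [An A'n] [Ap A'p].
  have sd := sqintB mB1 (su n) (su p); have sdG i := sqintB mB1 (sG n i) (sG p i).
  rewrite (nsq_box_split k lr l_r' sd) -/c.
  have -> : \sum_(k0 < 3) nsq leb3 (box l r) (dG n p k0) =
     \sum_(k0 < 3) nsq leb3 (box l (upd r k c)) (dG n p k0) +
     \sum_(k0 < 3) nsq leb3 (box (upd l k c) r) (dG n p k0).
    by rewrite -big_split/=; apply: eq_bigr => i _; exact: (nsq_box_split k lr l_r' (sdG i)).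
  have := hA n p An Ap; have := hA' n p A'n A'p.
  set a := nsq _ (box l _) _; set b := nsq _ (box _ r) _.
  set S := \sum_(_ < _) _; set S' := \sum_(_ < _) _; rewrite mulrDr.
  by set x := _ * S; set y := _ * S'; lra.
Qed.

Lemma box_side_le l r : cbox l r `<=` B1 -> (forall i, l i <= r i) ->
  forall i, r i - l i <= 2.
Proof.
move=> lr0 l_r0 i0.
have lc i : -1 < l i.
  have : B1 (l 0, l 1, l 2) by apply: lr0; elim/I3P; rewrite /coord/= lexx l_r0.
  by move/B1_coord => h; move: i; elim/I3P; [have := h 0|have := h 1|have := h 2]; case/andP.
have rc i : r i < 1.
  have : B1 (r 0, r 1, r 2) by apply: lr0; elim/I3P; rewrite /coord/= lexx andbT l_r0.
  by move/B1_coord => h; move: i; elim/I3P; [have := h 0|have := h 1|have := h 2]; case/andP.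
by have := lc i0; have := rc i0; lra.
Qed.

Lemma ultra_cauchy_box l r (e : R) : cbox l r `<=` B1 -> (forall i, l i <= r i) -> 0 < e ->
  exists2 A, U A & forall n p, A n -> A p -> nsq leb3 (box l r) (dB n p) <= e.
Proof.
move=> lr l_r0 e0.
have [l_r|] := pselect (forall i, l i < r i); last first.
  move=> /existsNP[i /negP]; rewrite -leNgt => ri.
  (* A half-open box with a side of nonpositive length is empty. *)
  exists setT; first exact: filterT.
  move=> n p _ _; rewrite (_ : box l r = set0).
    by rewrite /nsq Rintegral_set0 ltW.
  rewrite -subset0 => x /(_ i) /andP[h1 h2].
  by have := lt_le_trans h1 (le_trans h2 ri); rewrite ltxx.
have C0 : 0 <= C by apply: le_trans (uC 0%N); exact: nsq_ge0.
(* The three squared gradient differences add up to at most 12 C. Since d <= 1, their contribution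
   is at most 12 C d, which is at most e/2. *)
pose d := Num.min 1 (e / (24 * (C + 1))).
have C1 : 0 < 24 * (C + 1) by rewrite mulr_gt0// ltr_wpDl.
have d0 : 0 < d by rewrite lt_min ltr01/= divr_gt0.
have d1 : d <= 1 by rewrite /d ge_min lexx.
have d2 : d * (24 * (C + 1)) <= e by rewrite -ler_pdivlMr// /d ge_min lexx orbT.
have hM i : r i - l i <= d * 2 ^+ (Num.bound (2 / d)).
  apply: le_trans (box_side_le lr l_r0 i) _.
  rewrite mulrC -ler_pdivrMr//; apply: ltW.
  have h : 2 / d < (Num.bound (2 / d))%:R by apply: archi_boundP; rewrite divr_ge0// ltW.
  by apply: lt_le_trans h _; rewrite -natrX ler_nat ltnW// ltn_expl.
have e2 : 0 < e / 2 by rewrite divr_gt0.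
have [A UA hA] := ultra_cauchy_coarse d0 (m := fun=> _) erefl lr l_r hM e2.
exists A => // n p An Ap; apply: le_trans (hA n p An Ap) _.
have hG i : nsq leb3 (box l r) (dG n p i) <= 4 * C.
  have sd := sqintB mB1 (sG n i) (sG p i).
  apply: le_trans (le_nsq_box lr sd) _.
  have := le_nsq_sum mB1 (sG n i) (sqintZ mB1 (-1) (sG p i)).
  rewrite (nsqZ mB1 _ (sG p i)) sqrrN expr1n mul1r => h.
  have -> : nB (dG n p i) = nB (fun x => G n i x + -1 * G p i x).
    by apply: eq_nsq => x _; rewrite /dG; ring.
  by apply: le_trans h _; have := GC n i; have := GC p i; lra.
have hS : \sum_(k < 3) nsq leb3 (box l r) (dG n p k) <= 12 * C.
  apply: le_trans (ler_sum _ (fun i _ => hG i)) _.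
  by rewrite sumr_const card_ord -mulr_natl; lra.
have S0 : 0 <= \sum_(k < 3) nsq leb3 (box l r) (dG n p k) by rewrite sumr_ge0// => i _; exact: nsq_ge0.
move: hS S0; set S := \sum_(_ < _) _ => hS S0.
have : d ^+ 2 * S <= d * (12 * C).
  apply: (@le_trans _ _ (d * S)); last by rewrite ler_wpM2l// ltW.
  by rewrite ler_wpM2r// expr2 ler_piMl// ltW.
by nra.
Qed.

End Rellich.

Section RellichSubsequence.
Context {R : realType}.
Local Notation mB1 := measurable_B1.
Local Notation B := (@B1 R : set (mR3 R)).
Local Notation nB := (nsq leb3 B).

(** The k-th index is taken in a member of the ultrafilter which controls boxes 0 to k at scales 0
    to k. The differences are then summable on each box, and [ae_cvg_of_summable] applies. The
    bounded sequence [a] is carried along so that the Dirichlet energies converge along the same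
    indices; [k <= phi k] is all that limits require of [phi]. *)
Lemma rellich (J : finType) (u : nat -> J -> R3 R -> R)
    (G : nat -> J -> 'I_3 -> R3 R -> R) (C : R) (a : nat -> R) :
  (forall n j, cont_approx (u n j) (G n j)) ->
  (forall n j, nB (u n j) <= C) -> (forall n j k, nB (G n j k) <= C) ->
  (forall n, `|a n| <= C) ->
  exists (phi : nat -> nat) (l : R), [/\ forall k, (k <= phi k)%N,
    a (phi k) @[k --> \oo] --> l &
    forall j, {ae (@leb3 R), forall x, B1 x -> cvgn (fun k => u (phi k) j x)}].
Proof.
move=> hu uC GC aC.
have [U [UU hU]] := ultraFilterLemma eventually_filter.
have UP : ProperFilter U by exact: ultra_proper.
have [l hl] := ultra_bounded_cvg UU aC.
have [lb [rb [lrB l_r cov]]] := @B1_box_cover R.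
have e8 k : 0 < (8^-1 : R) ^+ k by rewrite exprn_gt0// invr_gt0.
pose good i k A := U A /\ forall n p, A n -> A p -> forall j,
   nsq leb3 (box (lb i) (rb i)) (fun x => u n j x - u p j x) <= (8^-1) ^+ k.
have hgood i k : exists A, good i k A.
  have h j := ultra_cauchy_box UU (fun n => hu n j) (fun n => uC n j) (fun n => GC n j) (lrB i) (l_r i) (e8 k).
  have [A hA] : exists A : J -> set nat, forall j, U (A j) /\ forall n p, A j n -> A j p ->
      nsq leb3 (box (lb i) (rb i)) (fun x => u n j x - u p j x) <= (8^-1) ^+ k.
    have h' j : exists A : set nat, U A /\ forall n p, A n -> A p ->
        nsq leb3 (box (lb i) (rb i)) (fun x => u n j x - u p j x) <= (8^-1) ^+ k.
      by have [A ? ?] := h j; exists A.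
    by exists (fun j => sval (cid (h' j))) => j; exact: (svalP (cid (h' j))).
  exists [set n | forall j, A j n]; split.
    by apply: filter_forall => j; exact: (hA j).1.
  by move=> n p /= An Ap j; apply: (hA j).2.
pose A i k := sval (cid (hgood i k)).
have AP i k : good i k (A i k) := svalP (cid (hgood i k)).
(* A finite intersection of members of [U], hence nonempty. *)
pose S k := [set n | [/\ (forall i j : 'I_k.+1, A i j n), `|a n - l| <= (8^-1) ^+ k & (k <= n)%N]].
have US k : U (S k).
  have h1 : U [set n | forall i j : 'I_k.+1, A i j n].
    by apply: filter_forall => i; apply: filter_forall => j; exact: (AP i j).1.
  have h2 := hl _ (e8 k).
  have h3 : U [set n | (k <= n)%N] by apply: hU; exists k.
  by apply: filterS (filterI h1 (filterI h2 h3)) => n [? [? ?]].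
have hS k : exists n, S k n by exact: filter_ex (US k).
pose phi k := sval (cid (hS k)).
have phiP k : S k (phi k) := svalP (cid (hS k)).
exists phi, l; split.
- by move=> k; case: (phiP k).
- apply/subr_cvg0; apply: norm_cvg0.
  apply: (@squeeze0 _ _ (fun k => (8^-1) ^+ k)).
    by move=> k; rewrite normr_ge0/=; case: (phiP k).
  by apply: cvg_expr; rewrite ger0_norm; lra.
move=> j.
have hu2 n : sqint leb3 B (u n j) by case: (hu n j).
suff key i : {ae (@leb3 R), forall x, box (lb i) (rb i) x -> cvgn (fun k => u (phi k) j x)}.
  by apply: filterS (ae_foralln key) => x hx /cov[n]; exact: hx.
have mb := measurable_box (lb i) (rb i).
(* Box [i] is controlled only from index [i] on, hence the shift by [i]. *)
have h := @ae_cvg_of_summable _ _ _ leb3 _ mb (fun k => u (phi (k + i)%N) j).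
have {}h : {ae (@leb3 R), forall x, box (lb i) (rb i) x -> cvgn (fun k => u (phi (k + i)%N) j x)}.
  apply: h => [k|k]; first exact: sq_box (lrB i) (hu2 _).
  apply: (@le_trans _ _ (8^-1 ^+ (k + i)%N)); last first.
    by rewrite exprD ler_piMr ?exprn_ge0// ?exprn_ile1//; lra.
  have [H1 _ _] := phiP (k + i)%N; have [H2 _ _] := phiP (k.+1 + i)%N.
  have i1 : (i < (k + i).+1)%N by rewrite ltnS leq_addl.
  have i2 : (i < (k.+1 + i).+1)%N by rewrite ltnS leq_addl.
  have k1 : (k + i < (k + i).+1)%N by [].
  have k2 : (k + i < (k.+1 + i).+1)%N by rewrite addSn ltnW.
  have := (AP i (k + i)%N).2 _ _ (H2 (Ordinal i2) (Ordinal k2)) (H1 (Ordinal i1) (Ordinal k1)) j.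
  exact.
apply: filterS h => x /= hx /hx.
move=> /cvg_ex[t ht]; apply/cvg_ex; exists t.
by move: ht; rewrite (cvg_shiftn i (fun k => u (phi k) j x)).
Qed.

End RellichSubsequence.

(** * Mazur's lemma and traces *)

Section Hull.
Context (T : Type) (R : realType) (I : Type).
Implicit Types (f g : I -> T -> R).

Definition midpoint f g : I -> T -> R := fun i x => 2^-1 * (f i x + g i x).

(** Dyadic convex combinations of the terms of index at least [n]. Midpoints are all that the
    parallelogram identity calls for, and a property passes to the hull once it is stable under this
    single operation. The index type gathers functions and derivatives, which thus receive the same
    weights. *)
Inductive hull (w : nat -> I -> T -> R) (n : nat) : (I -> T -> R) -> Prop :=
| hull_base m : (n <= m)%N -> hull w n (w m)
| hull_mid f g : hull w n f -> hull w n g -> hull w n (midpoint f g).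

Lemma hullS w n m f : (n <= m)%N -> hull w m f -> hull w n f.
Proof.
move=> nm; elim=> [p mp|g h _ hg _ hh]; last exact: hull_mid.
by apply: hull_base; exact: leq_trans mp.
Qed.

Lemma hull_ind_prop (P : (I -> T -> R) -> Prop) w n :
  (forall m, (n <= m)%N -> P (w m)) -> (forall f g, P f -> P g -> P (midpoint f g)) ->
  forall f, hull w n f -> P f.
Proof. by move=> h1 h2 f; elim=> // g h _ hg _ hh; exact: h2. Qed.

End Hull.

Section Mazur.
Context d (T : measurableType d) (R : realType).
Variables (mu : {measure set T -> \bar R}) (D : set T).
Hypothesis mD : measurable D.
Variables (I : finType).
Implicit Types (f g : I -> T -> R).

Let N f : R := \sum_i nsq mu D (f i).

(* Almost minimizers of the norm in the hulls: by the parallelogram identity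
   they form a Cauchy sequence. *)
Lemma mazur (w : nat -> I -> T -> R) (C : R) :
  (forall n i, sqint mu D (w n i)) -> (forall n i, nsq mu D (w n i) <= C) ->
  exists P : nat -> I -> T -> R, (forall n, hull w n (P n)) /\
  forall i (e : R), 0 < e -> exists K, forall n m, (K <= n)%N -> (K <= m)%N ->
    nsq mu D (fun x => P n i x - P m i x) <= e.
Proof.
move=> hw wC.
have sqm f g : (forall i, sqint mu D (f i)) -> (forall i, sqint mu D (g i)) ->
    forall i, sqint mu D (midpoint f g i).
  by move=> hf hg i; apply: sqintZ => //; exact: sqintD.
have hs n f : hull w n f -> forall i, sqint mu D (f i).
  by apply: (hull_ind_prop (P := fun f => forall i, sqint mu D (f i))) => // m _ i; exact: hw.
have N0 f : 0 <= N f by apply: sumr_ge0 => i _; exact: nsq_ge0.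
have par f g : (forall i, sqint mu D (f i)) -> (forall i, sqint mu D (g i)) ->
    N (fun i x => f i x - g i x) = 2 * N f + 2 * N g - 4 * N (midpoint f g).
  move=> hf hg; rewrite /N.
  rewrite (eq_bigr (fun i => 2 * nsq mu D (f i) + 2 * nsq mu D (g i) - 4 * nsq mu D (midpoint f g i))).
    by rewrite sumrB big_split/= -!mulr_sumr.
  by move=> i _; exact: nsq_parallelogram.
pose V n := [set N f | f in hull w n].
have Vlb n : lbound (V n) 0 by move=> _ [f _ <-].
have V0 n : has_inf (V n).
  by split; [exists (N (w n)); exists (w n) => //; exact: hull_base|exists 0].
pose dn n := inf (V n).
have dle n f : hull w n f -> dn n <= N f.
  by move=> hf; apply: ge_inf; [exact: (V0 n).2|exists f].
have dmono n m : (n <= m)%N -> dn n <= dn m.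
  move=> nm; apply: lb_le_inf; first exact: (V0 m).1.
  by move=> _ [f hf <-]; apply: dle; exact: hullS hf.
have dC n : dn n <= \sum_(i : I) C.
  by apply: le_trans (dle n (w n) (hull_base w (leqnn n))) _; apply: ler_sum.
have hP n : exists f, hull w n f /\ N f < dn n + n.+1%:R^-1.
  have e0 : 0 < n.+1%:R^-1 :> R by rewrite invr_gt0.
  by have [_ [f hf <-] hlt] := inf_adherent e0 (V0 n); exists f.
pose P n := sval (cid (hP n)).
have PP n : hull w n (P n) /\ N (P n) < dn n + n.+1%:R^-1 := svalP (cid (hP n)).
exists P; split; first by move=> n; case: (PP n).
move=> i e e0.
have hsup : has_sup (range dn).
  by split; [exists (dn 0%N); exists 0%N|exists (\sum_(i : I) C) => _ [n _ <-]].
pose ds := sup (range dn).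
(* The infima over the hulls increase to [ds]. The parallelogram identity bounds the squared
   distance by 2 (dn m - dn n) + 2/(n+1) + 2/(m+1), and each of the three differences and inverses
   is below e/8. *)
have e8 : 0 < e / 8 by rewrite divr_gt0.
have [_ [K1 _ <-] hK1] := sup_adherent e8 hsup.
have [K2 _ hK2] := near_infty_natSinv_lt (PosNum e8).
have key n m : (maxn K1 K2 <= n)%N -> (n <= m)%N ->
    nsq mu D (fun x => P n i x - P m i x) <= e.
  rewrite geq_max => /andP[K1n K2n] nm.
  have [hn Nn] := PP n; have [hm Nm] := PP m.
  have hN := par _ _ (hs n _ hn) (hs m _ hm).
  have hmid : dn n <= N (midpoint (P n) (P m)).
    by apply: dle; apply: hull_mid => //; exact: hullS hm.
  have hi : nsq mu D (fun x => P n i x - P m i x) <= N (fun i x => P n i x - P m i x).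
    by rewrite /N (bigD1 i)//= lerDl sumr_ge0// => j _; exact: nsq_ge0.
  have dnK : dn K1 <= dn n by exact: dmono.
  have dms : dn m <= ds by apply: ub_le_sup; [exact: hsup.2|exists m].
  have n2 : n.+1%:R^-1 < e / 8 := hK2 n K2n.
  have m2 : m.+1%:R^-1 < e / 8 := hK2 m (leq_trans K2n nm).
  move: hi hN hmid dnK dms n2 m2 hK1 Nn Nm; rewrite -/ds.
  set a := nsq _ _ _; set b := N _; set b1 := N _; set b2 := N _; set b3 := N (midpoint _ _).
  by move: (n.+1%:R^-1) (m.+1%:R^-1) (dn n) (dn m) (dn K1) ds => x y z t q p; lra.
exists (maxn K1 K2) => n m Kn Km.
have [nm|mn] := leqP n m; first exact: key.
rewrite (_ : nsq _ _ _ = nsq mu D (fun x => P m i x - P n i x)); first exact: key (ltnW mn).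
by apply: eq_Rintegral => x _; ring.
Qed.

End Mazur.

(** * Integrals over the sphere and stability of traces *)

Section SphereIntegral.
Context {R : realType}.
Implicit Types (w : R3 R -> R).

Lemma sphere_pt_B1bar phi theta : B1bar (sphere_pt phi theta : R3 R).
Proof.
rewrite /B1bar/= /normsq3/= !exprMn -mulrDr cos2Dsin2 mulr1.
by rewrite addrC cos2Dsin2.
Qed.

Lemma normsq3_sphere phi theta : normsq3 (sphere_pt phi theta : R3 R) = 1.
Proof. by rewrite /normsq3/= !exprMn -mulrDr cos2Dsin2 mulr1 addrC cos2Dsin2. Qed.

Lemma continuous_sphere_comp w : {within B1bar, continuous w} ->
  continuous (fun z : R * R => w (sphere_pt z.2 z.1)).
Proof.
move=> cw z.
have cs : (fun z : R * R => sphere_pt z.2 z.1 : R3 R) @ z --> sphere_pt z.2 z.1.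
  have c1 : (fun z : R * R => sin z.2) @ z --> sin z.2.
    by apply: (@cvg_comp _ _ _ snd sin); [exact: cvg_snd|exact: continuous_sin].
  have c2 : (fun z : R * R => cos z.2) @ z --> cos z.2.
    by apply: (@cvg_comp _ _ _ snd cos); [exact: cvg_snd|exact: continuous_cos].
  have c3 : (fun z : R * R => sin z.1) @ z --> sin z.1.
    by apply: (@cvg_comp _ _ _ fst sin); [exact: cvg_fst|exact: continuous_sin].
  have c4 : (fun z : R * R => cos z.1) @ z --> cos z.1.
    by apply: (@cvg_comp _ _ _ fst cos); [exact: cvg_fst|exact: continuous_cos].
  have c5 : (fun z : R * R => (sin z.2 * cos z.1, sin z.2 * sin z.1)) @ z -->
      (sin z.2 * cos z.1, sin z.2 * sin z.1).
    exact (cvg_pair (F := nbhs z) (cvgM c1 c4) (cvgM c1 c3)).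
  exact: (cvg_pair (F := nbhs z) c5 c2).
have cwz : w @ within B1bar (nbhs (sphere_pt z.2 z.1 : R3 R)) --> w (sphere_pt z.2 z.1).
  have h : w @ nbhs_subspace (A := B1bar) (sphere_pt z.2 z.1 : R3 R) --> w (sphere_pt z.2 z.1).
    exact: (cw (sphere_pt z.2 z.1)).
  by move: h; rewrite -nbhs_subspace_in//; exact: sphere_pt_B1bar.
apply: (cvg_comp _ _ _ cwz) => A /= hA.
have hn := cs _ hA; rewrite /nbhs/=; apply: (filterS (F := nbhs z) _ hn) => y /= h.
by apply: h; exact: sphere_pt_B1bar.
Qed.

Definition meridian w (theta : R) : \bar R :=
  (\int[lebesgue_measure]_(phi in `[0%R, pi])
      (w (sphere_pt phi theta) ^+ 2 * sin phi)%:E)%E.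

Lemma sphere_integralE w :
  sphere_integral (fun x => w x ^+ 2) =
  (\int[lebesgue_measure]_(theta in `[0%R, (2 * pi)%R]) meridian w theta)%E.
Proof. by []. Qed.

(** The indicator extends the integral in colatitude to the whole line, so that Tonelli's theorem
    gives the measurability of [meridian]; it also keeps the integrand nonnegative where the sine is
    not. *)
Let F w (z : measurableTypeR R * measurableTypeR R) : \bar R :=
  (w (sphere_pt z.2 z.1) ^+ 2 * (sin z.2 * \1_(`[0%R, pi]%classic) z.2))%:E.

Lemma sin_indic_ge0 (phi : R) : 0 <= sin phi * \1_(`[0%R, pi]%classic) phi.
Proof.
rewrite indicE; case: (boolP (_ \in _)) => [|_]; last by rewrite mulr0.
by rewrite inE /= in_itv/= mulr1 => h; exact: sin_ge0_pi.
Qed.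

Let F_ge0 w z : (0 <= F w z)%E.
Proof. by rewrite lee_fin mulr_ge0 ?sqr_ge0 ?sin_indic_ge0. Qed.

Let mF w : {within B1bar, continuous w} -> measurable_fun setT (F w).
Proof.
move=> cw; apply/measurable_EFinP; apply: measurable_funM.
  by apply: measurable_funX; apply: continuous_measurable2; exact: continuous_sphere_comp.
apply: measurable_funM.
  by apply: (continuous_measurable2 (f := fun z : R * R => sin z.2)) => z;
    apply: (@cvg_comp _ _ _ snd sin); [exact: cvg_snd|exact: continuous_sin].
have mi : measurable_fun setT (\1_(`[0%R, pi]%classic : set (measurableTypeR R)) : measurableTypeR R -> R).
  by apply: measurable_indic.
exact: (measurableT_comp mi measurable_snd).
Qed.

Lemma meridianE w theta : meridian w theta = fubini_F lebesgue_measure (F w) theta.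
Proof.
rewrite /meridian /fubini_F [LHS]integral_mkcond; apply: eq_integral => phi _.
rewrite patchE /F/= indicE; case: ifP => _; rewrite ?mulr1// !mulr0//.
Qed.

Lemma measurable_meridian w : {within B1bar, continuous w} ->
  measurable_fun setT (meridian w).
Proof.
move=> cw; rewrite (_ : meridian w = fubini_F lebesgue_measure (F w)); last first.
  by apply/funext => t; exact: meridianE.
by apply: measurable_fun_fubini_tonelli_F => //; exact: mF.
Qed.

Lemma meridian_ge0 w theta : (0 <= meridian w theta)%E.
Proof. by rewrite meridianE; apply: integral_ge0. Qed.

Lemma meridian_le w1 w2 w theta : {within B1bar, continuous w1} ->
  {within B1bar, continuous w2} -> {within B1bar, continuous w} ->
  (forall x, B1bar x -> w x ^+ 2 <= w1 x ^+ 2 + w2 x ^+ 2) ->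
  (meridian w theta <= meridian w1 theta + meridian w2 theta)%E.
Proof.
move=> c1 c2 c h; rewrite !meridianE /fubini_F.
have m' f : {within B1bar, continuous f} -> measurable_fun setT (fun y => F f (theta, y)).
  by move=> cf; apply: measurableT_comp; [exact: mF|exact: measurable_pair1].
rewrite -ge0_integralD//; [|exact: m'|exact: m'].
apply: ge0_le_integral => //; [exact: m'|by apply: emeasurable_funD; exact: m'|].
move=> phi _; rewrite /F/= -EFinD lee_fin -mulrDl ler_wpM2r ?sin_indic_ge0//.
by apply: h; exact: sphere_pt_B1bar.
Qed.

(** Used in [traced_mid], with [w] the boundary error of a midpoint and [w1], [w2] those of the two
    functions. *)
Lemma sphere_integral_le w1 w2 w : {within B1bar, continuous w1} ->
  {within B1bar, continuous w2} -> {within B1bar, continuous w} ->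
  (forall x, B1bar x -> w x ^+ 2 <= w1 x ^+ 2 + w2 x ^+ 2) ->
  (sphere_integral (fun x => (w x ^+ 2)%R) <=
   sphere_integral (fun x => (w1 x ^+ 2)%R) + sphere_integral (fun x => (w2 x ^+ 2)%R))%E.
Proof.
move=> c1 c2 c h; rewrite !sphere_integralE.
have mm f : {within B1bar, continuous f} -> measurable_fun `[0%R, (2 * pi)%R]%classic (meridian f).
  by move=> cf; apply: measurable_funTS; exact: measurable_meridian.
rewrite -ge0_integralD//; [|by move=> *; exact: meridian_ge0|exact: mm|by move=> *; exact: meridian_ge0|exact: mm].
apply: ge0_le_integral => //; [by move=> *; exact: meridian_ge0|exact: mm|by apply: emeasurable_funD; exact: mm|].
by move=> theta _; exact: meridian_le.
Qed.

Lemma sphere_integral_ge0 w : (0 <= sphere_integral (fun x => (w x ^+ 2)%R))%E.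
Proof. by rewrite sphere_integralE; apply: integral_ge0 => *; exact: meridian_ge0. Qed.

Lemma eq_sphere_integral (f g : R3 R -> R) : (forall x, normsq3 x = 1 -> f x = g x) ->
  sphere_integral f = sphere_integral g.
Proof.
move=> h; apply: eq_integral => t _; apply: eq_integral => p _.
by rewrite h// normsq3_sphere.
Qed.

End SphereIntegral.

Section Traced.
Context {R : realType}.
Implicit Types (u v g : R3 R -> R) (G : 'I_3 -> R3 R -> R) (k : 'I_3).
Local Notation mB1 := measurable_B1.
Local Notation B := (@B1 R : set (mR3 R)).
Local Notation sq := (sqint leb3 B).
Local Notation nB := (nsq leb3 B).
Local Notation wp := (wpartial B1).
Variable q : R3 R -> R.
Hypothesis cq : {within B1bar, continuous q}.

(* A form of "[u] has gradient [G] and trace [q]" which is visibly stable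
   under midpoints and under limits. *)
Definition traced u G : Prop :=
  sq u /\ (forall k, sq (G k)) /\ forall e : R, 0 < e ->
  exists v gv, [/\ sq v /\ (forall k, is_weak_partial B1 k v (gv k)),
    {within B1bar, continuous v},
    nB (fun x => v x - u x) <= e,
    (forall k, nB (fun x => gv k x - G k x) <= e) &
    (sphere_integral (fun x => ((v x - q x) ^+ 2)%R) <= e%:E)%E].

Lemma le_add_sum3 (a : R) (b : 'I_3 -> R) c : a <= c -> (forall k, b k <= c) ->
  a + \sum_(k < 3) b k <= 4 * c.
Proof.
move=> ac bc; rewrite !big_ord_recl big_ord0.
by have := bc ord0; have := bc (lift ord0 ord0); have := bc (lift ord0 (lift ord0 ord0)); lra.
Qed.

Lemma within_cvgD (f g : R3 R -> R) : {within B1bar, continuous f} ->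
  {within B1bar, continuous g} -> {within B1bar, continuous (fun x => f x + g x)}.
Proof. by move=> cf cg x; apply: cvgD; [exact: cf|exact: cg]. Qed.

Lemma within_cvgB (f g : R3 R -> R) : {within B1bar, continuous f} ->
  {within B1bar, continuous g} -> {within B1bar, continuous (fun x => f x - g x)}.
Proof. by move=> cf cg x; apply: cvgB; [exact: cf|exact: cg]. Qed.

Lemma within_cvgM (f g : R3 R -> R) : {within B1bar, continuous f} ->
  {within B1bar, continuous g} -> {within B1bar, continuous (fun x => f x * g x)}.
Proof. by move=> cf cg x; apply: cvgM; [exact: cf|exact: cg]. Qed.

Lemma within_cst (c : R) : {within (B1bar : set (R3 R)), continuous (fun=> c)}.
Proof. by move=> x; exact: cvg_cst. Qed.

Lemma has_trace_traced u : W12 B1 u -> has_trace u q -> traced u (fun k => wp k u).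
Proof.
move=> hu /(has_traceP _ hu)[v [hv cv dv sv]]; split; first exact: hu.1.
split; first by move=> k; exact: sq_wpartial.
move=> e e0.
have h1 : \forall n \near \oo, wdist (v n) u < e by exact: cvgr_lt dv _ e0.
have h2 : \forall n \near \oo, (sphere_integral (fun x => ((v n x - q x) ^+ 2)%R) < e%:E)%E.
  exact (sv (fun y : \bar R => (y < e%:E)%E) (lt_nbhsl e0)).
have [n [/ltW n1 /ltW n2]] := filter_ex (filterI h1 h2).
exists (v n), (fun k => wp k (v n)); split => //.
- by split; [exact: (hv n).1|move=> k; exact: wpartialP].
- by apply: le_trans n1; exact: wdist_nsq.
- by move=> k; apply: le_trans n1; exact: wdist_nsqk.
Qed.

Lemma traced_has_trace u G : traced u G -> (forall k, is_weak_partial B1 k u (G k)) ->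
  W12 B1 u /\ has_trace u q.
Proof.
move=> [su [sG h]] wu.
have hu : W12 B1 u by split => // k; exists (G k).
split => //; apply/(has_traceP _ hu).
have e0 n : 0 < (n.+1%:R^-1 : R) by rewrite invr_gt0.
pose v n := sval (cid (h _ (e0 n))).
have hv n := svalP (cid (h _ (e0 n))).
have Wv n : W12 B1 (v n).
  by case: (hv n) => gv [[s1 s2] _ _ _ _]; split => // k; exists (gv k).
exists v; split => //.
- by move=> n; case: (hv n) => gv [].
- have cn : (fun n : nat => 4 * n.+1%:R^-1 : R) @ \oo --> (0 : R).
    by rewrite -(mulr0 4); apply: cvgM; [exact: cvg_cst|exact: cvg_harmonic].
  apply: squeeze0 cn => n; rewrite wdist_ge0/=.
  case: (hv n) => gv [[s1 s2] _ d1 d2 _].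
  (* The approximation concerns some weak gradient [gv] of [v n]; uniqueness transfers it to the
     chosen [wpartial]. *)
  have hk k : nB (fun x => wp k (v n) x - wp k u x) <= n.+1%:R^-1.
    apply: le_trans (d2 k); rewrite le_eqVlt; apply/orP; left; apply/eqP.
    apply: (ae_eq_nsq mB1) => //; first exact: sqB_wp.
      exact (sqintB mB1 (s2 k).1 (sG k)).
    have a1 := wpartial_ae (Wv n) (s2 k); have a2 := wpartial_ae hu (wu k).
    by apply: filterS2 a1 a2 => x a1 a2 Bx; rewrite a1// a2.
  exact: le_add_sum3.
- have cn : (fun n : nat => (n.+1%:R^-1 : R)%:E) @ \oo --> 0%E.
    by apply: cvg_EFin; [exact: nearW|exact: cvg_harmonic].
  apply: (squeeze_cvge _ (cvg_cst 0%E) cn); apply: nearW => n.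
  by rewrite sphere_integral_ge0/=; case: (hv n) => gv [].
Qed.

Lemma traced_mid u G v H : traced u G -> traced v H ->
  traced (fun x => 2^-1 * (u x + v x)) (fun k x => 2^-1 * (G k x + H k x)).
Proof.
move=> [su [sG hu]] [sv [sH hv]]; split; first exact (sqintZ mB1 _ (sqintD mB1 su sv)).
split; first by move=> k; exact (sqintZ mB1 _ (sqintD mB1 (sG k) (sH k))).
move=> e e0; have e2 : 0 < e / 2 by rewrite divr_gt0.
have [u' [G' [[su' wu'] cu' du' dG' tu']]] := hu _ e2.
have [v' [H' [[sv' wv'] cv' dv' dH' tv']]] := hv _ e2.
have mid f f' g g' : sq f -> sq f' -> sq g -> sq g' ->
    nB (fun x => f' x - f x) <= e / 2 -> nB (fun x => g' x - g x) <= e / 2 ->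
    nB (fun x => 2^-1 * (f' x + g' x) - 2^-1 * (f x + g x)) <= e.
  move=> sf sf' sg sg' d1 d2.
  have := nsq_mid mB1 (sqintB mB1 sf' sf) (sqintB mB1 sg' sg).
  rewrite (_ : nsq _ _ _ = nB (fun x => 2^-1 * (f' x + g' x) - 2^-1 * (f x + g x))).
    move=> /le_trans; apply; move: d1 d2.
    by set a := nsq _ _ _; set b := nsq _ _ _; move: e0; lra.
  by apply: eq_nsq => x _; ring.
exists (fun x => 2^-1 * (u' x + v' x)), (fun k x => 2^-1 * (G' k x + H' k x)); split.
- split; first exact (sqintZ mB1 _ (sqintD mB1 su' sv')).
  move=> k; have := weak_partial_lin 2^-1 2^-1 su' sv' (wu' k) (wv' k).
  by congr (is_weak_partial _ _ _ _); apply/funext => x; ring.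
- by apply: within_cvgM; [exact: within_cst|exact: within_cvgD].
- exact: mid.
- by move=> k; apply: mid => //; [case: (wu' k)|case: (wv' k)].
- have := sphere_integral_le (within_cvgB cu' cq) (within_cvgB cv' cq)
    (w := fun x => 2^-1 * (u' x + v' x) - q x).
  move=> /(_ _ _)/le_trans; apply.
  + by apply: within_cvgB => //; apply: within_cvgM; [exact: within_cst|exact: within_cvgD].
  + move=> x _; set a := u' x; set b := v' x; set c := q x.
    have := sqr_ge0 (a - c + (b - c)); have := sqr_ge0 (a - c - (b - c)).
    by rewrite !expr2; nra.
  + by have := leeD tu' tv'; rewrite -EFinD -splitr.
Qed.

Lemma traced_limit (u_ : nat -> R3 R -> R) (G_ : nat -> 'I_3 -> R3 R -> R) u G :
  (forall n, traced (u_ n) (G_ n)) -> sq u -> (forall k, sq (G k)) ->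
  (forall e : R, 0 < e -> exists n, nB (fun x => u_ n x - u x) <= e /\
     forall k, nB (fun x => G_ n k x - G k x) <= e) ->
  traced u G.
Proof.
move=> ht su sG hd; split=> //; split=> // e e0.
(* [le_nsq_sum] doubles both squared distances, hence the quarter. *)
have e4 : 0 < e / 4 by rewrite divr_gt0.
have [n [d1 d2]] := hd _ e4.
have [su_ [sG_ /(_ _ e4)[v [gv [[sv wv] cv dv dg tv]]]]] := ht n.
have tri f g h : sq f -> sq g -> sq h -> nB (fun x => f x - g x) <= e / 4 ->
    nB (fun x => g x - h x) <= e / 4 -> nB (fun x => f x - h x) <= e.
  move=> sf sg sh a1 a2; have := le_nsq_sum mB1 (sqintB mB1 sf sg) (sqintB mB1 sg sh).
  rewrite (_ : nsq _ _ _ = nB (fun x => f x - h x)).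
    move=> /le_trans; apply; move: a1 a2.
    by set a := nsq _ _ _; set b := nsq _ _ _; move: e0; lra.
  by apply: eq_nsq => x _; ring.
exists v, gv; split => //.
- exact: tri dv d1.
- by move=> k; apply: tri (dg k) (d2 k) => //; case: (wv k).
- by apply: le_trans tv _; rewrite lee_fin; move: e0; lra.
Qed.

End Traced.

(** * Functions of class C^1 on the ball and the explicit competitor *)

Lemma sigma_finite_product d (T : measurableType d) (R : realType)
  (m : {sigma_finite_measure set T -> \bar R}) : sigma_finite setT (m \x m)%E.
Proof.
have /sigma_finiteP[F [TF ndF Foo]] := sigma_finiteT m.
exists (fun n => F n `*` F n).
  rewrite -setXTT TF predeqE => -[x y]; split.
    move=> [/= [n _ Fnx] [k _ Gky]]; exists (maxn n k) => //; split.
    - by move: x Fnx; exact/subsetPset/ndF/leq_maxl.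
    - by move: y Gky; exact/subsetPset/ndF/leq_maxr.
  by move=> [n _ []/= ? ?]; split; exists n.
move=> k; have [? ?] := Foo k; split; first exact: measurableX.
by rewrite product_measure1E// lte_mul_pinfty// ge0_fin_numE.
Qed.

(** Fubini's theorem on [(T * T) * T] takes the planar measure as one factor, and hence in
    sigma-finite form. *)
Definition prod2 d (T : measurableType d) (R : realType)
  (m : {sigma_finite_measure set T -> \bar R}) : {sigma_finite_measure set (T * T)%type -> \bar R} :=
  HB.pack (m \x m)%E (Measure_isSigmaFinite.Build _ _ _ (m \x m)%E (sigma_finite_product m)).

Definition upd3 (T : Type) (k : 'I_3) (t : T) (x : T * T * T) : T * T * T :=
  (if k == 0 then t else x.1.1, if k == 1 then t else x.1.2, if k == 2 then t else x.2).

Section CompactlySupported.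
Context {R : realType}.
Local Notation mR := (measurableTypeR R).
Local Notation leb := (@lebesgue_measure R).

Lemma integral_derivative_zero (F D : R -> R) : (forall t : R, is_derive t (1 : R) F (D t)) ->
  continuous D -> (forall t, 1 < `|t| -> F t = 0 /\ D t = 0) ->
  (\int[leb]_t (D t)%:E)%E = 0%E.
Proof.
move=> dF cD h.
have cF : continuous F.
  by move=> t; apply: differentiable_continuous; apply/derivable1_diffP; case: (dF t).
have -> : (\int[leb]_t (D t)%:E)%E = (\int[leb]_(t in `[(-2)%R, 2%R]) (D t)%:E)%E.
  rewrite [RHS]integral_mkcond; apply: eq_integral => t _; rewrite patchE.
  case: ifPn => // /negP ht; rewrite (h t _).2//; move: ht.
  rewrite inE/= in_itv/= => ht; rewrite ltNge; apply/negP; rewrite ler_norml => /andP[a b].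
  by apply: ht; apply/andP; split; lra.
rewrite (@continuous_FTC2 _ D F); last first.
- by move=> t _; rewrite derive1E; case: (dF t).
- split; first by move=> t _; case: (dF t).
    by apply: cvg_at_right_filter; exact: cF.
  by apply: cvg_at_left_filter; exact: cF.
- exact: continuous_subspaceT.
- lra.
have h2 : 1 < `|2 : R| by rewrite ger0_norm; lra.
have h2' : 1 < `|- 2 : R| by rewrite normrN.
by rewrite (h _ h2).1 (h _ h2').1 subee.
Qed.

Lemma integrable_bounded_support d (T : measurableType d) (mu : {measure set T -> \bar R})
    (A : set T) (f : T -> R) (M : R) : measurable A -> (mu A < +oo)%E ->
  measurable_fun setT f -> (forall x, `|f x| <= M) -> (forall x, ~ A x -> f x = 0) ->
  mu.-integrable setT (EFin \o f).
Proof.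
move=> mA fA mf fM f0.
have -> : EFin \o f = (EFin \o f) \_ A.
  apply/funext => x /=; rewrite patchE; case: ifPn => // /negP hx; rewrite f0//.
  by move=> Ax; apply: hx; rewrite inE.
apply/(integrable_mkcond _ mA).
apply: (@le_intble _ _ _ mu A mA f (fun=> M)) => //; first exact: measurable_funTS.
exact: intble_cst.
Qed.

(** The order of integration is chosen so that the variable [k] comes innermost; the integrability
    of the planar sections serves directions 0 and 1. *)
Lemma integral3_zero d (T : measurableType d) (m : {sigma_finite_measure set T -> \bar R})
    (f : T * T * T -> \bar R) (k : 'I_3) :
  ((m \x m) \x m)%E.-integrable setT f ->
  (forall c, (m \x m)%E.-integrable setT (fun z => f (z, c))) ->
  (forall a b c, \int[m]_t f (upd3 k t (a, b, c)) = 0)%E ->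
  (\int[((m \x m) \x m)%E]_z f z = 0)%E.
Proof.
move=> h3 h2 hk.
elim/I3P: k hk => hk.
- have E := @integral21_prod_meas1 _ _ _ _ _ (prod2 m) m _ h3.
  refine (etrans (esym E) _); apply: integral0_eq => c _; rewrite /fubini_G/=.
  rewrite -(integral21_prod_meas1 (h2 c)); apply: integral0_eq => b _ /=.
  exact: (hk b b c).
- have E := @integral21_prod_meas1 _ _ _ _ _ (prod2 m) m _ h3.
  refine (etrans (esym E) _); apply: integral0_eq => c _; rewrite /fubini_G/=.
  rewrite -(integral12_prod_meas1 (h2 c)); apply: integral0_eq => a _ /=.
  exact: (hk a a c).
- have E := @integral12_prod_meas1 _ _ _ _ _ (prod2 m) m _ h3.
  refine (etrans (esym E) _); apply: integral0_eq => -[a b] _; rewrite /fubini_F/=.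
  exact: (hk a b a).
Qed.

Lemma is_derive_section k (h : R3 R -> R) (p : R3 R) (d : R) : is_derive p (basis3 k) h d ->
  is_derive (coord k p) (1 : R) (fun t => h ((t - coord k p) *: basis3 k + p)) d.
Proof.
move=> /is_derive_lineP hd.
have := @is_derive_affine R (fun s : R => h (s *: basis3 k + p)) 1 (- coord k p) (coord k p) d.
rewrite mul1r subrr mul1r => /(_ hd).
by congr is_derive; apply/funext => t; rewrite mul1r.
Qed.

Lemma continuous_bounded_support (D : R3 R -> R) : continuous D ->
  (forall x, ~ B1 x -> D x = 0) -> exists M : R, forall x, `|D x| <= M.
Proof.
move=> cD D0; pose K := cbox (fun=> -1 : R) (fun=> 1).
have : compact (D @` K).
  by apply: continuous_compact; [exact: continuous_subspaceT|exact: compact_cbox].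
move=> /compact_bounded[M [Mr hM]]; exists (`|M| + 1) => x.
have [Bx|/D0 ->] := pselect (B1 x); last by rewrite normr0; have := normr_ge0 M; lra.
apply: (hM (`|M| + 1)); first by rewrite (le_lt_trans (ler_norm M))// ltrDl.
by exists x => // i; have /andP[/ltW -> /ltW ->] := B1_coord i Bx.
Qed.

(** Integration by parts without boundary term: on each line in direction [k] the integrand is the
    derivative of a function that vanishes at both ends, and Fubini integrates over the lines. *)
Lemma integral_partial_zero k (h D : R3 R -> R) :
  (forall x, is_derive x (basis3 k) h (D x)) -> continuous D ->
  (forall x, ~ B1 x -> h x = 0 /\ D x = 0) -> (\int[leb3]_x (D x)%:E)%E = 0%E.
Proof.
move=> dh cD h0.
have [M DM] := continuous_bounded_support cD (fun x Bx => (h0 x Bx).2).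
pose I : set mR := `[(-1)%R, 1%R]%classic.
have mI : measurable I by rewrite /I; exact: measurable_itv.
have fI : (leb I < +oo)%E by rewrite lebesgue_measure_itv/=; case: ifP => _; rewrite ltry.
have out x i : 1 < `|coord i x| -> h x = 0 /\ D x = 0.
  move=> hi; apply: h0 => /B1_coord-/(_ i); rewrite -ltr_norml => hi'.
  by have := lt_trans hi hi'; rewrite ltxx.
have nI (t : R) : ~ I t -> 1 < `|t|.
  move=> ht; rewrite ltNge; apply/negP; rewrite ler_norml => h'.
  by apply: ht; rewrite /I/= in_itv.
have line p : (\int[leb]_t (D ((t - coord k p) *: basis3 k + p))%:E)%E = 0%E.
  apply: (integral_derivative_zero (F := fun t => h ((t - coord k p) *: basis3 k + p))).
  - move=> t; have := is_derive_section (dh ((t - coord k p) *: basis3 k + p)).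
    rewrite coord_line eqxx mulr1 subrK; congr is_derive; apply/funext => s.
    by rewrite addrA -scalerDl; congr (h (_ *: _ + _)); ring.
  - move=> t; apply: continuous_comp; last exact: cD.
    apply: cvgD; last exact: cvg_cst; apply: cvgZr_tmp => //.
    by apply: cvgB; [exact: cvg_id|exact: cvg_cst].
  - by move=> t ht; apply: (out _ k); rewrite coord_line eqxx mulr1 subrK.
have int3 : (leb3 : {measure set mR3 R -> \bar R}).-integrable setT (EFin \o D).
  apply: (@integrable_bounded_support _ _ leb3 ((I `*` I) `*` I) D M) => //.
  - by do 2 apply: measurableX => //.
  - have : (leb I * leb I * leb I < +oo)%E.
      by move: fI; rewrite -ge0_fin_numE// => /fineK <-; rewrite -!EFinM ltry.
    by rewrite -(leb3X mI mI mI).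
  - exact: continuous_measurable3.
  - move=> x /not_andP[/not_andP[]|] /nI hx.
    + by have [] := out x 0 hx.
    + by have [] := out x 1 hx.
    + by have [] := out x 2 hx.
have int2 c : (leb \x leb)%E.-integrable setT (fun z : mR * mR => (D (z, c))%:E).
  apply: (@integrable_bounded_support _ _ (leb \x leb)%E (I `*` I) (fun z => D (z, c)) M) => //.
  - exact: measurableX.
  - have : (leb I * leb I < +oo)%E.
      by move: fI; rewrite -ge0_fin_numE// => /fineK <-; rewrite -!EFinM ltry.
    have E : ((leb \x leb) (I `*` I) = leb I * leb I)%E by exact: product_measure1E.
    by rewrite -E.
  - by apply: (@continuous_measurable2 _ (fun z => D (z, c))); exact: continuous_fixr.
  - move=> x /not_andP[] /nI hx.
    + by have [] := out (x, c) 0 hx.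
    + by have [] := out (x, c) 1 hx.
apply: (@integral3_zero _ mR leb (fun z => (D z)%:E) k int3 int2) => a b c.
rewrite -[RHS](line (a, b, c)); apply: eq_integral => t _; congr (D _)%:E.
have -> (u : R) : u *: basis3 k + (a, b, c) = (u * (val k == 0%N)%:R + a,
    u * (val k == 1%N)%:R + b, u * (val k == 2%N)%:R + c) by [].
rewrite /upd3 /coord.
by elim/I3P: k {dh line} => /=; congr (_, _, _); ring.
Qed.

End CompactlySupported.

Section C1Ball.
Context {R : realType}.
Implicit Types (f g h phi : R3 R -> R) (x : R3 R) (k : 'I_3).
Local Notation mB1 := measurable_B1.
Local Notation B := (@B1 R : set (mR3 R)).
Local Notation sq := (sqint leb3 B).
Local Notation wcont f := {within B1bar, continuous f}.

(** Continuity relative to the closed ball leaves the values outside it free, so measurability on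
    the whole space is a separate clause. *)
Definition C1grad f (df : 'I_3 -> R3 R -> R) : Prop :=
  [/\ measurable_fun setT (f : mR3 R -> R),
      forall k, measurable_fun setT (df k : mR3 R -> R), wcont f,
      forall k, wcont (df k) &
      forall x k, B1 x -> is_derive x (basis3 k) f (df k x)].

Definition C1ball f : Prop := exists df, C1grad f df.

Lemma C1_cst (c : R) : C1ball (fun=> c).
Proof.
exists (fun _ _ => 0); split => //; [exact: within_cst|move=> k; exact: within_cst|].
by move=> x k _; exact: is_derive_cst.
Qed.

Lemma C1_coord i : C1ball (coord i).
Proof.
exists (fun k _ => (i == k)%:R); split => //.
- exact: measurable_coord.
- exact/continuous_subspaceT/continuous_coord.
- by move=> k; exact: within_cst.
- move=> x k _; have := @is_derive_coord R i k x _ _ (is_derive_id (coord i x) (1 : R)).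
  by rewrite mulr1.
Qed.

Lemma C1_add f g : C1ball f -> C1ball g -> C1ball (fun x => f x + g x).
Proof.
move=> [df [mf mdf cf cdf hf]] [dg [mg mdg cg cdg hg]].
exists (fun k x => df k x + dg k x); split.
- exact: measurable_funD.
- by move=> k; exact: measurable_funD.
- exact: within_cvgD.
- by move=> k; exact: within_cvgD.
- by move=> x k Bx; have h1 := hf x k Bx; have h2 := hg x k Bx; exact: is_deriveD.
Qed.

Lemma C1_mul f g : C1ball f -> C1ball g -> C1ball (fun x => f x * g x).
Proof.
move=> [df [mf mdf cf cdf hf]] [dg [mg mdg cg cdg hg]].
exists (fun k x => f x * dg k x + g x * df k x); split.
- exact: measurable_funM.
- by move=> k; apply: measurable_funD; exact: measurable_funM.
- exact: within_cvgM.
- by move=> k; apply: within_cvgD; exact: within_cvgM.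
- by move=> x k Bx; have h1 := hf x k Bx; have h2 := hg x k Bx; exact: is_deriveM.
Qed.

Lemma C1_exp f n : C1ball f -> C1ball (fun x => f x ^+ n).
Proof.
move=> hf; elim: n => [|n ih]; first by under eq_fun do rewrite expr0; exact: C1_cst.
by under eq_fun do rewrite exprS; exact: C1_mul.
Qed.

(* The inverse square root, written so that its derivative is [- r^3 / 2]. *)
Definition isqrt (s : R) : R := expR (- (ln s / 2)).

Lemma isqrt_sqr s : 0 < s -> isqrt s ^+ 2 = s^-1.
Proof.
move=> s0; rewrite /isqrt expr2 -expRD -opprD -splitr expRN lnK//.
Qed.

Lemma isqrt_gt0 s : 0 < isqrt s. Proof. exact: expR_gt0. Qed.

Lemma is_derive_isqrt (s : R) : 0 < s ->
  is_derive s (1 : R) isqrt (- 2^-1 * isqrt s ^+ 3).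
Proof.
move=> s0; have h1 := is_derive1_ln s0.
have h2 : is_derive s (1 : R) (fun s => - (ln s / 2)) (- 2^-1 * s^-1).
  rewrite (_ : (fun _ => _) = (fun s => - 2^-1 * ln s)); first exact: is_deriveZ.
  by apply/funext => t; ring.
have h3 := is_derive_expR (- (ln s / 2)).
have := @is_derive1_comp R expR (fun s => - (ln s / 2)) s _ _ h3 h2.
congr (is_derive _ _ _ _); rewrite exprS isqrt_sqr// /isqrt; ring.
Qed.

Lemma C1_isqrt f : C1ball f -> (forall x, B1bar x -> 0 < f x) -> C1ball (fun x => isqrt (f x)).
Proof.
move=> [df [mf mdf cf cdf hf]] f0.
have mG : measurable_fun setT (fun x : mR3 R => isqrt (f x)).
  have m1 : measurable_fun setT isqrt.
    apply: (measurableT_comp (@measurable_expR R)); apply: (@measurable_funN _ _ _ setT (fun s : R => ln s / 2)).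
    by apply: measurable_funM; [exact: measurable_ln|exact: measurable_cst].
  exact: (measurableT_comp m1 mf).
have cG : wcont (fun x => isqrt (f x)).
  apply/subspace_continuousP => x Bx.
  have h1 := (subspace_continuousP _ _).1 cf x Bx.
  apply: (@continuous_cvg _ _ _ _ _ f isqrt) h1.
  apply: differentiable_continuous; apply/derivable1_diffP.
  by case: (is_derive_isqrt (f0 x Bx)).
exists (fun k x => - 2^-1 * isqrt (f x) ^+ 3 * df k x); split => //.
- by move=> k; apply: measurable_funM => //; apply: measurable_funM => //; exact: measurable_funX.
- move=> k; apply: within_cvgM => //; apply: within_cvgM; first exact: within_cst.
  under eq_fun do rewrite !exprS expr0 mulr1.
  by apply: within_cvgM => //; exact: within_cvgM.
- move=> x k Bx; have Bx' : B1bar x by exact: ltW.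
  apply/is_derive_lineP; have /is_derive_lineP h := hf x k Bx.
  have := is_derive_isqrt (f0 x Bx'); rewrite -{1}[x]add0r -{1}(scale0r (basis3 k)) => hi.
  exact: (@is_derive1_comp R isqrt (fun h : R => f (h *: basis3 k + x)) 0 _ _ hi h).
Qed.

Lemma B1bar_compact : compact (B1bar : set (R3 R)).
Proof.
apply: (@subclosed_compact _ _ (cbox (fun=> -1 : R) (fun=> 1))).
- have -> : (B1bar : set (R3 R)) = normsq3 @^-1` [set t | t <= 1] by [].
  apply: closed_comp; last exact: closed_le.
  move=> x _; rewrite /continuous_at (_ : normsq3 = fun x => coord 0 x ^+ 2 + coord 1 x ^+ 2 + coord 2 x ^+ 2)//.
  have c i : (fun y : R3 R => coord i y ^+ 2) @ x --> coord i x ^+ 2.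
    by rewrite expr2; under eq_fun do rewrite expr2; apply: cvgM; exact: continuous_coord.
  by apply: cvgD => //; exact: cvgD.
- exact: compact_cbox.
- move=> x; rewrite /B1bar/= normsq3E => h i.
  move: h; rewrite (bigD1 i)//=.
  have : 0 <= \sum_(j < 3 | j != i) coord j x ^+ 2 by apply: sumr_ge0 => j _; exact: sqr_ge0.
  by set s := \sum_(_ < _ | _) _ => s0 h; apply/andP; split; nra.
Qed.

Lemma within_bounded f : wcont f -> exists M : R, forall x, B1bar x -> `|f x| <= M.
Proof.
move=> cf; have : compact (f @` B1bar) by apply: continuous_compact => //; exact: B1bar_compact.
move=> /compact_bounded[M [Mr hM]]; exists (`|M| + 1) => x Bx.
by apply: (hM (`|M| + 1)); [rewrite (le_lt_trans (ler_norm M))// ltrDl|exists x].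
Qed.

Lemma within_sq f : measurable_fun setT (f : mR3 R -> R) -> wcont f -> sq f.
Proof.
move=> mf cf; have [M hM] := within_bounded cf.
apply: (@sqint_bounded _ _ _ _ _ mB1 _ M); first exact: leb3_B1_fin.
  exact: measurable_funTS.
by move=> x Bx; apply: hM; exact: ltW.
Qed.

Lemma within_interior f x : wcont f -> B1 x -> {for x, continuous f}.
Proof.
move=> cf Bx; have h : {in B1, continuous f}.
  rewrite -continuous_open_subspace; last exact: open_B1.
  by apply: continuous_subspaceW cf => y; exact: ltW.
by apply: h; rewrite inE.
Qed.

(** The product f phi has a continuous partial derivative on the whole space: near a point of the
    support [K] the product rule applies inside the ball, and off [K] the product is locally 0. The
    integral of that derivative vanishes. *)
Lemma C1_weak_partial f df k : C1grad f df -> is_weak_partial B1 k f (df k).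
Proof.
move=> [mf mdf cf cdf hf].
have sf := within_sq mf cf; have sdf := within_sq (mdf k) (cdf k).
apply: (iffRL (weak_partialP k _ sf)); split => // phi tphi.
have tdphi := test_derive k tphi.
have sphi := test_sqint tphi; have sdphi := test_sqint tdphi.
have [Cphi [K [cK KB K0]]] := tphi.
have clK : closed K by apply: compact_closed => //; exact: Rhausdorff.
have oK : open (~` K) by exact: closed_openC.
pose h x := f x * phi x.
pose D x := f x * 'D_(basis3 k) phi x + phi x * df k x.
have near0 x : ~ K x -> \near x, phi x = 0.
  by move=> Kx; apply: filterS (open_nbhs_nbhs (conj oK Kx)) => y /K0.
have dphi0 x : ~ K x -> 'D_(basis3 k) phi x = 0.
  by move=> Kx; rewrite (@near_eq_derive _ _ _ phi (fun=> 0)) ?derive_cst//; exact: near0.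
have h0 x : ~ K x -> h x = 0 /\ D x = 0.
  by move=> Kx; rewrite /h /D K0// dphi0// !mulr0 mul0r addr0.
have dh x : is_derive x (basis3 k) h (D x).
  have [Kx|Kx] := pselect (K x).
    have h1 := hf x k (KB x Kx).
    have h2 : is_derive x (basis3 k) phi ('D_(basis3 k) phi x).
      by split => //; have [_ /(_ k)[]] := Cphi 1%N.
    exact: is_deriveM.
  have hn : \near x, 0 = h x by apply: filterS (near0 x Kx) => y hy; rewrite /h hy mulr0.
  by rewrite (h0 x Kx).2; apply: (@near_eq_is_derive R _ _ (fun=> 0) h _ _ _ hn).
have cD : continuous D.
  move=> x; have [Kx|Kx] := pselect (K x).
    apply: cvgD; apply: cvgM.
    + exact: within_interior cf (KB x Kx).
    + exact: test_continuous tdphi x.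
    + exact: test_continuous tphi x.
    + exact: within_interior (cdf k) (KB x Kx).
  rewrite /continuous_at (h0 x Kx).2.
  apply: (@cvg_near_cst _ _ 0 D (nbhs x)).
  by apply: filterS (open_nbhs_nbhs (conj oK Kx)) => y /h0[].
have := integral_partial_zero dh cD (fun x Bx => h0 x (fun Kx => Bx (KB x Kx))).
have -> : (\int[leb3]_x (D x)%:E = \int[leb3]_(x in B) (D x)%:E)%E.
  rewrite [RHS]integral_mkcond; apply: eq_integral => x _; rewrite patchE.
  by case: ifPn => // /negP hx; rewrite (h0 x _).2// => /KB Bx; apply: hx; rewrite inE.
move=> /(congr1 fine); rewrite -/(Rintegral _ _ _) /D => /= E.
have i1 := sqintM_intble mB1 sf sdphi; have i2 := sqintM_intble mB1 sphi sdf.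
move: E; rewrite (RintegralD mB1 i1 i2) => /eqP; rewrite addr_eq0 => /eqP ->.
by congr (- _); apply: eq_Rintegral => x _; rewrite mulrC.
Qed.

Lemma C1_W12 f : C1ball f -> W12 B1 f.
Proof.
move=> [df h]; have [mf _ cf _ _] := h; split; first exact: within_sq.
by move=> k; exists (df k); exact: C1_weak_partial.
Qed.

End C1Ball.

(** * Coordinates on S_0 and the S^4-valued extension *)

Section Coordinates.
Context {R : realType}.
Implicit Types (t a b c d : R).

Lemma inord3E (m n : nat) : (m < 3)%N -> (n < 3)%N ->
  (inord m == inord n :> 'I_3) = (m == n).
Proof. by move=> hm hn; rewrite -val_eqE/= !inordK. Qed.

Lemma ord2E : (2 : 'I_3) = inord 2. Proof. by apply: val_inj; rewrite /= inordK. Qed.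

Lemma ord01E : ((1 : 'I_3) = inord 1) * ((0 : 'I_3) = inord 0).
Proof. by split; apply: val_inj; rewrite /= inordK. Qed.

Definition coords5 t a b c d : 'M[R]_3 := of_coords t (a +i* b) (c +i* d).

Lemma coords5E t a b c d i j : coords5 t a b c d i j =
  t * e0 i j + a * e11 i j + b * e12 i j + c * e21 i j + d * e22 i j.
Proof. by rewrite /coords5 /of_coords !mxE. Qed.

Lemma coords5Z k t a b c d :
  k *: coords5 t a b c d = coords5 (k * t) (k * a) (k * b) (k * c) (k * d).
Proof. by apply/matrixP => i j; rewrite mxE !coords5E; ring. Qed.

Lemma coords5_entries t a b c d (p := (Num.sqrt 6)^-1 : R) (q := (Num.sqrt 2)^-1 : R) :
  let M := coords5 t a b c d in
  [/\ [/\ M 0 0 = - p * t + q * c, M 0 1 = q * d & M 0 2 = q * a],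
      [/\ M 1 0 = q * d, M 1 1 = - p * t - q * c & M 1 2 = q * b] &
      [/\ M 2 0 = q * a, M 2 1 = q * b & M 2 2 = 2 * p * t]].
Proof.
by move=> M; split; split; rewrite /M ?ord2E ?ord01E coords5E /e0 /e11 /e12 /e21 /e22 /Eu !mxE !inord3E//= -/p -/q; ring.
Qed.

Lemma normsq_sum (M : 'M[R]_3) : normsq M = \sum_(i < 3) \sum_(j < 3) M i j * M j i.
Proof. by rewrite /normsq /mxtrace; apply: eq_bigr => i _; rewrite expr2 mxE. Qed.

Lemma normsq_coords5 t a b c d :
  normsq (coords5 t a b c d) = t ^+ 2 + a ^+ 2 + b ^+ 2 + c ^+ 2 + d ^+ 2.
Proof.
have p2 : (Num.sqrt (6 : R))^-1 ^+ 2 = 6^-1 by rewrite exprVn sqr_sqrtr.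
have q2 : (Num.sqrt (2 : R))^-1 ^+ 2 = 2^-1 by rewrite exprVn sqr_sqrtr.
have [[h00 h01 h02] [h10 h11 h12] [h20 h21 h22]] := coords5_entries t a b c d.
rewrite normsq_sum !big_ord_recl !big_ord0.
rewrite (_ : lift ord0 (lift ord0 ord0) = 2 :> 'I_3); last exact: val_inj.
rewrite (_ : lift ord0 ord0 = 1 :> 'I_3); last exact: val_inj.
rewrite h00 h01 h02 h10 h11 h12 h20 h21 h22.
move: p2 q2; set p := (Num.sqrt 6)^-1; set q := (Num.sqrt 2)^-1 => p2 q2.
transitivity (p ^+ 2 * 6 * t ^+ 2 + q ^+ 2 * 2 * (a ^+ 2 + b ^+ 2 + c ^+ 2 + d ^+ 2)); first by ring.
by rewrite p2 q2; field.
Qed.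

Lemma S0_coords5 t a b c d : S0 (coords5 t a b c d).
Proof.
have [[h00 h01 h02] [h10 h11 h12] [h20 h21 h22]] := coords5_entries t a b c d.
split.
  by apply/matrixP; elim/I3P; elim/I3P; rewrite mxE ?h00 ?h01 ?h02 ?h10 ?h11 ?h12 ?h20 ?h21 ?h22.
rewrite /mxtrace !big_ord_recl !big_ord0.
rewrite (_ : lift ord0 (lift ord0 ord0) = 2 :> 'I_3); last exact: val_inj.
rewrite (_ : lift ord0 ord0 = 1 :> 'I_3); last exact: val_inj.
by rewrite h00 h11 h22; ring.
Qed.

Lemma isqrt_sq (T : R) : 0 < T -> isqrt (T ^+ 2) = T^-1.
Proof.
move=> T0; apply/eqP; rewrite -(@eqrXn2 _ 2)//; first by rewrite isqrt_sqr ?exprn_gt0// exprVn.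
  exact/ltW/isqrt_gt0.
by rewrite invr_ge0 ltW.
Qed.

End Coordinates.

Section Extension.
Context {R : realType}.
Variable nu : R.
Hypothesis nu0 : 0 < nu.
Implicit Types (x : R3 R).
Local Notation wcont f := {within B1bar, continuous f}.

(* Homogeneous polynomials in [A = 1 + x_3], [B = 1 - x_3], [w = x_1 + i x_2]
   obtained from the numerators of [Q_{1,nu}] by [|w|^2 = A B], [z_0 = A] and
   division by [A^3]; the term [1 - |x|^2] removes the zeros on the axis. *)
Definition ct x : R := (1 + x.2) ^+ 3 - (1 + x.2) ^+ 2 * (1 - x.2)
  - nu ^+ 2 * (1 + x.2) * (1 - x.2) ^+ 2 + nu ^+ 2 / 9 * (1 - x.2) ^+ 3.
Definition cr1 x : R := 2 * ((1 + x.2) ^+ 2 - nu ^+ 2 / 3 * (1 - x.2) ^+ 2).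
Definition cr2 x : R := 2 * nu * ((1 + x.2) + 3^-1 * (1 - x.2)).
Definition ca x : R := cr1 x * x.1.1.
Definition cb x : R := cr1 x * x.1.2.
Definition cc x : R := cr2 x * (x.1.1 ^+ 2 - x.1.2 ^+ 2) + (1 - normsq3 x).
Definition cd x : R := cr2 x * (2 * x.1.1 * x.1.2).
Definition cs x : R := ct x ^+ 2 + ca x ^+ 2 + cb x ^+ 2 + cc x ^+ 2 + cd x ^+ 2.
Definition Qext x : 'M[R]_3 := isqrt (cs x) *: coords5 (ct x) (ca x) (cb x) (cc x) (cd x).

(** Suppose that all five components vanish. If [cr1] is not 0, then x lies on the axis, where [cc]
    is 1 - x_3^2; so x is a pole, and there [ct] is 8 or 8 nu^2 / 9. If [cr1] is 0, then A^2 = nu^2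
    B^2 / 3 turns [ct] into -(2/3) nu^2 B^2 (A + B/3). This vanishes only if B = 0, since A and B
    are nonnegative with sum 2, and then A = 0 as well. *)
Lemma cs_gt0 x : B1bar x -> 0 < cs x.
Proof.
rewrite /B1bar/= => Bx.
rewrite lt_neqAle eq_sym; apply/andP; split; last by rewrite /cs !addr_ge0 ?sqr_ge0.
apply/negP => /eqP; rewrite /cs => h.
have := sqr_ge0 (ct x); have := sqr_ge0 (ca x); have := sqr_ge0 (cb x).
have := sqr_ge0 (cc x); have := sqr_ge0 (cd x) => hd hc hb ha ht.
have t0 : ct x = 0 by apply/eqP; rewrite -sqrf_eq0; apply/eqP; lra.
have a0 : ca x = 0 by apply/eqP; rewrite -sqrf_eq0; apply/eqP; lra.
have b0 : cb x = 0 by apply/eqP; rewrite -sqrf_eq0; apply/eqP; lra.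
have c0 : cc x = 0 by apply/eqP; rewrite -sqrf_eq0; apply/eqP; lra.
clear ht ha hb hc hd h.
have z1 : -1 <= x.2 <= 1.
  move: Bx; rewrite /normsq3; have := sqr_ge0 x.1.1; have := sqr_ge0 x.1.2 => hy hx h.
  by apply/andP; split; nra.
have nu2 : 0 < nu ^+ 2 by rewrite exprn_gt0.
have [r0|r0] := eqVneq (cr1 x) 0; last first.
  have x0 : x.1.1 = 0 by move: a0 => /eqP; rewrite mulf_eq0 (negbTE r0) => /eqP.
  have y0 : x.1.2 = 0 by move: b0 => /eqP; rewrite mulf_eq0 (negbTE r0) => /eqP.
  move: c0; rewrite /cc /normsq3 x0 y0 !expr0n/= subr0 mulr0 !add0r => /eqP.
  rewrite subr_eq0 eq_sym sqrf_eq1 => /orP[/eqP zE|/eqP zE]; move: t0; rewrite /ct zE.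
    by rewrite subrr !expr0n/= !mulr0 addr0 !subr0 => /eqP; rewrite expf_eq0/= => /eqP; lra.
  have : 0 < nu ^+ 2 / 9 * (1 - -1) ^+ 3 by rewrite mulr_gt0 ?divr_gt0// exprn_gt0//; lra.
  by move=> h; rewrite subrr !expr0n/= !mulr0 !mul0r; lra.
move: r0 t0; rewrite /cr1 /ct; set z := x.2 in z1 * => r0 t0.
have r1 : (1 + z) ^+ 2 = nu ^+ 2 / 3 * (1 - z) ^+ 2 by move: r0; lra.
have E : - (2 / 3 * nu ^+ 2) * ((1 - z) ^+ 2 * ((1 + z) + 3^-1 * (1 - z))) = 0.
  by rewrite -t0 [(1 + z) ^+ 3]exprS r1; field.
move: E => /eqP; rewrite !mulf_eq0 oppr_eq0 mulf_eq0 (gt_eqF nu2).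
have -> : (2 / 3 == 0 :> R) = false by apply/eqP; lra.
rewrite /= orbb => /orP[/eqP zE|/eqP zE]; last by move: z1 => /andP[]; lra.
by move: r1; rewrite zE expr0n/= mulr0 => /eqP; rewrite expf_eq0/= => /eqP; lra.
Qed.

Lemma S4_Qext x : B1bar x -> S4 (Qext x).
Proof.
move=> Bx; rewrite /Qext coords5Z; split; first exact: S0_coords5.
have s0 := cs_gt0 Bx; rewrite normsq_coords5.
transitivity (isqrt (cs x) ^+ 2 * cs x); first by set r := isqrt _; rewrite /cs; ring.
by rewrite isqrt_sqr// mulVf// gt_eqF.
Qed.

Lemma C1_sub (f g : R3 R -> R) : C1ball f -> C1ball g -> C1ball (fun x => f x - g x).
Proof.
move=> hf hg; rewrite (_ : (fun x => _) = (fun x => f x + -1 * g x)).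
  by apply: C1_add => //; apply: C1_mul => //; exact: C1_cst.
by apply/funext => x; rewrite mulN1r.
Qed.

Ltac C1_tac := repeat first [exact: C1_cst | exact: (C1_coord 0) | exact: (C1_coord 1)
  | exact: (C1_coord 2) | apply: C1_sub | apply: C1_exp | apply: C1_mul | apply: C1_add ].

Lemma C1_Qext i j : C1ball (fun x => Qext x i j).
Proof.
have h1 : C1ball cr1 by rewrite /cr1; C1_tac.
have h2 : C1ball cr2 by rewrite /cr2; C1_tac.
have ht : C1ball ct by rewrite /ct; C1_tac.
have ha : C1ball ca by apply: C1_mul => //; C1_tac.
have hb : C1ball cb by apply: C1_mul => //; C1_tac.
have hd : C1ball cd by apply: C1_mul => //; C1_tac.
have hc : C1ball cc.
  by apply: C1_add; [apply: C1_mul => //; C1_tac|rewrite /normsq3; C1_tac].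
have hs : C1ball cs by do 4 (apply: C1_add; last exact: C1_exp); exact: C1_exp.
rewrite (_ : (fun x => _) = (fun x => isqrt (cs x) * (ct x * e0 i j + ca x * e11 i j +
   cb x * e12 i j + cc x * e21 i j + cd x * e22 i j))); last first.
  by apply/funext => x; rewrite /Qext mxE coords5E.
apply: C1_mul; first by apply: C1_isqrt => //; exact: cs_gt0.
by do 4 (apply: C1_add; last by apply: C1_mul => //; exact: C1_cst); apply: C1_mul => //; exact: C1_cst.
Qed.

Lemma Qext_cont i j : wcont (fun x => Qext x i j).
Proof. by have [df []] := C1_Qext i j. Qed.

Lemma normc_real (a : R) : 0 <= a -> ComplexField.Normc.normc a%:C = a.
Proof. by move=> a0; rewrite /ComplexField.Normc.normc/= expr0n/= addr0 sqrtr_sqr ger0_norm. Qed.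

Lemma normc_sqr (a b : R) : ComplexField.Normc.normc (a +i* b) ^+ 2 = a ^+ 2 + b ^+ 2.
Proof. by rewrite /ComplexField.Normc.normc sqr_sqrtr// addr_ge0 ?sqr_ge0. Qed.

(** On the sphere the numerators of [Qmu] are A^3 times the polynomials of [Qext], its denominator
    is A^3 P, and [cs] is P^2; the factor A^3 cancels. At the south pole A = 0 and the homogeneous
    coordinates are (0, 1), so that point is computed apart. *)
Lemma Qext_sphere x : normsq3 x = 1 -> Qext x = Qmu 1 nu%:C x.
Proof.
move=> nx; rewrite /Qmu /hom_coords.
have n1 : ComplexField.Normc.normc (1 : R[i]) = 1 by exact: (@normc_real 1).
have nn := normc_real (ltW nu0).
have nu2 : 0 < nu ^+ 2 by rewrite exprn_gt0.
have cE (t : R) z w : of_coords t z w =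
    coords5 t (complex.Re z) (complex.Im z) (complex.Re w) (complex.Im w).
  by case: z w => [? ?] [].
have z1 : -1 <= x.2 <= 1.
  move: nx; rewrite /normsq3; have := sqr_ge0 x.1.1; have := sqr_ge0 x.1.2 => hy hx h.
  by apply/andP; split; nra.
case: eqP => [zE|/eqP zE].
  have n0 : ComplexField.Normc.normc (0 : R[i]) = 0 by exact: (@normc_real 0).
  have [x0 y0] : x.1.1 = 0 /\ x.1.2 = 0.
    move: nx; rewrite /normsq3 zE; have := sqr_ge0 x.1.1; have := sqr_ge0 x.1.2 => hy hx h.
    by split; apply/eqP; rewrite -sqrf_eq0; apply/eqP; move: h; rewrite sqrrN expr1n; lra.
  rewrite n0 n1 nn cE; set X := _ * (_ - _)%:C; set Y := _ * (_ + _)%:C.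
  have -> : X = 0 by rewrite /X conjc0 mulr0 !mul0r.
  have -> : Y = 0 by rewrite /Y conjc0 expr0n/= mulr0 !mul0r.
  have D0 : 0 < nu ^+ 2 / 9 by rewrite divr_gt0.
  rewrite (_ : 0 ^+ 6 + _ + _ + _ = nu ^+ 2 / 9); last by ring.
  rewrite (_ : 0 ^+ 6 - _ - _ + _ = nu ^+ 2 / 9); last by ring.
  have T0 : 0 < nu ^+ 2 / 9 * 8 by rewrite mulr_gt0// divr_gt0.
  have ct0 : ct x = nu ^+ 2 / 9 * 8 by rewrite /ct zE; ring.
  have ca0 : ca x = 0 by rewrite /ca x0 mulr0.
  have cb0 : cb x = 0 by rewrite /cb y0 mulr0.
  have cc0 : cc x = 0 by rewrite /cc nx x0 y0; ring.
  have cd0 : cd x = 0 by rewrite /cd x0; ring.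
  rewrite /Qext /cs ct0 ca0 cb0 cc0 cd0 expr0n/= !addr0 isqrt_sq// !coords5Z !mulr0 mulVf ?gt_eqF//=.
  by rewrite mulVf ?gt_eqF.
pose A := 1 + x.2; pose B := 1 - x.2.
have A0 : 0 < A by rewrite /A; move: z1 => /andP[]; rewrite le_eqVlt eq_sym (negbTE zE)/= => h _; lra.
have B0 : 0 <= B by rewrite /B; move: z1 => /andP[]; lra.
have wAB : ComplexField.Normc.normc (x.1.1 +i* x.1.2) ^+ 2 = A * B.
  by rewrite normc_sqr /A /B; move: nx; rewrite /normsq3 => nx; lra.
have wAB' : x.1.2 ^+ 2 = A * B - x.1.1 ^+ 2.
  by rewrite -wAB normc_sqr addrAC subrr add0r.
pose P := A ^+ 3 + A ^+ 2 * B + nu ^+ 2 * A * B ^+ 2 + nu ^+ 2 / 9 * B ^+ 3.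
have P0 : 0 < P.
  have h1 : 0 < A ^+ 3 by rewrite exprn_gt0.
  have h2 : 0 <= A ^+ 2 * B by rewrite mulr_ge0// exprn_ge0// ltW.
  have h3 : 0 <= nu ^+ 2 * A * B ^+ 2 by rewrite !mulr_ge0 ?exprn_ge0// ltW.
  have h4 : 0 <= nu ^+ 2 / 9 * B ^+ 3 by rewrite !mulr_ge0 ?exprn_ge0// ltW.
  by rewrite /P; lra.
rewrite n1 nn (normc_real (ltW A0)) -/A.
set b := ComplexField.Normc.normc _ in wAB *.
have -> : b ^+ 6 = (A * B) ^+ 3 by rewrite -wAB -exprM.
have -> : b ^+ 4 = (A * B) ^+ 2 by rewrite -wAB -exprM.
rewrite wAB cE !expr1n.
set X := _ * (_ - _)%:C; set Y := _ * (_ + _)%:C.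
have XE : X = (A ^+ 3 * ca x) +i* (A ^+ 3 * cb x).
  rewrite /X /ca /cb /cr1 -/A -/B.
  have -> : (2 : R[i]) = (2 : R)%:C by rewrite rmorph_nat.
  by apply/eqP; rewrite eq_complex /=; apply/andP; split; apply/eqP; ring.
have YE : Y = (A ^+ 3 * cc x) +i* (A ^+ 3 * cd x).
  rewrite /Y /cc /cd /cr2 nx -/A -/B !expr2.
  have -> : (2 : R[i]) = (2 : R)%:C by rewrite rmorph_nat.
  by apply/eqP; rewrite eq_complex /=; apply/andP; split; apply/eqP; ring.
have sE : cs x = P ^+ 2.
  rewrite /cs /ct /ca /cb /cc /cd nx /cr1 /cr2 -/A -/B /P.
  transitivity ((A ^+ 3 - A ^+ 2 * B - nu ^+ 2 * A * B ^+ 2 + nu ^+ 2 / 9 * B ^+ 3) ^+ 2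
    + (2 * (A ^+ 2 - nu ^+ 2 / 3 * B ^+ 2)) ^+ 2 * (x.1.1 ^+ 2 + x.1.2 ^+ 2)
    + (2 * nu * (A + 3^-1 * B)) ^+ 2 * (x.1.1 ^+ 2 + x.1.2 ^+ 2) ^+ 2); first by ring.
  by rewrite wAB'; field.
have E1 : A ^+ 6 + 1 * A ^+ 4 * (A * B) + nu ^+ 2 * A ^+ 2 * (A * B) ^+ 2 +
    1 * nu ^+ 2 / 9 * (A * B) ^+ 3 = A ^+ 3 * P by rewrite /P; ring.
have E2 : A ^+ 6 - 1 * A ^+ 4 * (A * B) - nu ^+ 2 * A ^+ 2 * (A * B) ^+ 2 +
    1 * nu ^+ 2 / 9 * (A * B) ^+ 3 = A ^+ 3 * ct x by rewrite /ct -/A -/B; ring.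
rewrite E1 E2 XE YE /Qext sE isqrt_sq// ![complex.Re _]/= ![complex.Im _]/= -coords5Z scalerA.
by congr (_ *: _); rewrite invfM mulrAC mulVf ?mul1r// expf_eq0 gt_eqF.
Qed.

End Extension.

(** * Energies *)

Section Potential.
Context {R : realType}.
Implicit Types (A : 'M[R]_3).

Lemma sum3E (F : 'I_3 -> R) : \sum_(i < 3) F i = F 0 + F 1 + F 2.
Proof.
rewrite !big_ord_recl big_ord0 addr0 addrA.
by congr (_ + F _ + F _); exact: val_inj.
Qed.

Lemma cube_sum A : \tr (A ^+ 3) = \sum_(i < 3) \sum_(j < 3) \sum_(k < 3) A i j * A j k * A k i.
Proof.
rewrite /mxtrace; apply: eq_bigr => i _; rewrite exprS expr2 mxE.
apply: eq_bigr => j _; rewrite mxE mulr_sumr; apply: eq_bigr => k _.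
by rewrite mulrA.
Qed.

Lemma S0_entries A : S0 A ->
  [/\ A 1 0 = A 0 1, A 2 0 = A 0 2, A 2 1 = A 1 2 & A 2 2 = - A 0 0 - A 1 1].
Proof.
move=> [sA]; rewrite /mxtrace sum3E => tA.
have h i j : A i j = A j i by rewrite -{1}sA mxE.
by split; [exact: h|exact: h|exact: h|lra].
Qed.

(* The square norm of [A^2 - r A - (|A|^2 / 3) Id] with [r = |A| / sqrt 6],
   a matrix which vanishes exactly at the minimizers of the potential. *)
Lemma cube_le A (r : R) : S0 A -> r ^+ 2 = normsq A / 6 ->
  2 * r * \tr (A ^+ 3) <= normsq A ^+ 2 / 3.
Proof.
move=> /S0_entries[h10 h20 h21 h22] hr.
pose N := normsq A.
pose C i j := \sum_(k < 3) A i k * A k j - r * A i j - (if i == j then N / 3 else 0).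
have : 0 <= \sum_(i < 3) \sum_(j < 3) C i j ^+ 2.
  by apply: sumr_ge0 => i _; apply: sumr_ge0 => j _; exact: sqr_ge0.
have NE : N = 2 * (A 0 0 ^+ 2 + A 1 1 ^+ 2 + A 0 0 * A 1 1 + A 0 1 ^+ 2 + A 0 2 ^+ 2 + A 1 2 ^+ 2).
  by rewrite /N normsq_sum !sum3E h10 h20 h21 h22; ring.
have -> : \sum_(i < 3) \sum_(j < 3) C i j ^+ 2 =
    N ^+ 2 / 3 + (r ^+ 2 - N / 6) * N - 2 * r * \tr (A ^+ 3).
  rewrite cube_sum !sum3E /C !sum3E h10 h20 h21 h22 !eqxx.
  rewrite (_ : (0 == 1 :> 'I_3) = false)// (_ : (0 == 2 :> 'I_3) = false)//.
  rewrite (_ : (1 == 0 :> 'I_3) = false)// (_ : (1 == 2 :> 'I_3) = false)//.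
  rewrite (_ : (2 == 0 :> 'I_3) = false)// (_ : (2 == 1 :> 'I_3) = false)//.
  by rewrite NE; field.
by rewrite hr subrr mul0r addr0 /N; lra.
Qed.

Lemma normsq_ge0 A : S0 A -> 0 <= normsq A.
Proof.
move=> /S0_entries[h10 h20 h21 h22]; rewrite normsq_sum !sum3E h10 h20 h21 h22.
have := sqr_ge0 (A 0 0); have := sqr_ge0 (A 1 1); have := sqr_ge0 (A 0 0 + A 1 1).
by have := sqr_ge0 (A 0 1); have := sqr_ge0 (A 0 2); have := sqr_ge0 (A 1 2); nra.
Qed.

(** With s = |A| and g = 1 / sqrt 6, [cube_le] gives tr(A^3) <= g s^3, and the potential is then at
    least (g / 12) (s - 1)^2 (3 s^2 + 2 s + 1). *)
Lemma Wpot_ge0 A : S0 A -> 0 <= Wpot A.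
Proof.
move=> hA; have N0 := normsq_ge0 hA.
pose s : R := Num.sqrt (normsq A); pose g : R := (Num.sqrt (6 : R))^-1.
have s0 : 0 <= s by exact: sqrtr_ge0.
have s2 : s ^+ 2 = normsq A by rewrite sqr_sqrtr.
have g0 : 0 < g by rewrite invr_gt0 sqrtr_gt0.
have g2 : g ^+ 2 = 6^-1 by rewrite exprVn sqr_sqrtr.
have h : \tr (A ^+ 3) <= g * s ^+ 3.
  have := @cube_le A (g * s) hA; rewrite exprMn g2 s2 mulrC => /(_ erefl).
  have [sz|sz] := eqVneq s 0; last first.
    have sp : 0 < g * s by rewrite mulr_gt0// lt_neqAle eq_sym sz.
    rewrite -s2 => h; rewrite -(ler_pM2l sp); move: h.
    rewrite (_ : g * s * (g * s ^+ 3) = g ^+ 2 * s ^+ 4); last by ring.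
    rewrite g2 (_ : (s ^+ 2) ^+ 2 = s ^+ 4); last by ring.
    by set X := g * s; set Y := \tr _; set Z := s ^+ 4; lra.
  (* For s = 0 it is impossible to divide by g s, but then the matrix itself is 0. *)
  move=> _; have A0 : A = 0.
    move: s2; rewrite sz expr0n/= => /esym; have [h10 h20 h21 h22] := S0_entries hA.
    rewrite normsq_sum !sum3E h10 h20 h21 h22 => E.
    have := sqr_ge0 (A 0 0); have := sqr_ge0 (A 1 1); have := sqr_ge0 (A 0 0 + A 1 1).
    have := sqr_ge0 (A 0 1); have := sqr_ge0 (A 0 2); have := sqr_ge0 (A 1 2) => e1 e2 e3 e4 e5 e6.
    have z i j : A i j ^+ 2 <= 0 -> A i j = 0.
      by move=> hz; apply/eqP; rewrite -sqrf_eq0 eq_le hz sqr_ge0.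
    have z00 : A 0 0 = 0 by apply: z; nra.
    have z11 : A 1 1 = 0 by apply: z; nra.
    have z01 : A 0 1 = 0 by apply: z; nra.
    have z02 : A 0 2 = 0 by apply: z; nra.
    have z12 : A 1 2 = 0 by apply: z; nra.
    by apply/matrixP; elim/I3P; elim/I3P; rewrite mxE ?h22 ?h10 ?h20 ?h21 ?z00 ?z11 ?z01 ?z02 ?z12 ?oppr0 ?addr0.
  by rewrite A0 expr0n/= mxtrace0 sz expr0n/= mulr0.
rewrite /Wpot !invfM -/g -s2.
have : 0 <= g / 12 * ((s - 1) ^+ 2 * (3 * s ^+ 2 + 2 * s + 1)).
  apply: mulr_ge0; first by apply: divr_ge0 => //; exact: ltW.
  by apply: mulr_ge0; [exact: sqr_ge0|have := sqr_ge0 s; lra].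
move: h; set Y := \tr _ => h k.
have -> : 4^-1 * g * (s ^+ 2) ^+ 2 - 3^-1 * Y + 12^-1 * g =
  g / 12 * ((s - 1) ^+ 2 * (3 * s ^+ 2 + 2 * s + 1)) + 3^-1 * (g * s ^+ 3 - Y) by field.
by rewrite addr_ge0// mulr_ge0// subr_ge0.
Qed.

Lemma cvg_normsq (A_ : nat -> 'M[R]_3) A : (forall i j, A_ n i j @[n --> \oo] --> A i j) ->
  normsq (A_ n) @[n --> \oo] --> normsq A.
Proof.
move=> h; rewrite normsq_sum; under eq_fun do rewrite normsq_sum.
by apply: cvg_finsum => i; apply: cvg_finsum => j; apply: cvgM.
Qed.

Lemma cvg_Wpot (A_ : nat -> 'M[R]_3) A : (forall i j, A_ n i j @[n --> \oo] --> A i j) ->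
  Wpot (A_ n) @[n --> \oo] --> Wpot A.
Proof.
move=> h; rewrite /Wpot; apply: cvgD; last exact: cvg_cst.
apply: cvgB; apply: cvgM; try exact: cvg_cst.
  rewrite expr2; under eq_fun do rewrite expr2.
  by apply: cvgM; exact: cvg_normsq.
rewrite cube_sum; under eq_fun do rewrite cube_sum.
by apply: cvg_finsum => i; apply: cvg_finsum => j; apply: cvg_finsum => k; apply: cvgM => //; apply: cvgM.
Qed.

Lemma S0_limit (A_ : nat -> 'M[R]_3) A : (forall i j, A_ n i j @[n --> \oo] --> A i j) ->
  (forall n, S0 (A_ n)) -> S0 A.
Proof.
move=> h s; split.
  apply/matrixP => i j; rewrite mxE.
  have h1 := h i j; have h2 := h j i.
  have E : (fun n => A_ n j i) = (fun n => A_ n i j).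
    by apply/funext => n; have [sA _] := s n; rewrite -{1}sA mxE.
  by rewrite E in h2; exact: (cvg_unique _ h2 h1).
have h1 : (\sum_(i < 3) A_ n i i) @[n --> \oo] --> \sum_(i < 3) A i i by apply: cvg_finsum => i.
have E : (fun n => \sum_(i < 3) A_ n i i) = (fun=> 0).
  by apply/funext => n; have [_] := s n.
by rewrite E in h1; exact: (cvg_unique _ h1 (cvg_cst 0)).
Qed.

End Potential.

Section MatrixMeasurability.
Context d (T : measurableType d) (R : realType) (D : set T) (Q : T -> 'M[R]_3).
Hypothesis mQ : forall i j, measurable_fun D (fun x => Q x i j).

Lemma measurable_normsq : measurable_fun D (fun x => normsq (Q x)).
Proof.
under eq_fun do rewrite normsq_sum.
by apply: measurable_sum => i; apply: measurable_sum => j; exact: measurable_funM.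
Qed.

Lemma measurable_Wpot : measurable_fun D (fun x => Wpot (Q x)).
Proof.
rewrite /Wpot; apply: measurable_funD; last exact: measurable_cst.
apply: measurable_funB; apply: measurable_funM; try exact: measurable_cst.
  exact/measurable_funX/measurable_normsq.
under eq_fun do rewrite cube_sum.
apply: measurable_sum => i; apply: measurable_sum => j; apply: measurable_sum => k.
by apply: measurable_funM => //; exact: measurable_funM.
Qed.

End MatrixMeasurability.

(** * Measurability of pointwise limits *)

Section PointwiseLimit.
Context d (T : measurableType d) (R : realType).
Variables (D : set T).
Hypothesis mD : measurable D.

Lemma cvgn_cauchyP (u : nat -> R) : cvgn u <-> forall k : nat, exists N, forall n m,
  (N <= n)%N -> (N <= m)%N -> `|u n - u m| <= k.+1%:R^-1.
Proof.
split=> [/cvg_ex[l hl] k|h].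
  have k0 : 0 < (k.+1%:R^-1 / 2 : R) by rewrite divr_gt0// invr_gt0.
  have /cvgrPdist_le/(_ _ k0)[N _ hN] := hl; exists N => n m Nn Nm.
  have h1 := hN n Nn; have h2 := hN m Nm; rewrite /= in h1 h2.
  rewrite (_ : u n - u m = (l - u m) - (l - u n)); last by ring.
  by apply: le_trans (ler_normB _ _) _; rewrite [leRHS]splitr lerD.
apply: R_complete; apply: cauchy_exP => e e0.
have [k _ hk] := near_infty_natSinv_lt (PosNum e0).
have [N hN] := h k; exists (u N); exists N => // n /= Nn.
by rewrite /ball/=; apply: le_lt_trans (hN _ _ _ _) (hk k _) => /=.
Qed.

Lemma measurable_cvg_set (u : nat -> T -> R) : (forall n, measurable_fun D (u n)) ->
  measurable (D `&` [set x | cvgn (u ^~ x)]).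
Proof.
move=> mu.
rewrite (_ : _ `&` _ = \bigcap_k \bigcup_N \bigcap_n \bigcap_m
   (D `&` [set x | (N <= n)%N -> (N <= m)%N -> `|u n x - u m x| <= k.+1%:R^-1])).
  apply: bigcap_measurable => [|k _]; first by exists 0%N.
  apply: bigcup_measurable => N _; apply: bigcap_measurable => [|n _]; first by exists 0%N.
  apply: bigcap_measurable => [|m _]; first by exists 0%N.
  have [Nn|Nn] := leqP N n; last first.
    by rewrite (_ : [set x | _] = setT) ?setIT//; apply/seteqP; split.
  have [Nm|Nm] := leqP N m; last first.
    by rewrite (_ : [set x | _] = setT) ?setIT//; apply/seteqP; split.
  rewrite (_ : [set x | _] = [set x | `|u n x - u m x| <= k.+1%:R^-1]).
    have mf : measurable_fun D (fun x => `|u n x - u m x|).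
      by apply: measurableT_comp => //; exact: measurable_funB.
    have := mf mD `]-oo, k.+1%:R^-1]%classic (measurable_itv _).
    by congr measurable; congr (_ `&` _); apply/seteqP; split => x /=; rewrite in_itv.
  by apply/seteqP; split => x /=; [apply|].
apply/seteqP; split => [x [Dx /= /cvgn_cauchyP h] k _|x h].
  by have [N hN] := h k; exists N => // n _ m _; split => // ? ?; exact: hN.
split.
  by have [N _ /(_ 0%N I 0%N I) []] := h 0%N I.
apply/cvgn_cauchyP => k; have [N _ hN] := h k I; exists N => n m Nn Nm.
by have [_ /(_ Nn Nm)] := hN n I m I.
Qed.

(** The value is 0 as soon as one component diverges, in agreement with [limmx]; the set of joint
    convergence is measurable by the Cauchy criterion. *)
Lemma measurable_joint_limit (J : finType) (u : nat -> J -> T -> R) (j : J) :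
  (forall n j, measurable_fun D (u n j)) ->
  measurable_fun D (fun x => if `[< forall j, cvgn (fun n => u n j x) >]
    then limn (fun n => u n j x) else 0).
Proof.
move=> mu.
pose C := \bigcap_(j : J) (D `&` [set x | cvgn (fun n => u n j x)]).
have mC : measurable C.
  apply: fin_bigcap_measurable => [|i _]; first exact: finite_finset.
  exact: (measurable_cvg_set (u := fun n => u n i)).
have CE x : D x -> C x <-> forall j, cvgn (fun n => u n j x).
  move=> Dx; split=> [h i|h i _]; first by case: (h i I).
  by split => //=; exact: h.
apply: (measurable_fun_cvg (h := fun n => u n j \_ C)) => [n|x Dx].
  apply: measurable_funTS; apply/(measurable_restrictT _ mC).1.
  by apply: measurable_funS (mu n j) => // x /(_ j I)[].
case: asboolP => h.
  rewrite (_ : (fun n => _) = (fun n => u n j x)); first exact: h.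
  by apply/funext => n; rewrite patchE mem_set//; apply/(CE _ Dx).
rewrite (_ : (fun n => _) = (fun=> 0)); first exact: cvg_cst.
by apply/funext => n; rewrite patchE memNset// => /(CE _ Dx).
Qed.

End PointwiseLimit.

Section Energies.
Context {R : realType}.
Implicit Types (u v g : R3 R -> R) (k : 'I_3) (Q : R3 R -> 'M[R]_3) (p : 'I_3 * 'I_3).
Local Notation mB1 := measurable_B1.
Local Notation B := (@B1 R : set (mR3 R)).
Local Notation sq := (sqint leb3 B).
Local Notation nB := (nsq leb3 B).
Local Notation wp := (wpartial B1).

Definition entry Q p : R3 R -> R := fun x => Q x p.1 p.2.

Definition dirichlet Q : R := \sum_p \sum_(k < 3) nB (wp k (entry Q p)).

Lemma wpartial_congr k u v : W12 B1 u -> W12 B1 v ->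
  {ae (@leb3 R), forall x, B1 x -> u x = v x} ->
  {ae (@leb3 R), forall x, B1 x -> wp k u x = wp k v x}.
Proof.
move=> hu hv uv.
suff h : is_weak_partial B1 k v (wp k u) by have := wpartial_ae hv h; apply: filterS => x /[apply].
have sw := sq_wpartial k hu.
have s0 : sq (fun=> 0).
  by have := sqintZ mB1 0 hu.1; congr sqint; apply/funext => x; rewrite mul0r.
have z0 : nB (fun=> 0) = 0.
  by rewrite /nsq /Rintegral; under eq_integral do rewrite expr0n; rewrite integral0.
(* A constant sequence at L^2 distance 0 from [v]. *)
apply: (@weak_partial_limit _ k (fun=> u) (fun=> wp k u)) => //.
- by move=> _; exact: hu.1.
- exact: hv.1.
- by move=> _; exact: wpartialP.
- rewrite (_ : nB _ = 0); first exact: cvg_cst.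
  rewrite -z0; apply: ae_eq_nsq => //; [exact: mB1|exact (sqintB mB1 hu.1 hv.1)|].
  by apply: filterS uv => x /[apply] ->; rewrite subrr.
- rewrite (_ : nB _ = 0); first exact: cvg_cst.
  by rewrite -z0; apply: eq_nsq => x _; rewrite subrr.
Qed.

Lemma W12_entry X Q p : W12_into B1 X Q -> W12 B1 (entry Q p).
Proof. by move=> [h _]; exact: h. Qed.

Lemma measurable_entry X Q i j : W12_into B1 X Q -> measurable_fun B (fun x => Q x i j).
Proof. by move=> [h _]; case: (h i j) => -[]. Qed.

(** tr(A^2) is a sum of squares only for symmetric A. The derivatives of the entries are chosen one
    by one, so their symmetry holds only almost everywhere, by uniqueness. *)
Lemma grad_normsqE Q : W12_into B1 S0 Q -> {ae (@leb3 R), forall x, B1 x ->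
  grad_normsq B1 Q x = \sum_p \sum_(k < 3) wp k (entry Q p) x ^+ 2}.
Proof.
move=> hQ; have hS := hQ.2.
have h : {ae (@leb3 R), forall x, forall k p, B1 x ->
    wp k (entry Q (p.2, p.1)) x = wp k (entry Q p) x}.
  apply: filter_forall => k; apply: filter_forall => p.
  apply: wpartial_congr; [exact: W12_entry hQ|exact: W12_entry hQ|].
  by apply: filterS hS => x /[apply] -[sA _]; rewrite /entry -{1}sA mxE.
apply: filterS h => x hx Bx.
rewrite /grad_normsq [RHS]exchange_big/=; apply: eq_bigr => k _.
rewrite normsq_sum (pair_bigA _ (fun i j => dpartial B1 k Q x i j * dpartial B1 k Q x j i))/=.
by apply: eq_bigr => p _; rewrite !mxE (hx k p Bx) expr2.
Qed.

Lemma measurable_wp X Q k p : W12_into B1 X Q -> measurable_fun B (wp k (entry Q p)).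
Proof. by move=> /(@W12_entry _ _ p)/(sq_wpartial k)[]. Qed.

Lemma dirichletE Q : W12_into B1 S0 Q ->
  (\int[leb3]_(x in B) (2^-1 * \sum_p \sum_(k < 3) wp k (entry Q p) x ^+ 2)%:E)%E =
  (2^-1 * dirichlet Q)%:E.
Proof.
move=> hQ; have sw k p := sq_wpartial k (W12_entry p hQ).
have ms p : measurable_fun B (fun x => \sum_(k < 3) wp k (entry Q p) x ^+ 2).
  by apply: measurable_sum => k; apply/measurable_funX; case: (sw k p).
under eq_integral do rewrite EFinM.
rewrite ge0_integralZl_EFin//; [|exact: mB1| |].
- rewrite EFinM; congr (_ * _)%E; under eq_integral do rewrite -sumEFin.
  rewrite ge0_integral_sum//; [|exact: mB1| |].
  + rewrite /dirichlet -sumEFin; apply: eq_bigr => p _.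
    under eq_integral do rewrite -sumEFin.
    rewrite ge0_integral_sum//; [|exact: mB1| |].
    * by rewrite -sumEFin; apply: eq_bigr => k _; rewrite (nsqE mB1 (sw k p)).
    * by move=> k; apply/measurable_EFinP/measurable_funX; case: (sw k p).
    * by move=> k x _; rewrite lee_fin sqr_ge0.
  + by move=> p; apply/measurable_EFinP.
  + by move=> p x _; rewrite lee_fin sumr_ge0// => k _; exact: sqr_ge0.
- by move=> x _; rewrite lee_fin !sumr_ge0// => p _; rewrite sumr_ge0// => k _; exact: sqr_ge0.
- by apply/measurable_EFinP; apply: measurable_sum.
Qed.

(** The absolute value makes each integrand nonnegative everywhere, so the integral splits in the
    extended reals before anything is known to be finite. It changes the potential only on a null
    set, where [Q] is not in [S0]. *)
Lemma energyF_split lambda mu Q : 0 < lambda -> 0 <= mu -> W12_into B1 S0 Q ->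
  energyF lambda mu Q = ((2^-1 * dirichlet Q)%:E +
    \int[leb3]_(x in B) (lambda * `|Wpot (Q x)|)%:E +
    \int[leb3]_(x in B) (mu / 4 * (1 - normsq (Q x)) ^+ 2)%:E)%E.
Proof.
move=> l0 m0 hQ.
have mQ i j := measurable_entry i j hQ.
have mw k p := measurable_wp k p hQ.
have m1 : measurable_fun B (fun x => 2^-1 * \sum_p \sum_(k < 3) wp k (entry Q p) x ^+ 2).
  apply: measurable_funM; first exact: measurable_cst.
  by apply: measurable_sum => p; apply: measurable_sum => k; exact: measurable_funX.
have mW : measurable_fun B (fun x => Wpot (Q x)) by exact: measurable_Wpot.
have m2 : measurable_fun B (fun x => lambda * `|Wpot (Q x)|).
  by apply: measurable_funM; [exact: measurable_cst|exact: measurableT_comp].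
have m3 : measurable_fun B (fun x => mu / 4 * (1 - normsq (Q x)) ^+ 2).
  apply: measurable_funM; first exact: measurable_cst.
  apply/measurable_funX/measurable_funB; first exact: measurable_cst.
  exact: measurable_normsq.
rewrite -(dirichletE hQ) -ge0_integralD//; last 5 first.
- exact: mB1.
- move=> x _; rewrite lee_fin mulr_ge0// sumr_ge0// => p _; rewrite sumr_ge0// => k _; exact: sqr_ge0.
- exact/measurable_EFinP.
- by move=> x _; rewrite lee_fin mulr_ge0// ltW.
- exact/measurable_EFinP.
rewrite -ge0_integralD//; last 5 first.
- exact: mB1.
- move=> x _; rewrite -EFinD lee_fin addr_ge0//; last by rewrite mulr_ge0// ltW.
  rewrite mulr_ge0// sumr_ge0// => p _; rewrite sumr_ge0// => k _; exact: sqr_ge0.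
- by apply: emeasurable_funD; exact/measurable_EFinP.
- by move=> x _; rewrite lee_fin mulr_ge0 ?sqr_ge0// divr_ge0.
- exact/measurable_EFinP.
rewrite /energyF; apply: ae_eq_integral => //.
- exact: mB1.
- apply/measurable_EFinP; apply: measurable_funD => //; apply: measurable_funD.
    apply: measurable_funM; first exact: measurable_cst.
    apply: measurable_sum => k; apply: measurable_normsq => i j.
    rewrite (_ : (fun x => _) = wp k (entry Q (i, j))); first exact: mw.
    by apply/funext => x; rewrite mxE.
  by apply: measurable_funM => //; exact: measurable_cst.
- by apply: emeasurable_funD; [apply: emeasurable_funD|]; exact/measurable_EFinP.
- apply: filterS2 (grad_normsqE hQ) hQ.2 => x h1 h2 Bx.
  by rewrite h1// (ger0_norm (Wpot_ge0 (h2 Bx))) -!EFinD.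
Qed.

Lemma energyF0 lambda Q : energyF lambda 0 Q = energyE lambda Q.
Proof. by apply: eq_integral => x _; rewrite !mul0r addr0. Qed.

Lemma energyE_split lambda Q : 0 < lambda -> W12_into B1 S0 Q ->
  energyE lambda Q = ((2^-1 * dirichlet Q)%:E +
    \int[leb3]_(x in B) (lambda * `|Wpot (Q x)|)%:E)%E.
Proof.
move=> l0 hQ; rewrite -energyF0 energyF_split// [X in (_ + X)%E = _](_ : _ = 0%E) ?adde0//.
by apply: integral0_eq => x _; rewrite !mul0r.
Qed.

Lemma energyF_S4 lambda mu Q : 0 < lambda -> 0 <= mu -> W12_into B1 S4 Q ->
  W12_into B1 S0 Q /\ energyF lambda mu Q = energyE lambda Q.
Proof.
move=> l0 m0 [hQ hS].
have hQ0 : W12_into B1 S0 Q.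
  by split => //; apply: filterS hS => x /[apply] -[].
split => //; rewrite energyF_split// energyE_split// [X in (_ + X)%E = _](_ : _ = 0%E) ?adde0//.
rewrite -[RHS](integral0 leb3 B); apply: ae_eq_integral => //.
- exact: mB1.
- apply/measurable_EFinP; apply: measurable_funM; first exact: measurable_cst.
  apply/measurable_funX/measurable_funB; first exact: measurable_cst.
  by apply: measurable_normsq => i j; exact: measurable_entry hQ0.
- by apply: filterS hS => x /[apply] -[_ ->]; rewrite subrr expr0n/= mulr0.
Qed.

Lemma energyE_S4_lty lambda Q : 0 < lambda -> W12_into B1 S4 Q -> (energyE lambda Q < +oo)%E.
Proof.
move=> l0 hQ; have [hQ0 _] := energyF_S4 l0 (lexx 0) hQ.
rewrite energyE_split// lte_add_pinfty ?ltry//.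
(* On S^4 all entries are at most 1 in absolute value, and tr(A^3) is a sum of 27 products of
   entries. *)
pose C : R := (4 * Num.sqrt 6)^-1 + 3^-1 * 27 + (12 * Num.sqrt 6)^-1.
have s6 : 0 < Num.sqrt (6 : R) by rewrite sqrtr_gt0.
apply: (@le_lt_trans _ _ (\int[leb3]_(x in B) (lambda * C)%:E)%E); last first.
  rewrite integral_cst; last exact: mB1.
  by rewrite lte_mul_pinfty ?leb3_B1_fin// lee_fin mulr_ge0 ?ltW// /C !addr_gt0 ?invr_gt0 ?mulr_gt0.
apply: ae_ge0_le_integral => //.
- exact: mB1.
- by move=> x _; rewrite lee_fin mulr_ge0// ltW.
- apply/measurable_EFinP; apply: measurable_funM; first exact: measurable_cst.
  by apply: measurableT_comp => //; apply: measurable_Wpot => i j; exact: measurable_entry hQ.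
- by move=> x _; rewrite lee_fin mulr_ge0 ?ltW// /C !addr_gt0 ?invr_gt0 ?mulr_gt0.
apply: filterS hQ.2 => x /[apply] -[SA NA]; rewrite lee_fin; apply: ler_wpM2l; first exact: ltW.
set A := Q x in SA NA *; rewrite ger0_norm ?Wpot_ge0// /Wpot NA expr1n mulr1 /C.
have e1 i j : `|A i j| <= 1.
  have [h10 h20 h21 h22] := S0_entries SA; move: NA.
  rewrite normsq_sum !sum3E h10 h20 h21 => NA.
  have hh (z : R) : z ^+ 2 <= 1 -> `|z| <= 1 by move=> hz; rewrite ler_norml; apply/andP; split; nra.
  have := sqr_ge0 (A 0 0); have := sqr_ge0 (A 1 1); have := sqr_ge0 (A 2 2).
  have := sqr_ge0 (A 0 1); have := sqr_ge0 (A 0 2); have := sqr_ge0 (A 1 2) => k1 k2 k3 k4 k5 k6.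
  by apply: hh; elim/I3P: i; elim/I3P: j; rewrite ?h10 ?h20 ?h21; lra.
have : `|\tr (A ^+ 3)| <= 27.
  rewrite cube_sum; apply: le_trans (ler_norm_sum _ _ _) _.
  have -> : 27 = \sum_(i < 3) (9 : R) by rewrite sumr_const card_ord -mulr_natr; ring.
  apply: ler_sum => i _; apply: le_trans (ler_norm_sum _ _ _) _.
  have -> : 9 = \sum_(i < 3) (3 : R) by rewrite sumr_const card_ord -mulr_natr; ring.
  apply: ler_sum => j _; apply: le_trans (ler_norm_sum _ _ _) _.
  have -> : 3 = \sum_(i < 3) (1 : R) by rewrite sumr_const card_ord.
  by apply: ler_sum => k _; rewrite !normrM !mulr_ile1.
rewrite ler_norml => /andP[h _]; move: h.
by set Y := \tr _; set a := (4 * _)^-1; set b := (12 * _)^-1; lra.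
Qed.

End Energies.

(** * Limits of minimizers *)

Section MatrixLimits.
Context {R : realType}.
Implicit Types (A : nat -> 'M[R]_3) (M : 'M[R]_3).

Definition cvgmx A := forall p : 'I_3 * 'I_3, cvgn (fun n => A n p.1 p.2).

(* The junk value [0] is fixed by conjugations, so that [limmx_conj] holds with
   no convergence assumption. *)
Definition limmx A : 'M[R]_3 :=
  \matrix_(i, j) (if `[< cvgmx A >] then limn (fun n => A n i j) else 0).

Lemma limmxP A : cvgmx A -> forall i j, A n i j @[n --> \oo] --> limmx A i j.
Proof. by move=> h i j; rewrite mxE; case: asboolP => // _; exact: (h (i, j)). Qed.

Lemma cvg_conj A M (L : 'M[R]_3) : (forall i j, A n i j @[n --> \oo] --> L i j) ->
  forall i j, (M *m A n *m M^T) i j @[n --> \oo] --> (M *m L *m M^T) i j.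
Proof.
move=> h i j; rewrite mxE; under eq_fun do rewrite mxE.
apply: cvg_finsum => k; apply: cvgM; last exact: cvg_cst.
rewrite mxE; under eq_fun do rewrite mxE.
by apply: cvg_finsum => l; apply: cvgM => //; exact: cvg_cst.
Qed.

Lemma cvgmx_conj A M : cvgmx A -> cvgmx (fun n => M *m A n *m M^T).
Proof.
move=> /limmxP h p; apply/cvg_ex; exists ((M *m limmx A *m M^T) p.1 p.2).
exact: cvg_conj.
Qed.

Lemma limmx_conj A M : M^T *m M = 1%:M ->
  limmx (fun n => M *m A n *m M^T) = M *m limmx A *m M^T.
Proof.
move=> hM; have [h|h] := pselect (cvgmx A).
  apply/matrixP => i j; have h1 := limmxP (cvgmx_conj (M := M) h) (i := i) (j := j).
  have h2 : (M *m A n *m M^T) i j @[n --> \oo] --> (M *m limmx A *m M^T) i j.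
    by apply: cvg_conj => i' j'; exact: limmxP.
  exact: (cvg_unique _ h1 h2).
have nh : ~ cvgmx (fun n => M *m A n *m M^T).
  move=> /(cvgmx_conj (M := M^T)); rewrite trmxK.
  rewrite (_ : (fun n => _) = A)//; apply/funext => n.
  by rewrite !mulmxA hM mul1mx -mulmxA hM mulmx1.
have z (X : nat -> 'M[R]_3) : ~ cvgmx X -> limmx X = 0.
  by move=> hX; apply/matrixP => i j; rewrite !mxE; case: asboolP.
by rewrite !z// mulmx0 mul0mx.
Qed.

Lemma rotz_orthogonal (alpha : R) : (rotz alpha)^T *m rotz alpha = 1%:M.
Proof.
apply/matrixP => i j; rewrite !mxE sum3E !mxE.
have := cos2Dsin2 alpha.
by elim/I3P: i; elim/I3P: j => /=; set c := cos alpha; set s := sin alpha => h; rewrite ?mulr1n ?mulr0n; lra.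
Qed.

End MatrixLimits.

Section HullProperties.
Context {R : realType}.
Local Notation mB1 := measurable_B1.
Local Notation B := (@B1 R : set (mR3 R)).
Local Notation sq := (sqint leb3 B).
Local Notation nB := (nsq leb3 B).
Local Notation J := ('I_3 * 'I_3)%type.
Local Notation I := (J * option 'I_3)%type.
Implicit Types (f g : I -> R3 R -> R) (w : nat -> I -> R3 R -> R).

Definition grads f : R := \sum_(p : J) \sum_(k < 3) nB (f (p, Some k)).

Lemma hull_sq w n f : (forall m i, sq (w m i)) -> hull w n f -> forall i, sq (f i).
Proof.
move=> hw; apply: (hull_ind_prop (P := fun f => forall i, sq (f i))) => // g h hg hh i.
exact (sqintZ mB1 2^-1 (sqintD mB1 (hg i) (hh i))).
Qed.

Lemma hull_traced (q : J -> R3 R -> R) w n f : (forall p, {within B1bar, continuous (q p)}) ->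
  (forall m p, traced (q p) (w m (p, None)) (fun k => w m (p, Some k))) ->
  hull w n f -> forall p, traced (q p) (f (p, None)) (fun k => f (p, Some k)).
Proof.
move=> cq hw; apply: (hull_ind_prop
  (P := fun f => forall p, traced (q p) (f (p, None)) (fun k => f (p, Some k)))) => //.
by move=> g h hg hh p; exact: (traced_mid (cq p) (hg p) (hh p)).
Qed.

Lemma hull_weak_partial w n f : (forall m i, sq (w m i)) ->
  (forall m p k, is_weak_partial B1 k (w m (p, None)) (w m (p, Some k))) ->
  hull w n f -> forall p k, is_weak_partial B1 k (f (p, None)) (f (p, Some k)).
Proof.
move=> sw hw hf.
suff: (forall i, sq (f i)) /\ forall p k, is_weak_partial B1 k (f (p, None)) (f (p, Some k)) by case.
move: f hf; apply: (hull_ind_prop (P := fun f => (forall i, sq (f i)) /\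
  forall p k, is_weak_partial B1 k (f (p, None)) (f (p, Some k)))) => // g h [sg hg] [sh hh].
split; first by move=> i; exact (sqintZ mB1 2^-1 (sqintD mB1 (sg i) (sh i))).
move=> p k; have := weak_partial_lin 2^-1 2^-1 (sg (p, None)) (sh (p, None)) (hg p k) (hh p k).
by congr is_weak_partial; apply/funext => x; rewrite /midpoint mulrDr.
Qed.

Lemma hull_grads w n f b : (forall m i, sq (w m i)) ->
  (forall m, (n <= m)%N -> grads (w m) <= b) -> hull w n f -> grads f <= b.
Proof.
move=> sw hw hf.
suff: (forall i, sq (f i)) /\ grads f <= b by case.
move: f hf; apply: (hull_ind_prop (P := fun f => (forall i, sq (f i)) /\ grads f <= b)).
  by move=> m nm; split => //; exact: hw.
move=> g h [sg hg] [sh hh]; split.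
  by move=> i; exact (sqintZ mB1 2^-1 (sqintD mB1 (sg i) (sh i))).
apply: (@le_trans _ _ ((grads g + grads h) / 2)); last by move: hg hh; set x := grads g; set y := grads h; lra.
rewrite /grads -big_split/= mulr_suml; apply: ler_sum => p _.
rewrite -big_split/= mulr_suml; apply: ler_sum => k _; exact (nsq_mid mB1 (sg _) (sh _)).
Qed.

Lemma hull_near w n f i x l (e : R) :
  (forall m, (n <= m)%N -> `|w m i x - l| <= e) -> hull w n f -> `|f i x - l| <= e.
Proof.
move=> hw; apply: (hull_ind_prop (P := fun f => `|f i x - l| <= e)) => // g h.
by rewrite /midpoint !ler_norml => /andP[a b] /andP[c d]; apply/andP; split; lra.
Qed.

End HullProperties.

Lemma le_double_sum {R : realType} (I K : finType) (F : I -> K -> R) i k :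
  (forall i k, 0 <= F i k) -> F i k <= \sum_i \sum_k F i k.
Proof.
move=> h; rewrite (bigD1 i)//= (bigD1 k)//= -addrA lerDl.
by apply: addr_ge0; apply: sumr_ge0 => ? _ //; exact: sumr_ge0.
Qed.

Section Convergence.
Context {R : realType}.
Implicit Types (Q P : R3 R -> 'M[R]_3) (k : 'I_3).
Local Notation mB1 := measurable_B1.
Local Notation B := (@B1 R : set (mR3 R)).
Local Notation sq := (sqint leb3 B).
Local Notation nB := (nsq leb3 B).
Local Notation wp := (wpartial B1).
Local Notation J := ('I_3 * 'I_3)%type.
Variables (lambda : R) (q Qb : R3 R -> 'M[R]_3).
Hypothesis lambda0 : 0 < lambda.
Hypothesis cq : forall i j, {within B1bar, continuous (fun x => q x i j)}.
Hypothesis qb : forall x, normsq3 x = 1 -> q x = Qb x.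
Hypothesis Aq : A_class Qb q.

(** [Qb] is meaningful on the sphere only. Its extension [q] has the same values there and is
    continuous on the closed ball, as the stability lemmas for [traced] require. *)
Lemma trace_class u i j :
  has_trace u (fun x => Qb x i j) <-> has_trace u (fun x => q x i j).
Proof.
have E (v : R3 R -> R) : sphere_integral (fun x => (v x - Qb x i j) ^+ 2) =
    sphere_integral (fun x => (v x - q x i j) ^+ 2).
  by apply: eq_sphere_integral => x /qb ->.
have F (v : nat -> R3 R -> R) :
    (fun n => sphere_integral (fun x => (v n x - Qb x i j) ^+ 2)) =
    (fun n => sphere_integral (fun x => (v n x - q x i j) ^+ 2)).
  by apply/funext => n; exact: E.
split=> -[v [h1 h2 h3 h4]]; exists v; split; [exact: h1|exact: h2|exact: h3| |
    exact: h1|exact: h2|exact: h3|].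
  by rewrite -F; exact: h4.
by rewrite F; exact: h4.
Qed.

Definition potE Q : \bar R := (\int[leb3]_(x in B) (lambda * `|Wpot (Q x)|)%:E)%E.
Definition penE Q : \bar R := (\int[leb3]_(x in B) ((1 - normsq (Q x)) ^+ 2)%:E)%E.

Lemma potE_ge0 Q : (0 <= potE Q)%E.
Proof. by apply: integral_ge0 => x _; rewrite lee_fin mulr_ge0// ltW. Qed.

Lemma penE_ge0 Q : (0 <= penE Q)%E.
Proof. by apply: integral_ge0 => x _; rewrite lee_fin sqr_ge0. Qed.

Lemma dirichlet_ge0 Q : 0 <= dirichlet Q.
Proof. by apply: sumr_ge0 => p _; apply: sumr_ge0 => k _; exact: nsq_ge0. Qed.

Variables (m : nat -> R) (Q_ : nat -> R3 R -> 'M[R]_3).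
Hypothesis hm : forall n, n.+1%:R <= m n.
Hypothesis hmin : forall n, minimizer (energyF lambda (m n)) (W12_class Qb) (Q_ n).

Let m0 n : 0 < m n. Proof. by apply: lt_le_trans (hm n). Qed.
Let hS0 n : W12_into B1 S0 (Q_ n). Proof. by case: (hmin n) => -[]. Qed.

(** An S^4-valued map is admissible for the relaxed problem and has no penalty, so its energy bounds
    that of [Q_ n] whatever the parameter. *)
Lemma energy_bound n P : A_class Qb P ->
  ((2^-1 * dirichlet (Q_ n))%:E + potE (Q_ n) + (m n / 4)%:E * penE (Q_ n) <= energyE lambda P)%E.
Proof.
move=> [hP tP]; have [hP0 E] := energyF_S4 lambda0 (ltW (m0 n)) hP.
have [_ /(_ P)] := hmin n; rewrite E => /(_ (conj hP0 tP)).
rewrite (energyF_split lambda0 (ltW (m0 n)) (hS0 n)) => h; apply: le_trans h; apply: leeD2l.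
rewrite le_eqVlt; apply/orP; left; apply/eqP.
apply: esym; under eq_integral do rewrite EFinM.
rewrite ge0_integralZl_EFin//; [exact: mB1| | |].
- by move=> x _; rewrite lee_fin sqr_ge0.
- apply/measurable_EFinP/measurable_funX/measurable_funB; first exact: measurable_cst.
  by apply: measurable_normsq => i j; exact: measurable_entry (hS0 n).
- by apply: divr_ge0 => //; exact: ltW.
Qed.

Let gn n : (0 <= (2^-1 * dirichlet (Q_ n))%:E)%E.
Proof. by rewrite lee_fin mulr_ge0// dirichlet_ge0. Qed.

Let pn n : (0 <= (m n / 4)%:E * penE (Q_ n))%E.
Proof. by apply: mule_ge0 (penE_ge0 _); rewrite lee_fin; apply: divr_ge0 => //; exact: ltW. Qed.

(** With K the energy of [q], the Dirichlet part is at most 2 K and the penalty integral at most 4 K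
    / (n + 1). The L^2 bound comes from the penalty as well: N = |Q|^2 satisfies N <= 2 + (1 -
    N)^2. *)
Lemma uniform_bounds : exists C : R, [/\ forall n, dirichlet (Q_ n) <= C,
  forall n p, nB (entry (Q_ n) p) <= C & forall n, (penE (Q_ n) <= (C / n.+1%:R)%:E)%E].
Proof.
have Efin := energyE_S4_lty lambda0 Aq.1.
have E0 : (0 <= energyE lambda q)%E.
  apply: le_trans (energy_bound 0 Aq); apply: adde_ge0 (pn 0).
  exact: adde_ge0 (gn 0) (potE_ge0 _).
pose K := fine (energyE lambda q).
have KE : energyE lambda q = K%:E by rewrite fineK// ge0_fin_numE.
have K0 : 0 <= K by rewrite -lee_fin -KE.
have d n : dirichlet (Q_ n) <= 2 * K.
  have : ((2^-1 * dirichlet (Q_ n))%:E <= K%:E)%E.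
    rewrite -KE; apply: le_trans (energy_bound n Aq); rewrite -addeA leeDl//.
    exact: adde_ge0 (potE_ge0 _) (pn n).
  by rewrite lee_fin; lra.
have pe n : (penE (Q_ n) <= (4 * K / n.+1%:R)%:E)%E.
  have h : ((n.+1%:R / 4)%:E * penE (Q_ n) <= K%:E)%E.
    rewrite -KE; apply: le_trans (energy_bound n Aq).
    apply: (@le_trans _ _ ((m n / 4)%:E * penE (Q_ n))%E).
      by apply: lee_wpmul2r; [exact: penE_ge0|rewrite lee_fin ler_pM2r].
    by apply: leeDr; exact: adde_ge0 (gn n) (potE_ge0 _).
  have one (N : R) : N != 0 -> 4 / N * (N / 4) = 1 by move=> N0; field.
  have n0 : 0 < (4 / n.+1%:R : R) by rewrite divr_gt0.
  have := lee_wpmul2l (x := (4 / n.+1%:R)%:E) _ h; rewrite lee_fin => /(_ (ltW n0)).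
  rewrite muleA -EFinM (_ : 4 / n.+1%:R * (n.+1%:R / 4) = 1); last by apply: one; rewrite pnatr_eq0.
  by rewrite mul1e -EFinM mulrAC.
pose V := fine (leb3 (B1 : set (mR3 R))).
have VE : leb3 (B1 : set (mR3 R)) = V%:E.
  by rewrite fineK// ge0_fin_numE ?leb3_B1_fin.
have V0 : 0 <= V by rewrite -lee_fin -VE.
exists (2 * V + 4 * K); split.
- by move=> n; apply: le_trans (d n) _; lra.
- move=> n p; have hW := W12_entry p (hS0 n).
  rewrite -lee_fin (nsqE mB1 hW.1).
  have mN : measurable_fun B (fun x => (1 - normsq (Q_ n x)) ^+ 2).
    apply/measurable_funX/measurable_funB; first exact: measurable_cst.
    by apply: measurable_normsq => i j; exact: measurable_entry (hS0 n).
  apply: (@le_trans _ _ (\int[leb3]_(x in B) (2 + (1 - normsq (Q_ n x)) ^+ 2)%:E)%E).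
    apply: ae_ge0_le_integral => //.
    + exact: mB1.
    + by move=> x _; rewrite lee_fin sqr_ge0.
    + by apply/measurable_EFinP/measurable_funX; case: hW.1.
    + by move=> x _; rewrite lee_fin addr_ge0// sqr_ge0.
    + by apply/measurable_EFinP/measurable_funD => //; exact: measurable_cst.
    apply: filterS (hS0 n).2 => x /[apply] /S0_entries[h10 h20 h21 _]; rewrite lee_fin /entry.
    set A := Q_ n x in h10 h20 h21 *.
    have h : A p.1 p.2 ^+ 2 <= normsq A.
      rewrite normsq_sum !sum3E h10 h20 h21.
      have := sqr_ge0 (A 0 0); have := sqr_ge0 (A 1 1); have := sqr_ge0 (A 2 2).
      have := sqr_ge0 (A 0 1); have := sqr_ge0 (A 0 2); have := sqr_ge0 (A 1 2) => k1 k2 k3 k4 k5 k6.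
      by case: p {hW} => i j /=; elim/I3P: i; elim/I3P: j; rewrite ?h10 ?h20 ?h21; lra.
    by apply: le_trans h _; set N := normsq A; have := sqr_ge0 (1 - N); have := sqr_ge0 N; nra.
  under eq_integral do rewrite EFinD.
  rewrite ge0_integralD//; [|exact: mB1| |].
  + rewrite integral_cst; last exact: mB1.
    rewrite (EFinD (2 * V)); apply: leeD; first by rewrite EFinM -VE.
    apply: le_trans (pe n) _; rewrite lee_fin ler_pdivrMr// ler_peMr//; first by lra.
    by rewrite ler1n.
  + by move=> x _; rewrite lee_fin sqr_ge0.
  + exact/measurable_EFinP.
- move=> n; apply: le_trans (pe n) _; rewrite lee_fin ler_wpM2r ?invr_ge0//; lra.
Qed.

(** Entries ([None]) and their weak derivatives ([Some k]) form one family, to which Mazur's lemma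
    is applied once. *)
Let w n (i : J * option 'I_3) : R3 R -> R :=
  if i.2 is Some k then wp k (entry (Q_ n) i.1) else entry (Q_ n) i.1.

Lemma sq_w n i : sq (w n i).
Proof.
case: i => p [k|] /=; first by apply: sq_wpartial; exact: W12_entry (hS0 n).
by have [] := W12_entry p (hS0 n).
Qed.

Lemma weak_partial_w n p k : is_weak_partial B1 k (w n (p, None)) (w n (p, Some k)).
Proof. by apply: wpartialP; exact: W12_entry (hS0 n). Qed.

Lemma traced_w n (p : J) :
  traced (fun x => q x p.1 p.2) (w n (p, None)) (fun k => w n (p, Some k)).
Proof.
apply: has_trace_traced; first exact: W12_entry (hS0 n).
by apply: (iffLR (trace_class _ p.1 p.2)); case: (hmin n) => -[_ h] _; exact: (h p.1 p.2).
Qed.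

Lemma cont_approx_w n p : cont_approx (w n (p, None)) (fun k => w n (p, Some k)).
Proof.
apply: (@has_trace_approx _ _ (fun x => q x p.1 p.2)); first exact: W12_entry (hS0 n).
by apply: (iffLR (trace_class _ p.1 p.2)); case: (hmin n) => -[_ h] _; exact: (h p.1 p.2).
Qed.

Variables (phi : nat -> nat) (a : R).
Hypothesis phi_ge : forall n, (n <= phi n)%N.
Hypothesis cvg_a : dirichlet (Q_ (phi n)) @[n --> \oo] --> a.
Hypothesis cvg_ae : {ae (@leb3 R), forall x, B1 x -> cvgmx (fun n => Q_ (phi n) x)}.

Definition Qlim (x : R3 R) : 'M[R]_3 := limmx (fun n => Q_ (phi n) x).

Lemma Qlim_cvg : {ae (@leb3 R), forall x, B1 x -> forall i j,
  Q_ (phi n) x i j @[n --> \oo] --> Qlim x i j}.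
Proof. by apply: filterS cvg_ae => x /[apply] h i j; exact: limmxP. Qed.

Lemma measurable_Qlim i j : measurable_fun B (fun x => Qlim x i j).
Proof.
have h := @measurable_joint_limit _ _ _ B mB1 _ (fun n (p : J) x => Q_ (phi n) x p.1 p.2) (i, j).
rewrite (_ : (fun x => _) = (fun x => if `[< cvgmx (fun n => Q_ (phi n) x) >]
  then limn (fun n => Q_ (phi n) x i j) else 0)); last by apply/funext => x; rewrite mxE.
by apply: h => n p; exact: measurable_entry (hS0 (phi n)).
Qed.

Lemma sq_Qlim p : sq (entry Qlim p).
Proof.
have [C [_ hC _]] := uniform_bounds.
have := @fatou_nsq _ _ _ leb3 B mB1 (fun n => entry (Q_ (phi n)) p) (entry Qlim p) C.
case=> // [n| |].
- exact: (sq_w (phi n) (p, None)).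
- exact: measurable_Qlim.
- by apply: filterS Qlim_cvg => x /[apply]; exact.
Qed.

Lemma cvg_nonneg0 (f : nat -> R) : (forall n, 0 <= f n) ->
  (forall e : R, 0 < e -> exists N, forall n, (N <= n)%N -> f n <= e) -> f @ \oo --> 0.
Proof.
move=> f0 h; apply/cvgrPdist_le => e e0; have [N hN] := h e e0.
by exists N => // n /= Nn; rewrite sub0r normrN ger0_norm// hN.
Qed.

(** The convex combinations are Cauchy in L^2 together with their gradients. The functions tend to
    [Qlim], identified by pointwise convergence; the gradients have a limit [g] by completeness, and
    this is the weak gradient of [Qlim]. The bound by [a] is the convexity of the Dirichlet
    energy. *)
Lemma Qlim_sobolev : dirichlet Qlim <= a /\
  forall p, W12 B1 (entry Qlim p) /\ has_trace (entry Qlim p) (fun x => q x p.1 p.2).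
Proof.
have [C [hD hC _]] := uniform_bounds.
have sw n i : sq (w (phi n) i) := sq_w (phi n) i.
have wC n i : nB (w (phi n) i) <= C.
  case: i => p [k|]; last exact: hC.
  have h := @le_double_sum _ _ _ (fun p k => nB (wp k (entry (Q_ (phi n)) p))) p k (fun _ _ => nsq_ge0 _ _ _).
  exact: le_trans h (hD (phi n)).
have [P [hP cP]] := mazur mB1 sw wC.
have sP n i : sq (P n i) := hull_sq sw (hP n) i.
have hg p k : exists g, sq g /\ forall e : R, 0 < e -> exists N, forall n, (N <= n)%N ->
    nB (fun x => P n (p, Some k) x - g x) <= e.
  by apply: (sqint_complete mB1 (fun n => sP n (p, Some k))); exact: (cP (p, Some k)).
pose g p k := sval (cid (hg p k)).
have [sg cg] : (forall p k, sq (g p k)) /\ forall p k,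
    nB (fun x => P n (p, Some k) x - g p k x) @[n --> \oo] --> 0.
  split=> p k; have [h1 h2] := svalP (cid (hg p k)); first exact: h1.
  by apply: cvg_nonneg0 => // n; exact: nsq_ge0.
(* The n-th combination involves indices at least [n] only, so at a point of convergence it stays as
   close to the limit as they do. *)
have Pae p : {ae (@leb3 R), forall x, B1 x ->
    P n (p, None) x @[n --> \oo] --> entry Qlim p x}.
  apply: filterS Qlim_cvg => x /[apply] /(_ p.1 p.2) hx.
  apply/cvgrPdist_le => e e0; have /cvgrPdist_le/(_ e e0)[N _ hN] := hx.
  exists N => // n /= Nn; rewrite distrC.
  apply: (hull_near (w := fun n => w (phi n)) (n := n)); last exact: hP.
  by move=> l nl; rewrite distrC; apply: hN; exact: leq_trans nl.
(* Fatou in the second index of the Cauchy estimate. *)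
have c0 p : nB (fun x => P n (p, None) x - entry Qlim p x) @[n --> \oo] --> 0.
  apply: cvg_nonneg0 => [n|e e0]; first exact: nsq_ge0.
  have [K hK] := cP (p, None) e e0; exists K => n Kn.
  have := @fatou_nsq _ _ _ leb3 B mB1 (fun l x => P n (p, None) x - P (l + K)%N (p, None) x)
    (fun x => P n (p, None) x - entry Qlim p x) e.
  case=> // [l| |l|].
  - exact (sqintB mB1 (sP _ _) (sP _ _)).
  - by apply: measurable_funB; [case: (sP n (p, None))|exact: measurable_Qlim].
  - by apply: hK => //; exact: leq_addl.
  - apply: filterS (Pae p) => x /[apply] hx; apply: cvgB; first exact: cvg_cst.
    by move: hx; rewrite -(cvg_shiftn K).
have wpart p k : is_weak_partial B1 k (entry Qlim p) (g p k).
  apply: (@weak_partial_limit _ k (fun n => P n (p, None)) (fun n => P n (p, Some k))) => //.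
  - exact: sq_Qlim.
  - move=> n; apply: (hull_weak_partial sw _ (hP n)) => l p' k'; exact: weak_partial_w.
have tr p : W12 B1 (entry Qlim p) /\ has_trace (entry Qlim p) (fun x => q x p.1 p.2).
  apply: (traced_has_trace (G := g p)) => //.
  apply: (@traced_limit _ _ (fun n => P n (p, None)) (fun n k => P n (p, Some k))) => //.
  - move=> n; apply: (hull_traced (q := fun p x => q x p.1 p.2) _ _ (hP n)) => //.
    by move=> l p'; exact: traced_w.
  - exact: sq_Qlim.
  - move=> e e0.
    have h1 : \forall n \near \oo, nB (fun x => P n (p, None) x - entry Qlim p x) <= e.
      by apply: filterS (cvgr_lt _ (c0 p) _ e0) => n /ltW.
    have h2 : \forall n \near \oo, forall k, nB (fun x => P n (p, Some k) x - g p k x) <= e.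
      apply: filter_forall => k.
      by apply: filterS (cvgr_lt _ (cg p k) _ e0) => n /ltW.
    by have [n [n1 n2]] := filter_ex (filterI h1 h2); exists n.
split => //.
have -> : dirichlet Qlim = \sum_p \sum_(k < 3) nB (g p k).
  apply: eq_bigr => p _; apply: eq_bigr => k _.
  apply: (ae_eq_nsq mB1) => //; first by apply: sq_wpartial; exact: (tr p).1.
  exact: wpartial_ae (tr p).1 (wpart p k).
have cv : grads (P n) @[n --> \oo] --> \sum_p \sum_(k < 3) nB (g p k).
  apply: cvg_finsum => p; apply: cvg_finsum => k.
  exact: (cvg_nsq mB1 (fun n => sP n (p, Some k)) (sg p k) (cg p k)).
apply/ler_addgt0Pr => e e0.
have /cvgrPdist_le/(_ e e0)[N _ hN] := cvg_a.
apply: (ler_cvg_to cv (cvg_cst (a + e))); exists N => // n /= Nn.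
apply: (hull_grads sw _ (hP n)) => l nl.
have := hN l (leq_trans Nn nl); rewrite /= distrC ler_norml => /andP[_].
by rewrite lerBlDl; exact.
Qed.

Lemma Qlim_S0 : {ae (@leb3 R), forall x, B1 x -> S0 (Qlim x)}.
Proof.
have h : {ae (@leb3 R), forall x, forall n, B1 x -> S0 (Q_ (phi n) x)}.
  by apply: ae_foralln => n; exact: (hS0 (phi n)).2.
apply: filterS2 Qlim_cvg h => x /[swap] h /[swap] Bx /(_ Bx) hc.
by apply: S0_limit hc _ => n; exact: h.
Qed.

Lemma measurable_pen Q : (forall i j, measurable_fun B (fun x => Q x i j)) ->
  measurable_fun B (fun x => (1 - normsq (Q x)) ^+ 2).
Proof.
move=> mQ; apply/measurable_funX/measurable_funB; first exact: measurable_cst.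
exact: measurable_normsq.
Qed.

Lemma measurable_pot Q : (forall i j, measurable_fun B (fun x => Q x i j)) ->
  measurable_fun B (fun x => lambda * `|Wpot (Q x)|).
Proof.
move=> mQ; apply: measurable_funM; first exact: measurable_cst.
by apply: measurableT_comp => //; exact: measurable_Wpot.
Qed.

Lemma penE_Qlim : penE Qlim = 0%E.
Proof.
have [C [_ hC hpen]] := uniform_bounds.
have C0 : 0 <= C := le_trans (nsq_ge0 _ _ _) (hC 0%N (0, 0)).
apply/eqP; rewrite eq_le penE_ge0 andbT; apply/lee_addgt0Pr => e e0; rewrite add0e.
have C1 : 0 < C + 1 by lra.
have [N _ hN] := near_infty_natSinv_lt (PosNum (divr_gt0 e0 C1)).
apply: (@fatou_ae _ _ _ leb3 B mB1 (fun n x => (1 - normsq (Q_ (phi (n + N)%N) x)) ^+ 2)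
  (fun x => (1 - normsq (Qlim x)) ^+ 2)).
- by move=> n; apply: measurable_pen => i j; exact: measurable_entry (hS0 _).
- by apply: measurable_pen => i j; exact: measurable_Qlim.
- by move=> n x _; exact: sqr_ge0.
- by move=> x _; exact: sqr_ge0.
- move=> n; apply: le_trans (hpen (phi (n + N)%N)) _; rewrite lee_fin.
  have Nn : (N <= phi (n + N))%N by apply: leq_trans (phi_ge _); exact: leq_addl.
  have := hN _ Nn; rewrite /= ltr_pdivlMr// => h.
  apply: le_trans (ltW h); rewrite mulrC ler_wpM2l ?invr_ge0//; lra.
- apply: filterS Qlim_cvg => x /[apply] hx.
  have hx' : forall i j, Q_ (phi (n + N)%N) x i j @[n --> \oo] --> Qlim x i j.
    by move=> i j; have := hx i j; rewrite -(cvg_shiftn N).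
  have c1 : 1 - normsq (Q_ (phi (n + N)%N) x) @[n --> \oo] --> 1 - normsq (Qlim x).
    by apply: cvgB; [exact: cvg_cst|exact: cvg_normsq].
  by rewrite expr2; under eq_fun do rewrite expr2; exact: cvgM.
Qed.

Lemma Qlim_class : A_class Qb Qlim.
Proof.
have [_ tr] := Qlim_sobolev; split; last first.
  by move=> i j; apply: (iffRL (trace_class _ i j)); exact: (tr (i, j)).2.
split; first by move=> i j; exact: (tr (i, j)).1.
have mp : measurable_fun B (fun x => ((1 - normsq (Qlim x)) ^+ 2)%:E).
  by apply/measurable_EFinP; apply: measurable_pen => i j; exact: measurable_Qlim.
have h : ae_eq leb3 B (fun x => ((1 - normsq (Qlim x)) ^+ 2)%:E) (cst 0%E).
  apply: (iffLR (ae_eq_integral_abs leb3 mB1 mp)); rewrite -[RHS]penE_Qlim.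
  by apply: eq_integral => x _; rewrite gee0_abs// lee_fin sqr_ge0.
apply: filterS2 h Qlim_S0 => x /= h1 h2 Bx; split; first exact: h2.
have [] := h1 Bx => /eqP; rewrite sqrf_eq0 subr_eq0 => /eqP.
by move=> ->.
Qed.

(** Dirichlet part and potential are treated separately: the first is at most its limit [a] along
    the sequence, the second goes by Fatou, and an error [e] links the two. *)
Lemma Qlim_energy P : A_class Qb P -> (energyE lambda Qlim <= energyE lambda P)%E.
Proof.
move=> hP; have hQ := Qlim_class.
have [hQ0 _] := energyF_S4 lambda0 (lexx 0) hQ.1.
have Efin := energyE_S4_lty lambda0 hP.1.
have E0 : (0 <= energyE lambda P)%E.
  apply: le_trans (energy_bound 0 hP); apply: adde_ge0 (pn 0).
  exact: adde_ge0 (gn 0) (potE_ge0 _).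
pose r := fine (energyE lambda P).
have rE : energyE lambda P = r%:E by rewrite fineK// ge0_fin_numE.
rewrite rE energyE_split//; apply/lee_addgt0Pr => e e0.
have /cvgrPdist_le/(_ e e0)[N _ hN] := cvg_a.
(* From index [N] on the Dirichlet energies exceed a - e, which leaves at most r - (a - e)/2 for the
   potential. *)
have pot : (potE Qlim <= (r - 2^-1 * (a - e))%:E)%E.
  apply: (@fatou_ae _ _ _ leb3 B mB1 (fun n x => lambda * `|Wpot (Q_ (phi (n + N)%N) x)|)
    (fun x => lambda * `|Wpot (Qlim x)|)).
  - by move=> n; apply: measurable_pot => i j; exact: measurable_entry (hS0 _).
  - by apply: measurable_pot => i j; exact: measurable_Qlim.
  - by move=> n x _; rewrite mulr_ge0// ltW.
  - by move=> x _; rewrite mulr_ge0// ltW.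
  - move=> n; set l := phi (n + N)%N.
    have h1 : ((2^-1 * dirichlet (Q_ l))%:E + potE (Q_ l) <= r%:E)%E.
      by rewrite -rE; apply: le_trans (energy_bound l hP); apply: leeDl; exact: pn.
    have h2 : a - e <= dirichlet (Q_ l).
      have := hN (n + N)%N (leq_addl _ _); rewrite /= ler_norml => /andP[_].
      by rewrite -/l; lra.
    have h3 : ((2^-1 * (a - e))%:E + potE (Q_ l) <= r%:E)%E.
      by apply: le_trans h1; apply: leeD2r; rewrite lee_fin; lra.
    by rewrite EFinB leeBrDl.
  - apply: filterS Qlim_cvg => x /[apply] hx.
    apply: cvgM; first exact: cvg_cst.
    apply: cvg_norm; apply: cvg_Wpot => i j.
    by have := hx i j; rewrite -(cvg_shiftn N).
have [ha _] := Qlim_sobolev.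
apply: (@le_trans _ _ ((2^-1 * a)%:E + (r - 2^-1 * (a - e))%:E)%E).
  by apply: leeD => //; rewrite lee_fin; lra.
by rewrite -!EFinD lee_fin; lra.
Qed.

(** The angle is fixed, so the exceptional sets are countably many. Off them the sequence at the
    rotated point is the conjugate of the sequence at [x]: both converge or both diverge, and
    [limmx_conj] covers either case. *)
Lemma Qlim_equivariant : (forall n, equivariant (Q_ n)) -> equivariant Qlim.
Proof.
move=> h alpha.
have hn : {ae (@leb3 R), forall x, forall n, B1 x ->
    Q_ (phi n) (of_col (rotz alpha *m to_col x)) =
    rotz alpha *m Q_ (phi n) x *m (rotz alpha)^T}.
  by apply: ae_foralln => n; exact: h.
apply: filterS hn => x hx Bx.
rewrite -limmx_conj; last exact: rotz_orthogonal.
by congr limmx; apply/funext => n; exact: hx.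
Qed.

End Convergence.

Section Compactness.
Context {R : realType}.
Implicit Types (Q : R3 R -> 'M[R]_3).

Theorem equivariant_minimizer_limit (lambda : R) (q Qb : R3 R -> 'M[R]_3) (m : nat -> R)
    (Q_ : nat -> R3 R -> 'M[R]_3) : 0 < lambda ->
  (forall i j, {within B1bar, continuous (fun x => q x i j)}) ->
  (forall x, normsq3 x = 1 -> q x = Qb x) -> A_class Qb q ->
  (forall n, n.+1%:R <= m n) ->
  (forall n, minimizer (energyF lambda (m n)) (W12_class Qb) (Q_ n)) ->
  (forall n, equivariant (Q_ n)) ->
  exists Q, minimizer (energyE lambda) (A_class Qb) Q /\ equivariant Q.
Proof.
move=> l0 cq qb Aq hm hmin hequi.
have [C [hD hC _]] := uniform_bounds l0 Aq hm hmin.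
have [phi [a [phi_ge cvg_a hcv]]] : exists (phi : nat -> nat) (l : R), [/\
    forall k, (k <= phi k)%N, dirichlet (Q_ (phi k)) @[k --> \oo] --> l &
    forall p, {ae (@leb3 R), forall x, B1 x -> cvgn (fun k => entry (Q_ (phi k)) p x)}].
  apply: (@rellich R _ (fun n p => entry (Q_ n) p)
    (fun n p k => wpartial B1 k (entry (Q_ n) p)) C (fun n => dirichlet (Q_ n))).
  - by move=> n p; exact: (cont_approx_w qb hmin n p).
  - exact: hC.
  - move=> n p k; apply: le_trans (hD n).
    exact: (@le_double_sum _ _ _ (fun p k => nsq leb3 B1 (wpartial B1 k (entry (Q_ n) p))) p k (fun _ _ => nsq_ge0 _ _ _)).
  - by move=> n; rewrite ger0_norm ?dirichlet_ge0.
have cvg_ae : {ae (@leb3 R), forall x, B1 x -> cvgmx (fun n => Q_ (phi n) x)}.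
  have h : {ae (@leb3 R), forall x, forall p, B1 x -> cvgn (fun k => entry (Q_ (phi k)) p x)}.
    by apply: filter_forall => p; exact: hcv.
  by apply: filterS h => x h Bx p; exact: h.
exists (Qlim Q_ phi); split; last exact: Qlim_equivariant.
split; first exact: (Qlim_class l0 cq qb Aq hm hmin phi_ge cvg_a cvg_ae).
by move=> P; exact: (Qlim_energy l0 cq qb Aq hm hmin phi_ge cvg_a cvg_ae).
Qed.

End Compactness.

Lemma Qext_class {R : realType} (nu : R) : 0 < nu -> A_class (Qmu 1 nu%:C) (Qext nu).
Proof.
move=> nu0; split.
  split; first by move=> i j; exact: C1_W12 (C1_Qext nu0 i j).
  by apply: aeW => x Bx; apply: S4_Qext => //; exact: ltW.
move=> i j; have hW := C1_W12 (C1_Qext nu0 i j).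
(* Continuous on the closed ball, [Qext] is its own approximating sequence. *)
exists (fun _ x => Qext nu x i j); split.
- by move=> _.
- by move=> _; exact: Qext_cont.
- rewrite (_ : (fun n => _) = (fun=> 0%E)); first exact: cvg_cst.
  apply/funext => _; rewrite /W12_distsq -[RHS](integral0 leb3 (B1 : set (mR3 R))).
  apply: eq_integral => x _; rewrite subrr expr0n add0r big1// => k _.
  by rewrite subrr expr0n.
- rewrite (_ : (fun n => _) = (fun=> 0%E)); first exact: cvg_cst.
  apply/funext => _; rewrite (eq_sphere_integral (g := fun=> 0)); last first.
    by move=> x /(Qext_sphere nu0) ->; rewrite subrr expr0n.
  apply: integral0_eq => t _; apply: integral0_eq => p _.
  by rewrite mul0r.
Qed.

Theorem corollary7p16 (R : realType) (lambda : R) (hlambda : 0 < lambda)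
    (nu : nat -> R) (hnu_pos : forall j, 0 < nu j)
    (hnu_dec : nonincreasing_seq nu) (hnu_lim : nu @ \oo --> (0 : R))
    (j : nat)
    (hj : forall Q : R3 R -> 'M[R]_3,
      minimizer (energyE lambda) (A_class (Qmu 1 (nu j)%:C)) Q ->
      ~ equivariant Q) :
  exists mu0 : R, 0 < mu0 /\
    forall mu : R, mu0 <= mu -> forall Q : R3 R -> 'M[R]_3,
      minimizer (energyF lambda mu) (W12_class (Qmu 1 (nu j)%:C)) Q ->
      ~ equivariant Q.
Proof.
apply: contrapT => h.
have counterexample n : exists s : R * (R3 R -> 'M[R]_3), [/\ n.+1%:R <= s.1,
    minimizer (energyF lambda s.1) (W12_class (Qmu 1 (nu j)%:C)) s.2 & equivariant s.2].
  (* [n.+1] rather than [n], as a threshold must be positive also for n = 0. *)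
  apply: contrapT => hn; apply: h; exists n.+1%:R; split => // mu hmu Q hQ eQ.
  by apply: hn; exists (mu, Q).
have [s hs] := choice counterexample.
have [|||n|n|n|Q [hQ eQ]] := equivariant_minimizer_limit (q := Qext (nu j))
  (Qb := Qmu 1 (nu j)%:C) (m := fun n => (s n).1) (Q_ := fun n => (s n).2) hlambda.
- by move=> i k; exact: Qext_cont.
- by move=> x /(Qext_sphere (hnu_pos j)).
- exact: Qext_class.
- by case: (hs n).
- by case: (hs n).
- by case: (hs n).
- exact: hj hQ eQ.
Qed.
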